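(* Let $\{\xi(t),t\ge 0\}$ be a Lévy process such that $\psi(u):=\log \mathbb E e^{u\xi(1)}$ is finite for all $u\in\mathbb R$, and let $\xi_i$, $i\in\mathbb N$, be independent copies of $\xi$. Let $Z_N(t)=\sum_{i=1}^N e^{\xi_i(t)}$, $t\ge0$ (i.e. the case $s_N=0$). Then for every $T>0$, \[ \frac{Z_N(\cdot)-\mathbb E Z_N(\cdot)}{\sqrt N}\Longrightarrow \mathcal G(\cdot),\qquad N\to\infty, \] weakly on the Skorokhod space $D[0,T]$, where $\{\mathcal G(t),t\ge0\}$ is a zero-mean Gaussian process with covariance \[ \operatorname{Cov}(\mathcal G(t_1),\mathcal G(t_2))=e^{\psi(2)t_1+\psi(1)(t_2-t_1)}-e^{\psi(1)(t_1+t_2)},\qquad 0\le t_1\le t_2 . \]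
   Context: A Lévy process is a process with stationary independent increments and càdlàg sample paths, started at $0$. It is assumed throughout that $\xi(1)$ is not almost surely constant. *)

(* Defs.v *)
From HB Require Import structures.
From mathcomp Require Import all_boot all_order all_algebra.
From mathcomp Require Import all_classical all_reals all_analysis.
Set Implicit Arguments.
Unset Strict Implicit.
Unset Printing Implicit Defensive.
Import Order.TTheory GRing.Theory Num.Theory.
Import numFieldNormedType.Exports.
Local Open Scope classical_set_scope.
Local Open Scope ring_scope.

Section Defs.
Context {R : realType}.

Definition cadlag_path (x : R -> R) : Prop :=
  (forall t, 0 <= t -> x @ t^'+ --> x t) /\
  (forall t, 0 < t -> [cvg x @ t^'- in R]).

(** Membership in the Skorokhod space D[0,T] (only the restriction of the
    path to [0,T] matters). *)
Definition cadlag_on (T : R) (x : R -> R) : Prop :=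
  (forall t, 0 <= t < T -> x @ t^'+ --> x t) /\
  (forall t, 0 < t <= T -> [cvg x @ t^'- in R]).

Definition time_change (T : R) (lam : R -> R) : Prop :=
  [/\ lam 0 = 0, lam T = T, {within `[0, T], continuous lam} &
      (forall s t, 0 <= s -> s < t -> t <= T -> lam s < lam t)].

(** Continuity of f : D[0,T] -> R w.r.t. the Skorokhod (J1) metric
    d(x,y) = inf_{lam in Lambda_T} max(sup|lam - id|, sup|x - y o lam|). *)
Definition skorokhod_continuous (T : R) (f : (R -> R) -> R) : Prop :=
  forall x, cadlag_on T x -> forall e : R, 0 < e ->
  exists2 delta : R, 0 < delta &
    forall y lam, cadlag_on T y -> time_change T lam ->
      (forall t, 0 <= t <= T -> `|lam t - t| < delta /\ `|x t - y (lam t)| < delta) ->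
      `|f x - f y| < e.

Section OnSpace.
Context {d : measure_display} {Omega : measurableType d}.
Variable P : probability Omega R.

Definition levy_process (X : R -> Omega -> R) : Prop :=
  [/\ (forall t, 0 <= t -> measurable_fun setT (X t)),
      (forall w, cadlag_path (fun t => X t w)),
      P [set w | X 0 w = 0] = 1%E,
      (forall (n : nat) (ts : nat -> R), 0 <= ts 0%N ->
         (forall k, (k < n)%N -> ts k < ts k.+1) ->
         forall B : nat -> set R, (forall k, measurable (B k)) ->
         P (\bigcap_(k in `I_n) [set w | B k (X (ts k.+1) w - X (ts k) w)]) =
         (\prod_(k < n) P [set w | B k ((X (ts k.+1) w - X (ts k) w)%R)])%E) &
      (forall s t, 0 <= s -> 0 <= t -> forall B : set R, measurable B ->
         P [set w | B (X (s + t) w - X s w)] = P [set w | B (X t w - X 0 w)])].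

Definition iid_copies (xi : nat -> R -> Omega -> R) : Prop :=
  (forall (i m : nat) (ts : nat -> R) (B : nat -> set R),
     (forall k, 0 <= ts k) -> (forall k, measurable (B k)) ->
     P (\bigcap_(k in `I_m) [set w | B k (xi i (ts k) w)]) =
     P (\bigcap_(k in `I_m) [set w | B k (xi 0%N (ts k) w)])) /\
  (forall (n m : nat) (ts : nat -> R) (B : nat -> nat -> set R),
     (forall k, 0 <= ts k) -> (forall i k, measurable (B i k)) ->
     P (\bigcap_(i in `I_n) \bigcap_(k in `I_m) [set w | B i k (xi i (ts k) w)]) =
     (\prod_(i < n) P (\bigcap_(k in `I_m) [set w | B i k (xi i (ts k) w)]))%E).

Definition log_mgf (X : Omega -> R) (u : R) : R :=
  ln (fine (\int[P]_w (expR (u * X w))%:E)).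

Definition ZN (xi : nat -> R -> Omega -> R) (N : nat) (t : R) (w : Omega) : R :=
  \sum_(i < N) expR (xi i t w).

Definition normalized_ZN (xi : nat -> R -> Omega -> R) (N : nat) (w : Omega) : R -> R :=
  fun t => (ZN xi N t w - fine (\int[P]_v (ZN xi N t v)%:E)) / Num.sqrt N%:R.

Definition weak_conv_D (T : R) {d' : measure_display} {Om' : measurableType d'}
  (Q : probability Om' R) (X : nat -> Omega -> (R -> R)) (G : Om' -> (R -> R)) : Prop :=
  forall f : (R -> R) -> R, skorokhod_continuous T f ->
    (exists M : R, forall x, `|f x| <= M) ->
    (fun N => (\int[P]_w (f (X N w))%:E)%E) @ \oo --> (\int[Q]_w (f (G w))%:E)%E.

Definition centered_gaussian_process (G : R -> Omega -> R) (K : R -> R -> R) : Prop :=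
  (forall t, 0 <= t -> measurable_fun setT (G t)) /\
  forall (n : nat) (ts : nat -> R) (c : nat -> R), (forall k, 0 <= ts k) ->
    let Y := fun w => \sum_(k < n) c k * G (ts k) w in
    let v := \sum_(j < n) \sum_(k < n) c j * c k * K (ts j) (ts k) in
    [/\ 0 <= v,
        v = 0 -> P [set w | Y w = 0] = 1%E &
        0 < v -> forall B : set R, measurable B ->
          P (Y @^-1` B) = normal_prob 0 (Num.sqrt v) B].

End OnSpace.

Definition cov_fn (psi : R -> R) (s t : R) : R :=
  let a := Num.min s t in let b := Num.max s t in
  expR (psi 2 * a + psi 1 * (b - a)) - expR (psi 1 * (a + b)).

End Defs.

(* Main.v *)
(** Put psi = log_mgf, c = psi(1), gam = psi(2) - 2 c >= 0.  The processes
    Y_i(t) = exp(xi_i(t) - c t) are independent martingales of mean 1, and the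
    normalized sum is e^(ct) M_N(t) with M_N = N^(-1/2) sum_i (Y_i - 1).  Its limit
    is e^(ct) e^(gam t) B(1 - e^(-gam t)) for a Brownian bridge B, realized on the
    unit interval as a Schauder series in normal variables read off the binary
    digits.

    Finite-dimensional convergence is first proved for cosines of linear
    combinations (a Lindeberg-type recursion with fourth moments) and carried to
    bounded Lipschitz functions by tightness and Bernstein polynomials in sines.
    The fourth moment of an increment of M_N over a length h is O(h/N + h^2), so
    Doob's inequality for fourth powers controls the oscillation of M_N over a fine
    grid; as the limit is continuous, only the continuity of the functional f for
    the sup norm is needed.  Finally f is bounded below by its n-Lipschitz
    envelopes evaluated at piecewise linear interpolations of the path.  Applied to
    f and -f this sandwiches the integral of f(Z_N), which need not be measurable. *)
Require Import Defs.
From HB Require Import structures.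
From mathcomp Require Import all_boot all_order all_algebra.
From mathcomp Require Import all_classical all_reals all_analysis.
From mathcomp Require Import measurable_realfun ring lra.
Set Implicit Arguments.
Unset Strict Implicit.
Unset Printing Implicit Defensive.
Import Order.TTheory GRing.Theory Num.Theory.
Import numFieldNormedType.Exports.
Local Open Scope classical_set_scope.
Local Open Scope ring_scope.

(** * Expectations *)

Section Expectation.
Context {d : measure_display} {T : measurableType d} {R : realType}.
Variable P : probability T R.
Implicit Types X Y : T -> R.

(** Fourth moments enter because all T/h blocks of length h must be controlled together. Variances
    give a bound of order h per block, and its sum does not become small; h/N + h^2 sums to order
    1/N + h. The term h/N is the trace of the jumps, which only averaging over the copies removes,
    so the grid is fixed first and N tends to infinity on it. Cosines with an arbitrary phase
    replace characteristic functions: the phase -pi/2 gives the sine, no complex integral occurs,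
    and products of cosines are again sums of cosines. The bridge is used rather than Brownian
    motion because its clock 1 - e^(-gam t) stays in [0, 1): one series on a compact interval serves
    every horizon, and gam = 0 needs no separate case. *)

Definition L1 X := P.-integrable setT (EFin \o X).

Definition Ex X : R := \int[P]_w X w.

Definition bmeas X := measurable_fun setT X /\ exists M : R, forall w, `|X w| <= M.

(** The working class of random variables. Unlike [L1] it is closed under products, so the
    integrability conditions in moment computations reduce to closure lemmas. *)
Definition mom X :=
  measurable_fun setT X /\ forall n : nat, L1 (fun w => `|X w| ^+ n).

Lemma L1_le X Y : measurable_fun setT X -> (forall w, `|X w| <= Y w) -> L1 Y -> L1 X.
Proof.
move=> mX XY; apply: le_integrable => //; first exact/measurable_EFinP.
by move=> w _ /=; rewrite lee_fin (le_trans (XY w))// ler_norm.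
Qed.

Lemma L1_cst (c : R) : L1 (fun _ => c).
Proof. exact: finite_measure_integrable_cst. Qed.

Lemma L1D X Y : L1 X -> L1 Y -> L1 (fun w => X w + Y w).
Proof. by move=> ? ?; rewrite /L1 -[EFin \o _]/((EFin \o X) \+ (EFin \o Y))%E; exact: integrableD. Qed.

Lemma L1Z (c : R) X : L1 X -> L1 (fun w => c * X w).
Proof. by move=> ?; rewrite /L1 -[EFin \o _]/(fun w => c%:E * (EFin \o X) w)%E; exact: integrableZl. Qed.

Lemma L1N X : L1 X -> L1 (fun w => - X w).
Proof. by move=> /(L1Z (-1)); congr L1; apply/funext => w; rewrite mulN1r. Qed.

Lemma L1B X Y : L1 X -> L1 Y -> L1 (fun w => X w - Y w).
Proof. by move=> hX /L1N; exact: L1D. Qed.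

Lemma bmeas_L1 X : bmeas X -> L1 X.
Proof. by move=> [mX [M XM]]; apply: (L1_le mX XM); exact: L1_cst. Qed.

Lemma bmeas_mom X : bmeas X -> mom X.
Proof.
move=> [mX [M XM]]; split => // n; apply: bmeas_L1; split.
  by apply: measurable_funX; exact: measurableT_comp.
exists (M ^+ n) => w; rewrite ger0_norm ?exprn_ge0//.
by rewrite lerXn2r// nnegrE// (le_trans _ (XM w)).
Qed.

Lemma mom_L1 X : mom X -> L1 X.
Proof.
by move=> [mX /(_ 1%N)]; apply: L1_le => // w; rewrite expr1.
Qed.

Lemma mom_cst (c : R) : mom (fun _ => c).
Proof. by apply: bmeas_mom; split; [exact: measurable_cst|exists `|c|]. Qed.

Lemma mom_indic (A : set T) : measurable A -> mom (\1_A : T -> R).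
Proof.
move=> mA; apply: bmeas_mom; split; first exact: measurable_indic.
by exists 1 => w; rewrite indicE; case: (_ \in _); rewrite ?normr1 ?normr0.
Qed.

Lemma exprD_le_max (n : nat) (x y : R) : 0 <= x -> 0 <= y ->
  (x + y) ^+ n <= 2 ^+ n * (x ^+ n + y ^+ n).
Proof.
move=> x0 y0; wlog xy : x y x0 y0 / x <= y.
  by move=> W; case: (leP x y) => [|/ltW] xy; [|rewrite addrC [x ^+ _ + _]addrC]; exact: W.
rewrite (@le_trans _ _ ((2 * y) ^+ n))//.
  by rewrite lerXn2r// ?nnegrE; lra.
by rewrite exprMn ler_wpM2l// ?exprn_ge0// lerDr exprn_ge0.
Qed.

Lemma momD X Y : mom X -> mom Y -> mom (fun w => X w + Y w).
Proof.
move=> [mX hX] [mY hY]; split; first exact: measurable_funD.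
move=> n; apply: (@L1_le _ (fun w => 2 ^+ n * (`|X w| ^+ n + `|Y w| ^+ n))).
- by apply: measurable_funX; apply: measurableT_comp => //; exact: measurable_funD.
- move=> w; rewrite ger0_norm ?exprn_ge0//.
  apply: (le_trans _ (exprD_le_max n (normr_ge0 (X w)) (normr_ge0 (Y w)))).
  by rewrite lerXn2r// ?nnegrE ?addr_ge0// ler_normD.
- by apply: L1Z; exact: L1D.
Qed.

Lemma momM X Y : mom X -> mom Y -> mom (fun w => X w * Y w).
Proof.
move=> [mX hX] [mY hY]; split; first exact: measurable_funM.
move=> n; apply: (@L1_le _ (fun w => `|X w| ^+ (2 * n) + `|Y w| ^+ (2 * n))).
- by apply: measurable_funX; apply: measurableT_comp => //; exact: measurable_funM.
- move=> w; rewrite ger0_norm ?exprn_ge0// normrM exprMn mulnC !exprM.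
  by have := sqr_ge0 (`|X w| ^+ n - `|Y w| ^+ n); nra.
- exact: L1D.
Qed.

Lemma momZ (c : R) X : mom X -> mom (fun w => c * X w).
Proof. by move=> ?; apply: momM => //; exact: mom_cst. Qed.

Lemma momN X : mom X -> mom (fun w => - X w).
Proof. by move=> /(momZ (-1)); congr mom; apply/funext => w; rewrite mulN1r. Qed.

Lemma momB X Y : mom X -> mom Y -> mom (fun w => X w - Y w).
Proof. by move=> hX /momN; exact: momD. Qed.

Lemma momX (n : nat) X : mom X -> mom (fun w => X w ^+ n).
Proof.
move=> hX; elim: n => [|n ih]; first exact: mom_cst.
by under [X in mom X]funext do rewrite exprS; exact: momM.
Qed.

Lemma mom_norm X : mom X -> mom (fun w => `|X w|).
Proof.
move=> [mX hX]; split; first exact: measurableT_comp.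
by move=> n; under [X in L1 X]funext do rewrite normr_id.
Qed.

Lemma mom_sum (I : Type) (s : seq I) (F : I -> T -> R) :
  (forall i, mom (F i)) -> mom (fun w => \sum_(i <- s) F i w).
Proof.
move=> hF; elim: s => [|i s ih].
  by under [X in mom X]funext do rewrite big_nil; exact: mom_cst.
by under [X in mom X]funext do rewrite big_cons; exact: momD.
Qed.

Lemma ExE X : L1 X -> (\int[P]_w (X w)%:E)%E = (Ex X)%:E.
Proof. by move=> hX; rewrite fineK//; exact: integrable_fin_num. Qed.

Lemma Ex_cst (c : R) : Ex (fun _ => c) = c.
Proof. by rewrite /Ex Rintegral_cst//; rewrite [X in fine X]probability_setT mulr1. Qed.

Lemma ExD X Y : L1 X -> L1 Y -> Ex (fun w => X w + Y w) = Ex X + Ex Y.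
Proof. by move=> ? ?; rewrite /Ex RintegralD. Qed.

Lemma ExB X Y : L1 X -> L1 Y -> Ex (fun w => X w - Y w) = Ex X - Ex Y.
Proof. by move=> ? ?; rewrite /Ex RintegralB. Qed.

Lemma ExZ (c : R) X : L1 X -> Ex (fun w => c * X w) = c * Ex X.
Proof. by move=> ?; rewrite /Ex RintegralZl. Qed.

Lemma Ex_sum (I : Type) (s : seq I) (F : I -> T -> R) :
  (forall i, L1 (F i)) -> Ex (fun w => \sum_(i <- s) F i w) = \sum_(i <- s) Ex (F i).
Proof.
move=> hF; have [] : L1 (fun w => \sum_(i <- s) F i w) /\
  Ex (fun w => \sum_(i <- s) F i w) = \sum_(i <- s) Ex (F i); last by [].
elim: s => [|i s [ih1 ih2]].
  under [X in L1 X]funext do rewrite big_nil; under [X in Ex X]funext do rewrite big_nil.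
  by rewrite Ex_cst big_nil; split => //; exact: L1_cst.
under [X in L1 X]funext do rewrite big_cons; under [X in Ex X]funext do rewrite big_cons.
by rewrite ExD// big_cons ih2; split => //; exact: L1D.
Qed.

Lemma Ex_le X Y : L1 X -> L1 Y -> (forall w, X w <= Y w) -> Ex X <= Ex Y.
Proof. by move=> ? ? XY; apply: le_Rintegral => // w _; exact: XY. Qed.

Lemma Ex_ge0 X : (forall w, 0 <= X w) -> 0 <= Ex X.
Proof. by move=> X0; apply: Rintegral_ge0. Qed.

Lemma normr_Ex X : L1 X -> `|Ex X| <= Ex (fun w => `|X w|).
Proof. by move=> hX; apply: le_normr_Rintegral. Qed.

Lemma L1_norm X : L1 X -> L1 (fun w => `|X w|).
Proof. by move=> /integrable_norm. Qed.

Lemma Ex_bound X (M : R) : measurable_fun setT X -> (forall w, `|X w| <= M) -> `|Ex X| <= M.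
Proof.
move=> mX XM; have hX : L1 X by apply: bmeas_L1; split => //; exists M.
rewrite (le_trans (normr_Ex hX))// -[leRHS](Ex_cst M); apply: Ex_le => //.
- exact: L1_norm.
- exact: L1_cst.
Qed.

Lemma Ex_indic (A : set T) : measurable A -> Ex (\1_A) = fine (P A).
Proof. by move=> mA; rewrite /Ex /Rintegral integral_indic// setIT. Qed.

Lemma fine_prob01 (A : set T) : measurable A -> 0 <= fine (P A) <= 1.
Proof.
move=> mA; apply/andP; split; first exact/fine_ge0/measure_ge0.
by rewrite -[leRHS]/(fine 1%E) fine_le ?fin_num_measure//; exact: probability_le1.
Qed.

Lemma measurable_lt_set X Y : measurable_fun setT X -> measurable_fun setT Y ->
  measurable [set w | X w < Y w].
Proof.
move=> mX mY; rewrite -[X in measurable X]setTI.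
by apply: (measurable_fun_ltr mX mY).
Qed.

Lemma measurable_gt_norm X (c : R) : measurable_fun setT X -> measurable [set w | c < `|X w|].
Proof.
by move=> mX; apply: measurable_lt_set => //; exact: measurableT_comp.
Qed.

Lemma Ex_markov (n : nat) X (e : R) : mom X -> 0 < e ->
  fine (P [set w | e < `|X w|]) <= Ex (fun w => `|X w| ^+ n) / e ^+ n.
Proof.
move=> [mX hX] e0; have mA := measurable_gt_norm e mX.
rewrite -Ex_indic// mulrC -ExZ//; apply: Ex_le.
- exact/mom_L1/mom_indic.
- exact: L1Z.
- move=> w; rewrite indicE; case: (boolP (w \in _)) => [|_] /=.
    rewrite inE/= => eX; rewrite mulrC ler_pdivlMr ?exprn_gt0// mul1r lerXn2r ?nnegrE ?(ltW e0) ?(ltW eX)//.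
  by rewrite mulr_ge0// ?invr_ge0 exprn_ge0// ltW.
Qed.

Lemma Ex_cvg (F : nat -> T -> R) (f : T -> R) (M : R) :
  (forall n, measurable_fun setT (F n)) -> (forall n w, `|F n w| <= M) ->
  (forall w, F ^~ w @ \oo --> f w) -> Ex (F n) @[n --> \oo] --> Ex f.
Proof.
move=> mF FM Ff; apply: fine_cvg.
have mf : measurable_fun setT f by apply: (@measurable_fun_cvg _ _ _ setT F f mF) => w _; exact: Ff.
have hf : L1 f.
  apply: bmeas_L1; split => //; exists M => w.
  have : (fun n => `|F n w|) @ \oo --> `|f w| by apply: cvg_norm; exact: Ff.
  by move=> /cvgr_to_le; apply; exact: nearW.
rewrite fineK; last exact: integrable_fin_num.
apply: (@dominated_cvg _ _ _ P _ _ (fun n => EFin \o F n) (EFin \o f) (cst M%:E)) => //.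
- by move=> n; exact/measurable_EFinP.
- by move=> w _; apply: cvg_EFin; [near=> n|exact: Ff].
- exact: finite_measure_integrable_cst.
- by move=> n w _ /=; rewrite lee_fin.
Unshelve. all: by end_near. Qed.

End Expectation.

(** * Changes on null events *)

Section AlmostSure.
Context {d : measure_display} {T : measurableType d} {R : realType}.
Variable P : probability T R.

Lemma Ex_ae (f g : T -> R) (A : set T) : measurable_fun setT f -> measurable_fun setT g ->
  measurable A -> P A = 1%E -> (forall w, A w -> f w = g w) -> Ex P f = Ex P g.
Proof.
move=> mf mg mA PA fg; rewrite /Ex /Rintegral; congr fine.
apply: ae_eq_integral => //; [exact/measurable_EFinP|exact/measurable_EFinP|].
have E : P (~` A) = 0%E by rewrite probability_setC// PA subee.
exists (~` A); split; [exact: measurableC|exact: E|].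
by move=> w /= h Aw; apply: h => _; rewrite fg.
Qed.

Lemma Pr_ae (B C A : set T) : measurable A -> measurable B -> measurable C -> P A = 1%E ->
  (forall w, A w -> (B w <-> C w)) -> P B = P C.
Proof.
move=> mA mB mC PA BC.
rewrite -[LHS]fineK ?fin_num_measure// -[RHS]fineK ?fin_num_measure// -!Ex_indic//.
congr EFin; apply: (@Ex_ae _ _ A) => //; try exact: measurable_indic.
move=> w /BC h; rewrite !indicE; congr (nat_of_bool _)%:R.
by apply/idP/idP; rewrite !inE => /h.
Qed.

End AlmostSure.

(** * Independence *)

Section Independence.
Context {d : measure_display} {T : measurableType d} {R : realType}.
Variable P : probability T R.

(** Both sides are finite measures in [E], the trace of [P] on [H] and a multiple of [P], and they
    agree on the pi-system [G]. *)
Lemma indep_sigma (G : set (set T)) (H : set T) :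
  G `<=` measurable -> setI_closed G -> G setT -> measurable H ->
  (forall E, G E -> P (E `&` H) = (P E * P H)%E) ->
  forall E, <<s G >> E -> P (E `&` H) = (P E * P H)%E.
Proof.
move=> Gm GI GT mH GH E sE.
pose c : {nonneg R} := NngNum (fine_ge0 (measure_ge0 P H)).
have cE : (c%:num)%:E = P H by rewrite fineK// fin_num_measure.
have -> : (P E * P H)%E = mscale c P E by rewrite /mscale/= cE muleC.
apply: (g_sigma_algebra_measure_unique G Gm (fun=> setT) _ _ (mrestr P mH)) => //.
- by rewrite bigcup_const.
- by move=> A GA; rewrite /mrestr/= /mrestr GH// /mscale/= cE muleC.
- by move=> k; rewrite /= /mrestr (le_lt_trans (probability_le1 _ _)) ?ltry//; exact: measurableI.
Qed.

(** The exhausting rays []-k, +oo[] belong to the generating pi-system itself, so equality of the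
    total masses is a consequence and not an assumption. *)
Lemma measure_ray_unique (m1 m2 : {measure set R -> \bar R}) :
  (m1 setT < +oo)%E ->
  (forall a : R, m1 `]a, +oo[%classic = m2 `]a, +oo[%classic) ->
  forall A : set R, measurable A -> m1 A = m2 A.
Proof.
move=> fin1 m12 A mA.
apply: (measure_unique [set B : set R | exists x, B = `]x, +oo[%classic]
   (fun k : nat => `](- k%:R)%R, +oo[%classic)) => //.
- exact: RGenOInfty.measurableE.
- move=> _ _ [x ->] [y ->]; exists (Num.max x y); apply/seteqP; split => z /=;
    rewrite !in_itv/= !andbT gt_max; [by move=> [-> ->]|by move=> /andP[]].
- by move=> k; eexists.
- apply/seteqP; split => // x _; exists (Num.truncn `|x|).+1 => //=.
  rewrite in_itv/= andbT ltrNl (le_lt_trans (ler_norm (- x)))// normrN.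
  exact: truncnS_gt.
- by move=> _ [x ->].
- by move=> k; apply: le_lt_trans fin1; apply: le_measure; rewrite ?inE.
Qed.

Definition indep2 (U V : T -> R) := forall A B : set R, measurable A -> measurable B ->
  P (U @^-1` A `&` V @^-1` B) = (P (U @^-1` A) * P (V @^-1` B))%E.

Lemma indep2_comp (U V : T -> R) (f g : R -> R) :
  measurable_fun setT f -> measurable_fun setT g -> indep2 U V ->
  indep2 (f \o U) (g \o V).
Proof.
move=> mf mg UV A B mA mB; apply: (UV (f @^-1` A) (g @^-1` B)).
- by rewrite -[X in measurable X]setTI; exact: mf.
- by rewrite -[X in measurable X]setTI; exact: mg.
Qed.

Section product_expectation.
Variables U V : {mfun T >-> R}.

Let W w := (U w, V w).
Let mW : measurable_fun setT W. Proof. exact: measurable_fun_pair. Qed.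
HB.instance Definition _ := isMeasurableFun.Build _ _ _ _ W mW.
Let m : probability (R * R)%type R := distribution P W.
Let m1 : probability R R := distribution P U.
Let m2 : probability R R := distribution P V.

Let f (z : R * R) : \bar R := (z.1 * z.2)%:E.

Let mf : measurable_fun setT f.
Proof. by apply/measurable_EFinP; apply: measurable_funM. Qed.

Hypotheses (momU : mom P U) (momV : mom P V) (UV : indep2 U V).

Let mE X : measurable X -> (m1 \x m2)%E X = m X.
Proof. by apply: product_measure_unique => A B mA mB; exact: UV. Qed.

Let intU : m1.-integrable setT (EFin : R -> \bar R).
Proof.
by apply: integrable_pushforward => //=; exact: mom_L1 momU.
Qed.

Let intV : m2.-integrable setT (EFin : R -> \bar R).
Proof.
by apply: integrable_pushforward => //=; exact: mom_L1 momV.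
Qed.

Let ExU : (\int[m1]_x x%:E)%E = (Ex P U)%:E.
Proof.
rewrite -ExE ?(mom_L1 momU)// integral_distribution//.
exact: mom_L1 momU.
Qed.

Let ExV : (\int[m2]_x x%:E)%E = (Ex P V)%:E.
Proof.
rewrite -ExE ?(mom_L1 momV)// integral_distribution//.
exact: mom_L1 momV.
Qed.

Let intm : m.-integrable setT f.
Proof. by apply: integrable_pushforward => //=; exact: mom_L1 (momM momU momV). Qed.

Let intp : (m1 \x m2)%E.-integrable setT f.
Proof.
apply/integrableP; split => //.
rewrite (@eq_measure_integral _ _ _ _ m)//; first by case/integrableP : intm.
by move=> A mA _; exact: mE.
Qed.

(** Independence identifies the joint law [m] with the product [m1 \x m2]; Fubini then integrates
    one coordinate at a time. *)
Lemma Ex_indepM_mfun : Ex P (fun w => U w * V w) = Ex P U * Ex P V.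
Proof.
apply: EFin_inj; rewrite -ExE; last exact: mom_L1 (momM momU momV).
transitivity (\int[m]_z f z)%E.
  by rewrite integral_distribution//=; exact: mom_L1 (momM momU momV).
rewrite (@eq_measure_integral _ _ _ _ (m1 \x m2)%E); last first.
  by move=> A mA _; exact/esym/mE.
rewrite -integral12_prod_meas1// /fubini_F/=.
transitivity (\int[m1]_x (x%:E * (Ex P V)%:E))%E.
  apply: eq_integral => x _; rewrite -ExV -integralZl//.
by rewrite integralZr// ExU EFinM.
Qed.

End product_expectation.

Lemma Ex_indepM (U V : T -> R) : mom P U -> mom P V -> indep2 U V ->
  Ex P (fun w => U w * V w) = Ex P U * Ex P V.
Proof.
move=> momU momV; have [[mU _] [mV _]] := (momU, momV).
exact: (@Ex_indepM_mfun (mfun_Sub (mem_set mU)) (mfun_Sub (mem_set mV))).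
Qed.

End Independence.

(** * Convergence tested on cosines *)

Section Bernstein.
Context {R : realType}.
Implicit Types (phi psi : nat -> R) (s c eta : R).

(* The mean of [phi] under the binomial law of parameters [n] and [s]. *)
Fixpoint bern (n : nat) phi s : R :=
  if n is n'.+1 then s * bern n' (fun j => phi j.+1) s + (1 - s) * bern n' phi s
  else phi 0%N.

Lemma bern_le n phi psi s : 0 <= s <= 1 -> (forall j, phi j <= psi j) ->
  bern n phi s <= bern n psi s.
Proof.
move=> s01; elim: n phi psi => [|n ih] phi psi h /=; first exact: h.
by apply: lerD; apply: ler_wpM2l; rewrite ?ih//; lra.
Qed.

Lemma bernD n phi psi s :
  bern n (fun j => phi j + psi j) s = bern n phi s + bern n psi s.
Proof. by elim: n phi psi => [|n ih] phi psi //=; rewrite !ih; ring. Qed.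

Lemma bernZ n c phi s : bern n (fun j => c * phi j) s = c * bern n phi s.
Proof. by elim: n phi => [|n ih] phi //=; rewrite !ih; ring. Qed.

Lemma bern_cst n c s : bern n (fun=> c) s = c.
Proof. by elim: n => [|n ih] //=; rewrite !ih; ring. Qed.

Lemma bern_norm n phi s : 0 <= s <= 1 -> `|bern n phi s| <= bern n (fun j => `|phi j|) s.
Proof.
move=> s01; elim: n phi => [|n ih] phi //=; apply: (le_trans (ler_normD _ _)).
rewrite !normrM (ger0_norm (_ : 0 <= s)) ?(ger0_norm (_ : 0 <= 1 - s)); try lra.
by apply: lerD; apply: ler_wpM2l; rewrite ?ih//; lra.
Qed.

(** Squared bias plus binomial variance. The centre [c] is arbitrary because the recursion of [bern]
    moves it to [c - 1]. *)
Lemma bern_sqr n c s :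
  bern n (fun j => (j%:R - c) ^+ 2) s = (n%:R * s - c) ^+ 2 + n%:R * (s * (1 - s)).
Proof.
elim: n c => [|n ih] c /=; first by ring.
rewrite ih; have -> : bern n (fun j => (j.+1%:R - c) ^+ 2) s =
    (n%:R * s - (c - 1)) ^+ 2 + n%:R * (s * (1 - s)).
  by rewrite -ih; congr bern; apply/funext => j; rewrite -[j.+1%:R]natr1; congr (_ ^+ 2); ring.
by rewrite -natr1; ring.
Qed.

(** The inequality |x| <= eta + x^2 / eta reduces the mean absolute error to the variance, which
    [bern_sqr] gives. *)
Lemma bern_concentration n s eta : (0 < n)%N -> 0 <= s <= 1 -> 0 < eta ->
  bern n (fun j => `|s - j%:R / n%:R|) s <= eta + (eta * n%:R)^-1.
Proof.
move=> n0 s01 eta0; have nR : 0 < n%:R :> R by rewrite ltr0n.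
apply: (@le_trans _ _ (bern n (fun j => eta + (eta * n%:R ^+ 2)^-1 * (j%:R - n%:R * s) ^+ 2) s)).
  apply: bern_le => // j; set x := s - _.
  have -> : j%:R - n%:R * s = - (n%:R * x) by rewrite /x; field; rewrite gt_eqF.
  rewrite sqrrN exprMn.
  have -> : (eta * n%:R ^+ 2)^-1 * (n%:R ^+ 2 * x ^+ 2) = x ^+ 2 / eta.
    by field; rewrite ?gt_eqF.
  have -> : x ^+ 2 / eta = `|x| ^+ 2 / eta by rewrite real_normK ?num_real.
  have -> : eta + `|x| ^+ 2 / eta = `|x| + (eta - `|x| + `|x| ^+ 2 / eta) by ring.
  rewrite lerDl (_ : _ + _ = ((eta - `|x|) ^+ 2 + eta * `|x|) / eta); last first.
    by field; rewrite gt_eqF.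
  by rewrite divr_ge0 ?(ltW eta0)// addr_ge0 ?sqr_ge0// mulr_ge0// ltW.
rewrite bernD bern_cst bernZ bern_sqr subrr expr0n add0r lerD2l.
have -> : (eta * n%:R ^+ 2)^-1 * (n%:R * (s * (1 - s))) = (eta * n%:R)^-1 * (s * (1 - s)).
  by field; rewrite ?gt_eqF.
by rewrite ger_pMr ?invr_gt0 ?mulr_gt0//; nra.
Qed.
End Bernstein.

(** * From cosines to bounded Lipschitz functions of finitely many coordinates *)

Section TrigConvergence.
Context {R : realType}.
Implicit Types (x y : nat -> R) (h : (nat -> R) -> R) (L M : R).

(** A function of [m] real variables encoded on sequences: the bound forces [h] to depend on the
    first [m] coordinates only. *)
Definition lip_on (m : nat) (L : R) h :=
  forall x y, `|h x - h y| <= L * \sum_(k < m) `|x k - y k|.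

Definition upd x (k : nat) (a : R) : nat -> R := fun j => if j == k then a else x j.

(** No product sigma-algebra is needed: the set where [h] exceeds [a] is a countable union over
    rational points [q s], of the sets where the distance to [q s] is so small that the Lipschitz
    bound keeps [h] above [a]. *)
Lemma lip_measurable d (T : measurableType d) (V : nat -> T -> R) m L h :
  0 < L -> lip_on m L h -> (forall k, measurable_fun setT (V k)) ->
  measurable_fun setT (fun w => h (V ^~ w)).
Proof.
move=> L0 hL mV.
apply: (measurability _ (RGenOInfty.measurableE R)) => //.
move=> _ [_ [a ->] <-]; rewrite setTI.
pose q (s : seq rat) : nat -> R := fun k => ratr s`_k.
have -> : (fun w => h (V ^~ w)) @^-1` `]a, +oo[%classic =
  \bigcup_(s : seq rat) [set w | L * \sum_(k < m) `|V k w - q s k| < h (q s) - a].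
  apply/seteqP; split => w /=; rewrite in_itv/= andbT.
    (* The Lipschitz error is paid twice, from the point to [q] and back, so 2 L m e has to stay
       below the excess of [h] over [a]. *)
    move=> aw; pose e := (h (V ^~ w) - a) / (2 * L * (m%:R + 1)).
    have e0 : 0 < e by rewrite divr_gt0 ?subr_gt0// !mulr_gt0// ltr_wpDl.
    have /choice[r rP] : forall k, exists r : rat, `|V k w - ratr r| < e.
      move=> k; have [r] := @rat_in_itvoo R (V k w - e) (V k w + e) ltac:(lra).
      by rewrite in_itv/= => rk; exists r; rewrite distrC ltr_norml; lra.
    exists (mkseq r m) => //=.
    have S : \sum_(k < m) `|V k w - q (mkseq r m) k| <= m%:R * e.
      rewrite -[m in m%:R]card_ord -sum1_card natr_sum mulr_suml; apply: ler_sum => k _.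
      by rewrite mul1r /q nth_mkseq// ltW.
    have := hL (V ^~ w) (q (mkseq r m)); rewrite ler_norml => /andP[_ h1].
    have h2 : L * \sum_(k < m) `|V k w - q (mkseq r m) k| <= L * (m%:R * e) by rewrite ler_pM2l.
    have h3 : L * (m%:R * e) *+ 2 < h (V ^~ w) - a.
      have -> : L * (m%:R * e) *+ 2 = (h (V ^~ w) - a) * (m%:R / (m%:R + 1)).
        by rewrite /e; field; rewrite !gt_eqF//= ltr_wpDl.
      by rewrite gtr_pMr ?subr_gt0// ltr_pdivrMr ?ltr_wpDl// mul1r ltrDl.
    by rewrite mulr2n in h3; lra.
  move=> [s _ /= sw]; have := hL (V ^~ w) (q s); rewrite ler_norml; lra.
apply: countable_bigcupT_measurable => [|s]; first exact: countableP.
have mf : measurable_fun setT (fun w => L * \sum_(k < m) `|V k w - q s k|).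
  apply: measurable_funM => //; apply: measurable_sum => k.
  by apply: measurableT_comp => //; exact: measurable_funB.
exact: measurable_lt_set.
Qed.

Context {d : measure_display} {T : measurableType d} (P : probability T R).
Context {d' : measure_display} {T' : measurableType d'} (Q : probability T' R).
Variables (X : nat -> nat -> T -> R) (Y : nat -> T' -> R).
Hypothesis mX : forall N k, measurable_fun setT (X N k).
Hypothesis mY : forall k, measurable_fun setT (Y k).

Definition lin (s : seq (nat * R)) x : R := \sum_(p <- s) p.2 * x p.1.

Definition cvg_test h :=
  Ex P (fun w => h (fun k => X N k w)) @[N --> \oo] --> Ex Q (fun w => h (Y ^~ w)).

Hypothesis cvg_cos_lin : forall s th, cvg_test (fun x => cos (lin s x + th)).

Hypothesis tightX : forall k (e : R), 0 < e -> exists A : R, [/\ 0 < A,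
  forall N, fine (P [set w | A < `|X N k w|]) <= e & fine (Q [set w | A < `|Y k w|]) <= e].

Definition test_fun h := [/\ exists M, forall x, `|h x| <= M,
  forall N, measurable_fun setT (fun w => h (fun k => X N k w)) &
  measurable_fun setT (fun w => h (Y ^~ w))].

Lemma test_bmeasX h N : test_fun h -> bmeas (fun w => h (fun k => X N k w)).
Proof. by move=> [[M hM] m1 m2]; split => //; exists M. Qed.

Lemma test_bmeasY h : test_fun h -> bmeas (fun w => h (Y ^~ w)).
Proof. by move=> [[M hM] m1 m2]; split => //; exists M. Qed.

Lemma test_cst c : test_fun (fun=> c).
Proof. by split; [exists `|c|%R|move=> N; exact: measurable_cst|exact: measurable_cst]. Qed.

Lemma testD h h' : test_fun h -> test_fun h' -> test_fun (fun x => h x + h' x).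
Proof.
move=> [[M hM] m1 m2] [[M' hM'] m1' m2']; split.
- by exists (M + M') => x; rewrite (le_trans (ler_normD _ _))// lerD.
- by move=> N; exact: measurable_funD.
- exact: measurable_funD.
Qed.

Lemma testM h h' : test_fun h -> test_fun h' -> test_fun (fun x => h x * h' x).
Proof.
move=> [[M hM] m1 m2] [[M' hM'] m1' m2']; split.
- by exists (M * M') => x; rewrite normrM ler_pM.
- by move=> N; exact: measurable_funM.
- exact: measurable_funM.
Qed.

Lemma measurable_cos_fun d0 (T0 : measurableType d0) (f : T0 -> R) :
  measurable_fun setT f -> measurable_fun setT (fun w => cos (f w)).
Proof. by move=> mf; apply: measurableT_comp => //; apply: continuous_measurable_fun; exact: continuous_cos. Qed.

Lemma cos_le1_norm (a : R) : `|cos a| <= 1.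
Proof. by rewrite ler_norml cos_geN1 cos_le1. Qed.

Lemma test_cos (u th : R) k : test_fun (fun x => cos (u * x k + th)).
Proof.
split; first by exists 1 => x; exact: cos_le1_norm.
- by move=> N; apply: measurable_cos_fun; apply: measurable_funD => //; exact: measurable_funM.
- by apply: measurable_cos_fun; apply: measurable_funD => //; exact: measurable_funM.
Qed.

Definition tprod (l : seq (nat * R * R)) x : R := \prod_(p <- l) cos (p.1.2 * x p.1.1 + p.2).

Lemma tprod_cons p l x : tprod (p :: l) x = cos (p.1.2 * x p.1.1 + p.2) * tprod l x.
Proof. by rewrite /tprod big_cons. Qed.

Lemma test_tprod l : test_fun (tprod l).
Proof.
elim: l => [|p l ih].
  by under [X in test_fun X]funext do rewrite /tprod big_nil; exact: test_cst.
by under [X in test_fun X]funext do rewrite tprod_cons; apply: testM => //; exact: test_cos.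
Qed.

Lemma tprod_le1 l x : `|tprod l x| <= 1.
Proof.
elim: l => [|p l ih]; first by rewrite /tprod big_nil normr1.
by rewrite tprod_cons normrM mulr_ile1// cos_le1_norm.
Qed.

Lemma cvg_testD h h' : test_fun h -> test_fun h' -> cvg_test h -> cvg_test h' ->
  cvg_test (fun x => h x + h' x).
Proof.
move=> th th' ch ch'; rewrite /cvg_test ExD; try exact/bmeas_L1/test_bmeasY.
have e N : Ex P (fun w => h (fun k => X N k w) + h' (fun k => X N k w)) =
  Ex P (fun w => h (fun k => X N k w)) + Ex P (fun w => h' (fun k => X N k w)).
  by rewrite ExD//; exact/bmeas_L1/test_bmeasX.
under eq_fun do rewrite e.
exact: cvgD.
Qed.

Lemma cvg_testZ c h : test_fun h -> cvg_test h -> cvg_test (fun x => c * h x).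
Proof.
move=> th ch; rewrite /cvg_test ExZ; try exact/bmeas_L1/test_bmeasY.
have e N : Ex P (fun w => c * h (fun k => X N k w)) = c * Ex P (fun w => h (fun k => X N k w)).
  by rewrite ExZ//; exact/bmeas_L1/test_bmeasX.
under eq_fun do rewrite e.
by apply: cvgMr.
Qed.

Lemma test_lin s : (forall N, measurable_fun setT (fun w => lin s (fun k => X N k w))) /\
  measurable_fun setT (fun w => lin s (Y ^~ w)).
Proof. by split=> *; apply: measurable_sum => p; exact: measurable_funM. Qed.

Lemma test_cos_lin s th : test_fun (fun x => cos (lin s x + th)).
Proof.
have [m1 m2] := test_lin s; split; first by exists 1 => x; exact: cos_le1_norm.
- by move=> N; apply: measurable_cos_fun; exact: measurable_funD.
- by apply: measurable_cos_fun; exact: measurable_funD.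
Qed.

(** The product-to-sum formula absorbs one factor of [tprod] into the linear form, at the price of
    two terms with frequencies [u] and [- u]. *)
Lemma cvg_cos_lin_tprod l s th : cvg_test (fun x => cos (lin s x + th) * tprod l x).
Proof.
elim: l s th => [|[[k u] phi] l ih] s th.
  rewrite /tprod; under [X in cvg_test X]funext do rewrite big_nil mulr1.
  exact: cvg_cos_lin.
have -> : (fun x => cos (lin s x + th) * tprod (((k, u), phi) :: l) x) =
  (fun x => 2^-1 * (cos (lin ((k, u) :: s) x + (th + phi)) * tprod l x
                   + cos (lin ((k, - u) :: s) x + (th - phi)) * tprod l x)).
  apply/funext => x; rewrite tprod_cons/= /lin !big_cons/= -!/(lin s x).
  have -> : u * x k + lin s x + (th + phi) = (lin s x + th) + (u * x k + phi) by ring.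
  have -> : - u * x k + lin s x + (th - phi) = (lin s x + th) - (u * x k + phi) by ring.
  by set a := lin s x + th; set b := u * x k + phi; rewrite cosD cosB; field.
have tt s' th' : test_fun (fun x => cos (lin s' x + th') * tprod l x).
  by apply: testM; [exact: test_cos_lin|exact: test_tprod].
by apply: cvg_testZ; [apply: testD; exact: tt|apply: cvg_testD; [exact: tt|exact: tt|exact: ih|exact: ih]].
Qed.

(* The factor [tprod l] makes the class stable under products with cosines, hence
   under Bernstein polynomials in [ssin b (x k)]. *)
Definition cvg_class h := test_fun h /\ forall l, cvg_test (fun x => h x * tprod l x).

Lemma cvg_class_cst c : cvg_class (fun=> c).
Proof.
split; first exact: test_cst.
move=> l; apply: cvg_testZ; first exact: test_tprod.
have := @cvg_cos_lin_tprod l [::] 0; congr cvg_test; apply/funext => x.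
by rewrite /lin big_nil addr0 cos0 mul1r.
Qed.

Lemma cvg_classD h h' : cvg_class h -> cvg_class h' -> cvg_class (fun x => h x + h' x).
Proof.
move=> [th ch] [th' ch']; split; first exact: testD.
move=> l; under [X in cvg_test X]funext do rewrite mulrDl.
by apply: cvg_testD (ch l) (ch' l); apply: testM => //; exact: test_tprod.
Qed.

Lemma cvg_classZ c h : cvg_class h -> cvg_class (fun x => c * h x).
Proof.
move=> [th ch]; split; first by apply: testM => //; exact: test_cst.
move=> l; under [X in cvg_test X]funext do rewrite -mulrA.
by apply: cvg_testZ (ch l); apply: testM => //; exact: test_tprod.
Qed.

Lemma cvg_class_cos h k u th : cvg_class h -> cvg_class (fun x => cos (u * x k + th) * h x).
Proof.
move=> [t ch]; split; first by apply: testM => //; exact: test_cos.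
move=> l; have := ch (((k, u), th) :: l); congr cvg_test; apply/funext => x.
by rewrite tprod_cons/=; ring.
Qed.

(** A coordinate turned into a success probability: the sine is moved into [0, 1] to serve as the
    parameter of [bern]. *)
Definition ssin (b a : R) := (1 + sin (b * a)) / 2.

Lemma ssin01 b a : 0 <= ssin b a <= 1.
Proof. by rewrite /ssin; have := sin_le1 (b * a); have := sin_geN1 (b * a); lra. Qed.

Lemma cvg_class_ssin h k b : cvg_class h -> cvg_class (fun x => ssin b (x k) * h x).
Proof.
move=> ch; have := cvg_classD (cvg_classZ 2^-1 ch) (cvg_classZ 2^-1 (cvg_class_cos k b (- (pi / 2)) ch)).
congr cvg_class; apply/funext => x; rewrite /ssin.
have -> : cos (b * x k + - (pi / 2)) = sin (b * x k).
  by rewrite cosB cos_pihalf sin_pihalf mulr0 mulr1 add0r.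
by field.
Qed.

Lemma cvg_class_bern n (phi : nat -> (nat -> R) -> R) k b : (forall j, cvg_class (phi j)) ->
  cvg_class (fun x => bern n (fun j => phi j x) (ssin b (x k))).
Proof.
elim: n phi => [|n ih] phi hphi /=; first exact: hphi.
have h1 := ih (fun j => phi j.+1) (fun j => hphi j.+1); have h2 := ih phi hphi.
have := cvg_classD (cvg_classD (cvg_class_ssin k b h1) h2) (cvg_classZ (-1) (cvg_class_ssin k b h2)).
by congr cvg_class; apply/funext => x; ring.
Qed.

(** Approximation in mean, uniform in [N], is enough: [tprod l] is bounded by 1 and does not enlarge
    the error. *)
Lemma cvg_class_approx h : test_fun h ->
  (forall e : R, 0 < e -> exists2 h', cvg_class h' &
    (forall N, Ex P (fun w => `|h (fun k => X N k w) - h' (fun k => X N k w)|) <= e) /\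
    Ex Q (fun w => `|h (Y ^~ w) - h' (Y ^~ w)|) <= e) -> cvg_class h.
Proof.
move=> th ap; split => // l; apply/cvgrPdist_le => e e0.
have e3 : 0 < e / 3 by rewrite divr_gt0.
have [h' [th' ch'] [hX hY]] := ap _ e3.
have /cvgrPdist_le/(_ _ e3) := ch' l; apply: filterS => N hN.
have tl := test_tprod l.
have bY : `|Ex Q (fun w => h (Y ^~ w) * tprod l (Y ^~ w)) -
            Ex Q (fun w => h' (Y ^~ w) * tprod l (Y ^~ w))| <= e / 3.
  rewrite -ExB; try by apply: bmeas_L1; apply: (@test_bmeasY (fun x => _ x * tprod l x)); exact: testM.
  have L : L1 Q (fun w => h (Y ^~ w) * tprod l (Y ^~ w) - h' (Y ^~ w) * tprod l (Y ^~ w)).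
    by apply: L1B; apply: bmeas_L1; apply: (@test_bmeasY (fun x => _ x * tprod l x)); exact: testM.
  apply: (le_trans (normr_Ex L)); apply: le_trans hY; apply: Ex_le.
  + exact: L1_norm.
  + by apply: L1_norm; apply: L1B; exact/bmeas_L1/test_bmeasY.
  + by move=> w; rewrite -mulrBl normrM ler_piMr// tprod_le1.
have bX : `|Ex P (fun w => h (fun k => X N k w) * tprod l (fun k => X N k w)) -
            Ex P (fun w => h' (fun k => X N k w) * tprod l (fun k => X N k w))| <= e / 3.
  rewrite -ExB; try by apply: bmeas_L1; apply: (@test_bmeasX (fun x => _ x * tprod l x)); exact: testM.
  have L : L1 P (fun w => h (fun k => X N k w) * tprod l (fun k => X N k w) -
                       h' (fun k => X N k w) * tprod l (fun k => X N k w)).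
    by apply: L1B; apply: bmeas_L1; apply: (@test_bmeasX (fun x => _ x * tprod l x)); exact: testM.
  apply: (le_trans (normr_Ex L)); apply: le_trans (hX N); apply: Ex_le.
  + exact: L1_norm.
  + by apply: L1_norm; apply: L1B; exact/bmeas_L1/test_bmeasX.
  + by move=> w; rewrite -mulrBl normrM ler_piMr// tprod_le1.
move: bX bY hN; rewrite !ler_norml; set a1 := Ex P _; set a2 := Ex P _; set b1 := Ex Q _; set b2 := Ex Q _.
rewrite -/a2 -/b2; lra.
Qed.

(** Mean value theorem: on [-1, 1] the derivative of the sine is at least [cos 1]. *)
Lemma sin_sub_ge (a b : R) : -1 <= a -> a <= b -> b <= 1 ->
  cos 1 * (b - a) <= sin b - sin a.
Proof.
move=> a1 ab b1.
have [|c c_ab ->] := @MVT_segment R sin cos a b ab (fun z _ => is_derive_sin (z : R)).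
  by apply: continuous_subspaceT; exact: continuous_sin.
rewrite ler_wpM2r ?subr_ge0//; rewrite in_itv/= in c_ab.
have c1 : `|c| <= 1 by rewrite ler_norml; lra.
rewrite -(cos_norm c) leNgt ltr_cos ?in_itv/= ?normr_ge0 ?ler01//=; have := @pi_ge2 R; lra.
Qed.

(** A Lipschitz inverse of the sine on [-1, 1], extended to every [t] by projection onto
    [sin (-1), sin 1]. The projection is needed because the nodes 2j/n - 1 of the Bernstein
    polynomial leave that range. *)
Lemma sin_inverse_bound (t : R) : exists2 b, -1 <= b <= 1 &
  forall a : R, -1 <= a <= 1 -> cos 1 * `|a - b| <= `|sin a - t|.
Proof.
have sub (x y : R) : -1 <= x -> x <= y -> y <= 1 -> cos 1 * `|y - x| <= `|sin y - sin x|.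
  move=> h1 h2 h3; have H := sin_sub_ge h1 h2 h3.
  by rewrite (ger0_norm (_ : 0 <= y - x)) ?subr_ge0// (le_trans H)// ler_norm.
have sub' (x y : R) : -1 <= x <= 1 -> -1 <= y <= 1 -> cos 1 * `|x - y| <= `|sin x - sin y|.
  case: (leP x y) => xy /andP[? ?] /andP[? ?]; last by apply: sub => //; exact: ltW.
  by rewrite distrC [leRHS]distrC; exact: sub.
have c1 := @cos1_gt0 R.
have [t2|t2] := leP (sin 1) t.
  exists 1; first by lra.
  move=> a /andP[a1 a2]; rewrite distrC; have H := sin_sub_ge a1 a2 (lexx 1).
  by rewrite ger0_norm ?subr_ge0// distrC (le_trans H)// (le_trans _ (ler_norm _))// lerD2r.
have [t3|t3] := leP t (- sin 1).
  exists (-1); first by lra.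
  move=> a /andP[a1 a2]; have H := sin_sub_ge (lexx (-1)) a1 a2; rewrite sinN in H.
  by rewrite ger0_norm ?(le_trans H)//; [rewrite (le_trans _ (ler_norm _))//; lra|lra].
have t1 : -1 <= t <= 1 by have := @sin_le1 R 1; lra.
have sK : sin (asin t) = t by apply: asinK; rewrite in_itv/=.
have h1 := @pihalf_ge1 R; have h2 := asin_geNpi2 t1; have h3 := asin_lepi2 t1.
have b1 : -1 <= asin t <= 1.
  apply/andP; split.
    by rewrite leNgt -ltr_sin ?in_itv/=; [rewrite sK sinN -leNgt ltW|lra|lra].
  by rewrite leNgt -ltr_sin ?in_itv/=; [rewrite sK -leNgt ltW|lra|lra].
by exists (asin t) => // a a1; rewrite -{2}sK; apply: sub'.
Qed.

Lemma lip_test m L M h : lip_on m L h -> (forall x, `|h x| <= M) -> test_fun h.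
Proof.
move=> hL hM; have hL' : lip_on m (`|L| + 1) h.
  move=> x y; apply: (le_trans (hL x y)); apply: ler_wpM2r.
    by apply: sumr_ge0.
  by rewrite (le_trans (ler_norm L))// lerDl.
have L0 : 0 < `|L| + 1 by rewrite ltr_wpDl.
split; first by exists M.
- by move=> N; apply: lip_measurable L0 hL' _.
- exact: lip_measurable L0 hL' mY.
Qed.

Lemma lip_upd m L h a : lip_on m.+1 L h -> lip_on m L (fun x => h (upd x m a)).
Proof.
move=> hL x y; apply: (le_trans (hL _ _)); rewrite big_ord_recr/= /upd eqxx subrr normr0 addr0.
by rewrite le_eqVlt; apply/orP; left; apply/eqP; congr (_ * _); apply: eq_bigr => i _; rewrite ltn_eqF.
Qed.

Lemma lip_upd_dist m L h x a : lip_on m.+1 L h -> `|h x - h (upd x m a)| <= L * `|x m - a|.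
Proof.
move=> hL; apply: (le_trans (hL _ _)); rewrite big_ord_recr/= /upd eqxx big1 ?add0r//.
by move=> i _; rewrite ltn_eqF// subrr normr0.
Qed.

Lemma Ex_two_level d0 (T0 : measurableType d0) (P0 : probability T0 R) (f V : T0 -> R) (A a b e : R) :
  measurable_fun setT f -> measurable_fun setT V -> 0 <= a -> 0 <= b ->
  (forall w, 0 <= f w <= b) -> (forall w, `|V w| <= A -> f w <= a) ->
  fine (P0 [set w | A < `|V w|]) <= e -> Ex P0 f <= a + b * e.
Proof.
move=> mf mV a0 b0 fb fa Pe; have mA := measurable_gt_norm A mV.
have L1i : L1 P0 (\1_[set w | A < `|V w|]) by exact/mom_L1/mom_indic.
apply: (@le_trans _ _ (Ex P0 (fun w => a + b * \1_[set w | A < `|V w|] w))).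
  apply: Ex_le.
  - by apply: bmeas_L1; split => //; exists b => w; rewrite ger0_norm; have /andP[] := fb w.
  - by apply: L1D; [exact: L1_cst|exact: L1Z].
  - move=> w; have /andP[f0 fwb] := fb w; rewrite indicE.
    case: (boolP (w \in _)) => [_|]; first by rewrite mulr1 ler_wpDl.
    by rewrite notin_setE/= mulr0 addr0 => /negP; rewrite -leNgt; exact: fa.
rewrite ExD; [|exact: L1_cst|exact: L1Z].
by rewrite Ex_cst ExZ// Ex_indic// lerD2l ler_wpM2l.
Qed.

(* Induction on the number of coordinates: where [x m] is bounded it is a function of
   [ssin b (x m)], and a Bernstein polynomial in the latter approximates [h] with
   coefficients that depend on the other coordinates only. *)
Lemma cvg_class_lip m L M h : lip_on m L h -> (forall x, `|h x| <= M) -> cvg_class h.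
Proof.
elim: m h => [|m ih] h hL hM.
  have -> : h = fun=> h (fun=> 0); last exact: cvg_class_cst.
  apply/funext => x; have := hL x (fun=> 0).
  by rewrite big_ord0 mulr0 normr_le0 subr_eq0 => /eqP.
have th := lip_test hL hM.
have M0 : 0 <= M by apply: le_trans (hM (fun=> 0)).
have L0 : 0 <= L.
  have := lip_upd_dist (fun=> 0) 1 hL; rewrite sub0r normrN normr1 mulr1.
  exact: le_trans.
apply: cvg_class_approx => // e e0.
(* Mass allowed outside [-A, A]. The error there is at most 2M, so this part costs at most e/2. *)
have e2 : 0 < e / (4 * (M + 1)) by rewrite divr_gt0//; lra.
have [A [A0 AX AY]] := tightX m e2.
have c1 := @cos1_gt0 R.
(* Lipschitz constant of [h] as a function of [ssin A^-1 (x m)]: a factor 2 from the rescaling of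
   the sine, [A] from the range and 1 / cos 1 from its inverse. The summand 1 keeps [C] positive
   when [L] is 0. *)
pose C := 2 * L * A / cos 1 + 1.
have C0 : 0 < C by rewrite ltr_wpDl// divr_ge0 ?(ltW c1)// !mulr_ge0// ltW.
pose eta := e / (4 * C).
have eta0 : 0 < eta by rewrite divr_gt0// mulr_gt0.
pose n := (Num.truncn (eta ^- 2)).+1.
have nP : (eta * n%:R)^-1 <= eta.
  have nR : 0 < n%:R :> R by rewrite ltr0n.
  have : eta ^- 2 < n%:R by exact: truncnS_gt.
  rewrite invf_plt ?posrE ?exprn_gt0// => hn.
  by rewrite invfM mulrC ler_pdivrMr// -expr2 ltW.
(* [A * y0 j] is the value in [-A, A] at which [ssin] comes nearest to j/n. Freezing coordinate [m]
   there yields the coefficients of the Bernstein polynomial. *)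
have /choice[y0 yP] : forall j : nat, exists b : R, -1 <= b <= 1 /\
    forall a : R, -1 <= a <= 1 -> cos 1 * `|a - b| <= `|sin a - (2 * (j%:R / n%:R) - 1)|.
  by move=> j; have [b b1 bP] := sin_inverse_bound (2 * (j%:R / n%:R) - 1); exists b.
pose h' x := bern n (fun j => h (upd x m (A * y0 j))) (ssin A^-1 (x m)).
have ch' : cvg_class h'.
  apply: (@cvg_class_bern n (fun j x => h (upd x m (A * y0 j)))) => j.
  by apply: ih => [|x]; [exact: lip_upd|exact: hM].
have B1 x : `|h x - h' x| <= 2 * M.
  have : `|h' x| <= M.
    apply: (le_trans (bern_norm _ _ (ssin01 _ _))).
    by rewrite -[leRHS](bern_cst n M (ssin A^-1 (x m))); apply: bern_le => //; exact: ssin01.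
  by move=> h1; apply: (le_trans (ler_normB _ _)); have := hM x; lra.
have B2 x : `|x m| <= A -> `|h x - h' x| <= e / 2.
  move=> xA; have s01 := ssin01 A^-1 (x m).
  have -> : h x - h' x = bern n (fun j => h x - h (upd x m (A * y0 j))) (ssin A^-1 (x m)).
    rewrite (_ : (fun j => _) = fun j => h x + (-1) * h (upd x m (A * y0 j))).
      by rewrite bernD bern_cst bernZ mulN1r.
    by apply/funext => j; rewrite mulN1r.
  apply: (le_trans (bern_norm _ _ s01)).
  apply: (@le_trans _ _ (bern n (fun j => C * `|ssin A^-1 (x m) - j%:R / n%:R|) (ssin A^-1 (x m)))).
    apply: bern_le => // j; apply: (le_trans (lip_upd_dist _ _ hL)).
    have a1 : -1 <= A^-1 * x m <= 1.
      rewrite -ler_norml normrM ger0_norm ?invr_ge0 ?(ltW A0)//.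
      by rewrite mulrC ler_pdivrMr// mul1r.
    have [_ /(_ _ a1)] := yP j.
    have -> : sin (A^-1 * x m) - (2 * (j%:R / n%:R) - 1) = 2 * (ssin A^-1 (x m) - j%:R / n%:R).
      by set r := j%:R / n%:R; rewrite /ssin; field.
    have -> : x m - A * y0 j = A * (A^-1 * x m - y0 j) by field; rewrite gt_eqF.
    rewrite !normrM (gtr0_norm A0) (gtr0_norm (_ : 0 < 2))//.
    set u := `|A^-1 * _ - _|; set v := `|ssin _ _ - _| => h1.
    have : u <= 2 * v / cos 1 by rewrite ler_pdivlMr// mulrC.
    have v0 : 0 <= v by exact: normr_ge0.
    move=> /(ler_wpM2l (mulr_ge0 L0 (ltW A0))) h2.
    rewrite mulrA; apply: (le_trans h2).
    have -> : C * v = L * A * (2 * v / cos 1) + v by rewrite /C; ring.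
    by rewrite lerDl.
  rewrite bernZ; have n0 : (0 < n)%N by [].
  have h1 := bern_concentration n0 s01 eta0.
  have h2 : eta + (eta * n%:R)^-1 <= 2 * eta by lra.
  have := ler_wpM2l (ltW C0) (le_trans h1 h2).
  by have -> : C * (2 * eta) = e / 2 by rewrite /eta; field; rewrite gt_eqF.
have th' : test_fun h' by case: ch'.
have td : test_fun (fun x => `|h x - h' x|).
  have [[M1 hM1] m1 m2] := testD th (testM (test_cst (-1)) th').
  have E (f f' : R) : `|f - f'| = `|f + -1 * f'| by rewrite mulN1r.
  split; first by exists (2 * M) => x; rewrite normr_id.
  - by move=> N; under eq_fun do rewrite E; apply: measurableT_comp => //; exact: m1.
  - by under eq_fun do rewrite E; apply: measurableT_comp => //; exact: m2.
have fin : e / 2 + 2 * M * (e / (4 * (M + 1))) <= e.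
  have : 2 * M * (e / (4 * (M + 1))) = e / 2 * (M / (M + 1)) by field; rewrite gt_eqF//; lra.
  have : M / (M + 1) <= 1 by rewrite ler_pdivrMr; lra.
  nra.
exists h' => //; split.
- move=> N; apply: le_trans fin; apply: (Ex_two_level (V := X N m) (A := A)) => //.
  + by have [_ + _] := td; exact.
  + by rewrite divr_ge0// ltW.
  + by rewrite mulr_ge0.
  + by move=> w; rewrite normr_ge0/=; exact: B1.
  + by move=> w; exact: B2.
- apply: le_trans fin; apply: (Ex_two_level (V := Y m) (A := A)) => //.
  + by have [_ _] := td.
  + by rewrite divr_ge0// ltW.
  + by rewrite mulr_ge0.
  + by move=> w; rewrite normr_ge0/=; exact: B1.
  + by move=> w; exact: B2.
Qed.

Theorem cvg_lip m L M h : lip_on m L h -> (forall x, `|h x| <= M) -> cvg_test h.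
Proof.
move=> hL hM; have [_ /(_ [::])] := cvg_class_lip hL hM; congr cvg_test.
by apply/funext => x; rewrite /tprod big_nil mulr1.
Qed.

End TrigConvergence.

(** * Uniqueness of a law with given cosine transform *)

Section LawUniqueness.
Context {R : realType}.
Context {d : measure_display} {T : measurableType d} (P : probability T R).
Context {d' : measure_display} {T' : measurableType d'} (Q : probability T' R).

Lemma tight_single d0 (T0 : measurableType d0) (P0 : probability T0 R) (U : T0 -> R) (e : R) :
  measurable_fun setT U -> 0 < e ->
  \forall n \near \oo, fine (P0 [set w | n%:R < `|U w|]) <= e.
Proof.
move=> mU e0.
have : Ex P0 (\1_[set w | n%:R < `|U w|]) @[n --> \oo] --> Ex P0 (cst 0).
  apply: (@Ex_cvg _ _ _ P0 _ _ 1).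
  - by move=> n; apply: measurable_indic; exact: measurable_gt_norm.
  - by move=> n w; rewrite indicE; case: (_ \in _); rewrite ?normr1 ?normr0.
  - move=> w; apply: cvg_near_cst; exists (Num.truncn `|U w|).+1 => // n /= nw.
    rewrite indicE memNset//= => h; have := truncnS_gt `|U w|.
    by rewrite ltNge => /negP; apply; rewrite ltW// (le_lt_trans _ h)// ler_nat.
rewrite Ex_cst => /cvgrPdist_le/(_ _ e0); apply: filterS => n.
by rewrite sub0r normrN Ex_indic; [apply: le_trans; exact: ler_norm|exact: measurable_gt_norm].
Qed.

Definition clip01 (x : R) : R := Num.max 0 (Num.min 1 x).

Lemma clip01_bound x : 0 <= clip01 x <= 1.
Proof. by rewrite /clip01 le_max lexx/= ge_max ler01/= ge_min lexx. Qed.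

Lemma clip01_lip x y : `|clip01 x - clip01 y| <= `|x - y|.
Proof.
wlog xy : x y / x <= y.
  by move=> W; case: (leP x y) => [|/ltW] xy; [|rewrite distrC [leRHS]distrC]; exact: W.
rewrite /clip01 distrC [leRHS]distrC (ger0_norm (_ : 0 <= y - x)) ?subr_ge0//.
case: (leP 1 x) => x1; case: (leP 1 y) => y1; rewrite ?(max_r ler01) ?subrr ?normr0 ?subr_ge0//; try lra.
- by case: (leP 0 x) => x0; rewrite ger0_norm; lra.
- by case: (leP 0 x) => x0; case: (leP 0 y) => y0; rewrite ger0_norm; lra.
Qed.

Lemma clip01_cvg (u : R) : clip01 (n%:R * u) @[n --> \oo] --> ((0 < u)%R%:R : R).
Proof.
apply: cvg_near_cst; have [u0|u0] := ltP 0 u; last first.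
  by near=> n; rewrite /clip01 min_r ?max_l ?mulr_ge0_le0// (le_trans _ ler01)// mulr_ge0_le0.
exists (Num.truncn (u^-1)).+1 => // n /= nu.
have un : u^-1 < n%:R by apply: (lt_le_trans (truncnS_gt _)); rewrite ler_nat.
have nu1 : 1 <= n%:R * u by rewrite -ler_pdivrMr// div1r ltW.
by rewrite /clip01 min_l// max_r.
Unshelve. all: by end_near. Qed.

(** [cvg_lip] for sequences that are constant in N: convergence is then equality of the expectations
    of Lipschitz functions. Indicators of rays are pointwise limits of such functions, the ramps
    [clip01 (n (x - a))]. *)
Lemma law_eq_cos (U : T -> R) (V : T' -> R) :
  measurable_fun setT U -> measurable_fun setT V ->
  (forall u th, Ex P (fun w => cos (u * U w + th)) = Ex Q (fun w => cos (u * V w + th))) ->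
  forall B : set R, measurable B -> P (U @^-1` B) = Q (V @^-1` B).
Proof.
move=> mU mV UV.
have lipE m (L M : R) h : lip_on m L h -> (forall x, `|h x| <= M) ->
    Ex P (fun w => h (fun=> U w)) = Ex Q (fun w => h (fun=> V w)).
  move=> hL hM.
  have := @cvg_lip R _ T P _ T' Q (fun _ _ => U) (fun=> V) (fun _ _ => mU) (fun=> mV) _ _ m L M h hL hM.
  rewrite /cvg_test => H.
  suff /cvg_lim <- : Ex P (fun w => h (fun=> U w)) @[N --> \oo] --> Ex Q (fun w => h (fun=> V w)).
    - by rewrite lim_cst.
    - exact: Rhausdorff.
  apply: H => [s th|k e e0].
  - rewrite /cvg_test; set c := \sum_(p <- s) p.2.
    have E (a : R) : lin s (fun=> a) = c * a by rewrite /lin -mulr_suml.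
    under [X in Ex Q X]funext do rewrite E; rewrite -UV.
    rewrite (_ : (fun w => _) = fun w => cos (c * U w + th)); first exact: cvg_cst.
    by apply/funext => w; rewrite E.
  - have [n _ nP] := tight_single P mU e0; have [n' _ nQ] := tight_single Q mV e0.
    exists ((maxn n n').+1)%:R; split; first by rewrite ltr0n.
    + by move=> _; apply: nP => /=; rewrite (leq_trans (leq_maxl n n')).
    + by apply: nQ => /=; rewrite (leq_trans (leq_maxr n n')).
have rayE (a : R) : P (U @^-1` `]a, +oo[%classic) = Q (V @^-1` `]a, +oo[%classic).
  pose h (n : nat) (x : nat -> R) : R := clip01 (n%:R * (x 0%N - a)).
  have hE n : Ex P (fun w => h n (fun=> U w)) = Ex Q (fun w => h n (fun=> V w)).
    apply: (@lipE 1 n%:R 1) => [x y|x].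
      rewrite big_ord1; apply: (le_trans (clip01_lip _ _)); rewrite -mulrBr normrM ger0_norm//.
      by rewrite opprB addrA subrK.
    by have /andP[? ?] := clip01_bound (n%:R * (x 0%N - a)); rewrite ger0_norm.
  have key d0 (T0 : measurableType d0) (P0 : probability T0 R) (W : T0 -> R) : measurable_fun setT W ->
      Ex P0 (fun w => h n (fun=> W w)) @[n --> \oo] --> fine (P0 (W @^-1` `]a, +oo[%classic)).
    move=> mW; have mA : measurable (W @^-1` `]a, +oo[%classic).
      by rewrite -[X in measurable X]setTI; exact: mW.
    rewrite -Ex_indic//; apply: (@Ex_cvg _ _ _ P0 _ _ 1).
    - move=> n; apply: (measurableT_comp (f := clip01)).
        apply: continuous_measurable_fun => x; apply/cvgrPdist_lt => e e0.
        near=> t; apply: (le_lt_trans (clip01_lip _ _)); near: t.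
        exact: (@cvgr_dist_lt _ _ _ _ _ id x (@cvg_id _ _)).
      by apply: measurable_funM => //; exact: measurable_funB.
    - by move=> n w; have /andP[? ?] := clip01_bound (n%:R * (W w - a)); rewrite ger0_norm.
    - move=> w; rewrite indicE; have := @clip01_cvg (W w - a); rewrite subr_gt0.
      by congr (_ --> _); congr (nat_of_bool _)%:R; rewrite (_ : (w \in _) = (a < W w))//;
        apply/idP/idP; rewrite inE/= in_itv/= andbT.
  have /(cvg_lim (@Rhausdorff R)) E1 := key _ _ P U mU.
  have /(cvg_lim (@Rhausdorff R)) E2 := key _ _ Q V mV.
  have E : fine (P (U @^-1` `]a, +oo[%classic)) = fine (Q (V @^-1` `]a, +oo[%classic)).
    by rewrite -E1 -E2; under eq_fun do rewrite hE.
  have m1 : measurable (U @^-1` `]a, +oo[%classic) by rewrite -[X in measurable X]setTI; exact: mU.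
  have m2 : measurable (V @^-1` `]a, +oo[%classic) by rewrite -[X in measurable X]setTI; exact: mV.
  by rewrite -[LHS]fineK ?fin_num_measure// E fineK ?fin_num_measure.
move=> B mB.
have := @measure_ray_unique R (distribution P (mfun_Sub (mem_set mU)))
  (distribution Q (mfun_Sub (mem_set mV))).
apply => //.
by rewrite (le_lt_trans (probability_le1 _ _))// ltry.
Unshelve. all: by end_near. Qed.

End LawUniqueness.

(** * The normal law *)

Lemma integrableZ_EFin d (T : measurableType d) (R : realType) (mu : {measure set T -> \bar R})
  (c : R) (f : T -> R) : mu.-integrable setT (EFin \o f) ->
  mu.-integrable setT (EFin \o (fun y => c * f y)).
Proof. by move=> h; exact: (@integrableZl _ _ _ mu setT measurableT c (EFin \o f) h). Qed.

Section GaussianDensity.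
Context {R : realType}.
Variable s : R.
Hypothesis s0 : 0 < s.
Local Notation mu := (@lebesgue_measure R).
Local Notation p := (normal_pdf 0 s).

Let sn0 : s != 0. Proof. by rewrite gt_eqF. Qed.

Lemma integral_normal_prob (f : R -> R) : measurable_fun setT f -> (exists M : R, forall x, `|f x| <= M) ->
  \int[normal_prob 0 s]_x f x = \int[mu]_x (f x * p x).
Proof.
move=> mf bf; have finf : (normal_prob 0 s).-integrable setT (EFin \o f).
  by apply: bmeas_L1.
rewrite /Rintegral; congr fine.
rewrite -(Radon_Nikodym_change_of_variables (normal_prob_dominates 0 s))//=.
under [RHS]eq_integral do rewrite EFinM.
apply: ae_eq_integral => //.
- apply: emeasurable_funM => //; first exact/measurable_EFinP.
  apply: (measurable_int mu); apply: Radon_Nikodym_integrable; exact: normal_prob_dominates.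
- apply: emeasurable_funM => //=; first exact/measurable_EFinP.
  by apply/measurable_EFinP; exact: measurable_normal_pdf.
- apply: ae_eqe_mul2l => /=.
  rewrite Radon_NikodymE//=; first exact: normal_prob_dominates.
  move=> abmu; case: cid => /= h [h1 h2 h3].
  apply: integral_ae_eq => //=.
  + by apply/measurable_EFinP; exact: measurable_normal_pdf.
  + by move=> E _ mE; rewrite -h3.
Qed.

Lemma normal_pdf_expE (t x : R) : t != 0 ->
  normal_pdf 0 t x = normal_peak t * expR (- x ^+ 2 / (t ^+ 2 *+ 2)).
Proof. by move=> t0; rewrite normal_pdfE// /normal_fun subr0. Qed.

Lemma is_derive_normal_pdf (x : R) : is_derive x 1 p (- (x / s ^+ 2) * p x).
Proof.
have -> : p = fun x => normal_peak s * expR (- x ^+ 2 / (s ^+ 2 *+ 2)).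
  by apply/funext => y; exact: normal_pdf_expE sn0.
set c := s ^+ 2 *+ 2.
have h : is_derive x 1 (fun y : R => - y ^+ 2 / c) (- (x / s ^+ 2)).
  apply: is_derive_eq; rewrite /GRing.scale/= /c; field.
  by rewrite sn0.
apply: is_derive_eq; rewrite /GRing.scale/=; ring.
Qed.

(** From e^y >= y^2 / 2 at y = a x^2: half of the exponential pays for the fourth power. *)
Lemma pow4_expR (a x : R) : 0 < a -> x ^+ 4 * expR (- (2 * a * x ^+ 2)) <= 2 / a ^+ 2 * expR (- (a * x ^+ 2)).
Proof.
move=> a0; have -> : - (2 * a * x ^+ 2) = - (a * x ^+ 2) - (a * x ^+ 2) by ring.
rewrite expRD mulrCA mulrC ler_pM2r ?expR_gt0//.
have := @expR_ge1Dxn R (a * x ^+ 2) 1 (mulr_ge0 (ltW a0) (sqr_ge0 _)).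
move=> h; rewrite expRN ler_pdivrMr ?expR_gt0// -ler_pdivrMl ?divr_gt0 ?exprn_gt0//.
apply: le_trans h; rewrite -[leLHS]add0r lerD//.
by rewrite le_eqVlt; apply/orP; left; apply/eqP; rewrite (_ : 2`!%:R = 2)//; field; rewrite gt_eqF.
Qed.

Lemma integrable_pow4_normal : mu.-integrable setT (EFin \o (fun x => x ^+ 4 * p x)).
Proof.
(* By [pow4_expR] with a = 1 / (4 s^2) the integrand is at most a multiple of the density of
   deviation s sqrt 2; the quotient of the peaks adjusts the normalizations. *)
pose c := 2 / (4 * s ^+ 2)^-1 ^+ 2 * (normal_peak s / normal_peak (s * Num.sqrt 2)).
have s2 : s * Num.sqrt 2 != 0 by rewrite mulf_neq0// gt_eqF// sqrtr_gt0.
apply: (@le_integrable _ _ _ mu _ measurableT _ (EFin \o (fun x => c * normal_pdf 0 (s * Num.sqrt 2) x))).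
- apply/measurable_EFinP; apply: measurable_funM; last exact: measurable_normal_pdf.
  exact: measurable_funX.
- move=> x _ /=; rewrite lee_fin ger0_norm; last first.
    by rewrite mulr_ge0 ?normal_pdf_ge0// exprn_even_ge0.
  apply: le_trans (ler_norm _).
  rewrite (normal_pdf_expE _ sn0) (normal_pdf_expE _ s2) exprMn sqr_sqrtr//.
  set a := (4 * s ^+ 2)^-1.
  have a0 : 0 < a by rewrite invr_gt0 mulr_gt0// exprn_gt0.
  have -> : - x ^+ 2 / (s ^+ 2 *+ 2) = - (2 * a * x ^+ 2) by rewrite /a; field.
  have -> : - x ^+ 2 / (s ^+ 2 * 2 *+ 2) = - (a * x ^+ 2) by rewrite /a; field.
  have pk0 := normal_peak_gt0 sn0.
  rewrite mulrCA (le_trans (ler_wpM2l (ltW pk0) (pow4_expR x a0)))//.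
  rewrite /c -/a le_eqVlt; apply/orP; left; apply/eqP.
  have := normal_peak_gt0 s2; set q := normal_peak (s * _) => q0.
  by field; rewrite !gt_eqF.
- rewrite (_ : EFin \o _ = fun x => (c%:E * (normal_pdf 0 (s * Num.sqrt 2) x)%:E)%E); last by apply/funext => x.
  by apply: integrableZl => //; exact: integrable_normal_pdf.
Qed.

Lemma normal_tail4 : exists C : R, forall l : R, 0 < l ->
  fine (normal_prob 0 s [set x | l < `|x|]) <= C / l ^+ 4.
Proof.
exists (\int[mu]_x (x ^+ 4 * p x)) => l l0.
have mA : measurable [set x : R | l < `|x|] by exact: (@measurable_gt_norm _ R R id).
have i4 := integrable_pow4_normal.
have i4l : mu.-integrable setT (EFin \o (fun x => l ^- 4 * (x ^+ 4 * p x))).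
  exact: integrableZ_EFin.
rewrite mulrC -RintegralZl// /Rintegral; apply: fine_le.
- exact: (fin_num_measure (normal_prob 0 s)).
- exact: integrable_fin_num i4l.
- have f0 (x : R) : 0 <= l ^- 4 * (x ^+ 4 * p x).
    apply: mulr_ge0; first by rewrite invr_ge0 exprn_ge0// ltW.
    by apply: mulr_ge0; [exact: exprn_even_ge0|exact: normal_pdf_ge0].
  apply: (@le_trans _ _ (\int[mu]_(x in [set x : R | (l < `|x|)%R]) (l ^- 4 * (x ^+ 4 * p x))%:E)%E).
    apply: ge0_le_integral => //.
    + by move=> x _; rewrite lee_fin normal_pdf_ge0.
    + by apply/measurable_EFinP/measurable_funTS; exact: measurable_normal_pdf.
    + by apply: measurable_funTS; exact: measurable_int i4l.
    + move=> x /= lx; rewrite lee_fin mulrA ler_peMl ?normal_pdf_ge0//.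
      rewrite mulrC ler_pdivlMr ?exprn_gt0// mul1r.
      have -> : x ^+ 4 = `|x| ^+ 4 by rewrite -normrX ger0_norm// exprn_even_ge0.
      by rewrite lerXn2r// ?nnegrE ?(ltW l0)// ltW.
  apply: ge0_subset_integral => //; first exact: measurable_int i4l.
  by move=> x _; rewrite lee_fin.
Qed.

Lemma integrable_le_normal (f : R -> R) (a b : R) : measurable_fun setT f ->
  (forall x, `|f x| <= (a + b * x ^+ 4) * p x) -> mu.-integrable setT (EFin \o f).
Proof.
move=> mf fb.
apply: (@le_integrable _ _ _ mu _ measurableT _ (EFin \o (fun x => a * p x + b * (x ^+ 4 * p x)))).
- exact/measurable_EFinP.
- move=> x _ /=; rewrite lee_fin; apply: le_trans (ler_norm _).
  by apply: (le_trans (fb x)); rewrite mulrDl mulrA.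
- apply: (@integrableD _ _ _ mu setT measurableT (EFin \o (fun x => a * p x)) (EFin \o (fun x => b * (x ^+ 4 * p x)))).
    by apply: integrableZ_EFin; exact: integrable_normal_pdf.
  by apply: integrableZ_EFin; exact: integrable_pow4_normal.
Qed.

Let mp : measurable_fun setT p. Proof. exact: measurable_normal_pdf. Qed.

Lemma norm_le_pow4 (x : R) : `|x| <= 1 + x ^+ 4.
Proof.
have -> : x ^+ 4 = `|x| ^+ 4 by rewrite -normrX ger0_norm// exprn_even_ge0.
have := normr_ge0 x; set y := `|x| => y0.
have := sqr_ge0 (y ^+ 2 - 1 / 2); have := sqr_ge0 (y - 1 / 2); rewrite !sqrrB.
have -> : (y ^+ 2) ^+ 2 = y ^+ 4 by rewrite -exprM.
by move=> *; nra.
Qed.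

Let measurable_cos_aff (x th : R) : measurable_fun setT (fun y : R => cos (x * y + th)).
Proof. by apply: measurable_cos_fun; apply: measurable_funD => //; exact: measurable_funM. Qed.

Let measurable_sin_aff (x th : R) : measurable_fun setT (fun y : R => sin (x * y + th)).
Proof.
apply: measurableT_comp; first by apply: continuous_measurable_fun; exact: continuous_sin.
by apply: measurable_funD => //; exact: measurable_funM.
Qed.

Variable th : R.
Let A (x : R) : R := \int[mu]_y (cos (x * y + th) * p y).
Let B (x : R) : R := \int[mu]_y (y * sin (x * y + th) * p y).

Let intA x : mu.-integrable setT (EFin \o (fun y => cos (x * y + th) * p y)).
Proof.
apply: (@integrable_le_normal _ 1 0) => [|y]; first exact: measurable_funM.
by rewrite mul0r addr0 mul1r normrM (ger0_norm (normal_pdf_ge0 _ _ _)) ler_piMl ?normal_pdf_ge0// cos_max.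
Qed.

Let intB x : mu.-integrable setT (EFin \o (fun y => y * sin (x * y + th) * p y)).
Proof.
apply: (@integrable_le_normal _ 1 1) => [|y].
  by apply: measurable_funM => //; apply: measurable_funM.
rewrite !normrM (ger0_norm (normal_pdf_ge0 _ _ _)) ler_wpM2r ?normal_pdf_ge0//.
rewrite mul1r; apply: le_trans (norm_le_pow4 y); rewrite ler_piMr//; exact: sin_max.
Qed.

(** Differentiation under the integral sign. The dominating function (1 + y^4) p(y) is chosen so
    that [integrable_pow4_normal] covers it. *)
Let derA (x : R) : is_derive x (1 : R) (A : R -> R) (- B x).
Proof.
pose f (x y : R) := cos (x * y + th) * p y.
have df (y z : R) : is_derive z 1 (fun z => cos (z * y + th) * p y) (- (y * sin (z * y + th) * p y)).
  by apply: is_derive_eq; rewrite /GRing.scale/=; ring.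
have D1 z y : partial1of2 f z y = - (y * sin (z * y + th) * p y).
  by rewrite partial1of2E; have [_ ->] := df y z.
have Ix : (`]x - 1, x + 1[%classic : set R) x by rewrite /= in_itv/=; lra.
have iG : mu.-integrable setT (EFin \o (fun y => (1 + y ^+ 4) * p y)).
  apply: (@integrable_le_normal _ 1 1) => [|y].
    by apply: measurable_funM => //; apply: measurable_funD => //; exact: measurable_funX.
  rewrite mul1r ger0_norm// mulr_ge0 ?normal_pdf_ge0// addr_ge0// exprn_even_ge0//.
have h1 : forall z y, (`]x - 1, x + 1[%classic : set R) z -> [set: R] y -> derivable (f ^~ y) z 1.
  by move=> z y _ _; have [] := df y z.
have h2 : forall y : R, 0 <= (1 + y ^+ 4) * p y.
  by move=> y; rewrite mulr_ge0 ?normal_pdf_ge0// addr_ge0// exprn_even_ge0.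
have h3 : forall z y, (`]x - 1, x + 1[%classic : set R) z -> [set: R] y ->
    `|partial1of2 f z y| <= (1 + y ^+ 4) * p y.
  move=> z y _ _; rewrite D1 normrN !normrM (ger0_norm (normal_pdf_ge0 _ _ _)) ler_wpM2r ?normal_pdf_ge0//.
  by apply: le_trans (norm_le_pow4 y); rewrite ler_piMr//; exact: sin_max.
have dA := @derivable_under_integral R _ _ mu f setT measurableT x _ _ Ix (fun z _ => intA z) h1 _ h2 iG h3.
apply: DeriveDef => //.
have := @differentiation_under_integral R _ _ mu f setT measurableT x _ _ Ix (fun z _ => intA z) h1 _ h2 iG h3.
rewrite derive1E => ->; under eq_Rintegral do rewrite D1 -mulN1r.
by rewrite RintegralZl// mulN1r.
Qed.

Let pdf_le (y : R) : 0 < y -> p y <= normal_peak s * (2 * s ^+ 2) / y ^+ 2.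
Proof.
move=> y0; rewrite (normal_pdf_expE _ sn0) -mulrA ler_pM2l ?normal_peak_gt0//.
rewrite mulNr expRN -[leRHS]invf_div lef_pV2 ?posrE ?expR_gt0 ?divr_gt0 ?mulr_gt0 ?exprn_gt0//.
apply: le_trans (expR_ge1Dx _); rewrite -[leLHS]add0r lerD//.
by rewrite mulr_natl.
Qed.

(** Integration by parts: [g] is the derivative of [H], which vanishes at both ends of the line, so
    the integral of [g] is zero. *)
Let BE x : B x = s ^+ 2 * x * A x.
Proof.
pose g (y : R) := x * (cos (x * y + th) * p y) - s ^- 2 * (y * sin (x * y + th) * p y).
pose H (y : R) := sin (x * y + th) * p y.
have dH (y : R) : is_derive y 1 H (g y).
  have dp := is_derive_normal_pdf y.
  by apply: is_derive_eq; rewrite /g /GRing.scale/=; field.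
have cp : continuous p by exact: continuous_normal_pdf.
have clin : continuous (fun y : R => x * y + th).
  by move=> y; apply: cvgD; [apply: cvgMr; exact: cvg_id|exact: cvg_cst].
have cg : continuous g.
  move=> y; apply: cvgB; apply: cvgMr; apply: cvgM; [|exact: cp| |exact: cp].
    by apply: continuous_comp; [exact: clin|exact: continuous_cos].
  by apply: cvgM; [exact: cvg_id|apply: continuous_comp; [exact: clin|exact: continuous_sin]].
have i1 : mu.-integrable setT (EFin \o (fun y => x * (cos (x * y + th) * p y))).
  exact: integrableZ_EFin.
have i2 : mu.-integrable setT (EFin \o (fun y => s ^- 2 * (y * sin (x * y + th) * p y))).
  exact: integrableZ_EFin.
have ig : mu.-integrable setT (EFin \o g).
  rewrite (_ : EFin \o _ = (EFin \o (fun y => x * (cos (x * y + th) * p y))%R) \-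
    (EFin \o (fun y => s ^- 2 * (y * sin (x * y + th) * p y))%R))%E//.
  exact: integrableB.
pose I (n : nat) : set R := `[- n.+1%:R, n.+1%:R]%classic.
have FTC n : (\int[mu]_y ((EFin \o g) \_ (I n)) y = (H n.+1%:R - H (- n.+1%:R))%:E)%E.
  rewrite -integral_mkcond (@continuous_FTC2 _ g H)//.
  - by rewrite ltrNl -subr_gt0 opprK addr_gt0// ltr0n.
  - exact: continuous_subspaceT.
  - split.
    + by move=> z _; have [] := dH z.
    + apply: cvg_at_right_filter; have [dd _] := dH (- n.+1%:R).
      by move/derivable1_diffP : dd => /differentiable_continuous.
    + apply: cvg_at_left_filter; have [dd _] := dH n.+1%:R.
      by move/derivable1_diffP : dd => /differentiable_continuous.
  - by move=> z _; rewrite derive1E; have [_ ->] := dH z.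
have lim1 : (\int[mu]_y ((EFin \o g) \_ (I n)) y @[n --> \oo] --> \int[mu]_y (g y)%:E)%E.
  apply: (@dominated_cvg _ _ _ mu setT measurableT _ _ (abse \o (EFin \o g))) => //.
  - move=> n; apply/(measurable_restrictT _ _).1 => //; first exact: measurable_itv.
    by apply: measurable_funTS; exact: measurable_int ig.
  - move=> y _; apply: cvg_near_cst; exists (Num.truncn `|y|) => // n /= yn.
    rewrite patchE mem_set// /I/= in_itv/= -ler_norml ltW//.
    by apply: (lt_le_trans (truncnS_gt _)); rewrite ler_nat.
  - exact: integrable_abse.
  - by move=> n y _; rewrite patchE; case: ifP => // _; rewrite abse0; exact: abse_ge0.
have lim2 : (H n.+1%:R - H (- n.+1%:R)) @[n --> \oo] --> (0 : R).
  pose C := normal_peak s * (2 * s ^+ 2).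
  have C0 : 0 < C by rewrite mulr_gt0 ?normal_peak_gt0// mulr_gt0// exprn_gt0.
  apply/cvgrPdist_le => e e0; near=> n.
  rewrite sub0r normrN; have n0 : 0 < n.+1%:R :> R by rewrite ltr0n.
  have pN : p (- n.+1%:R) = p n.+1%:R by rewrite !(normal_pdf_expE _ sn0) sqrrN.
  have HH y : `|H y| <= p y.
    by rewrite /H normrM (ger0_norm (normal_pdf_ge0 _ _ _)) ler_piMl ?normal_pdf_ge0// sin_max.
  apply: (le_trans (ler_normB _ _)); apply: (le_trans (lerD (HH _) (HH _))); rewrite pN.
  have h := pdf_le n0.
  have h' : C / n.+1%:R ^+ 2 <= C / n.+1%:R.
    by rewrite ler_pM2l// lef_pV2 ?posrE ?exprn_gt0// expr2 ler_peMl// ler1n.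
  have : C / n.+1%:R <= e / 2.
    rewrite ler_pdivrMr// mulrC -ler_pdivrMr ?divr_gt0//.
    by apply: (@le_trans _ _ n%:R); [near: n; exact: nbhs_infty_ger|rewrite ler_nat].
  by move=> h''; have hh := le_trans h (le_trans h' h''); rewrite (le_trans (lerD hh hh))// -splitr.
have : (\int[mu]_y (g y)%:E = 0)%E.
  rewrite -(cvg_lim (@ereal_hausdorff R) lim1); apply: cvg_lim => //.
  by under eq_fun do rewrite FTC; apply: cvg_EFin => //; exact: nearW.
move=> /(congr1 fine); rewrite -[LHS]/(\int[mu]_y g y) RintegralB// !RintegralZl// -/(A x) -/(B x) /=.
by move/eqP; rewrite subr_eq0 => /eqP E; rewrite -mulrA E mulrA divff ?mul1r// expf_neq0.
Unshelve. all: by end_near. Qed.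

(** The transform solves a linear differential equation: [derA] gives A' = -B and [BE] gives B = s^2
    x A. Hence A(x) e^(s^2 x^2 / 2) is constant, equal to its value cos th at 0. *)
Lemma normal_cos (x : R) : Ex (normal_prob 0 s) (fun y => cos (x * y + th)) = cos th * expR (- (s ^+ 2 * x ^+ 2 / 2)).
Proof.
rewrite /Ex integral_normal_prob//; last by exists 1 => y; exact: cos_max.
rewrite -/(A x).
pose F (x : R) := A x * expR (s ^+ 2 * x ^+ 2 / 2).
have F' (z : R) : is_derive z 1 F 0.
  by have dA := derA z; apply: is_derive_eq; rewrite BE /GRing.scale/=; field.
have Fc := @is_derive_0_is_cst R F x 0 F'.
have A0 : A 0 = cos th.
  rewrite /A; under eq_Rintegral do rewrite mul0r add0r.
  rewrite RintegralZl//; last exact: integrable_normal_pdf.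
  by rewrite /Rintegral integral_normal_pdf mulr1.
move: Fc; rewrite /F A0 expr0n/= mulr0 mul0r expR0 mulr1 => <-.
by rewrite expRN mulfK// gt_eqF// expR_gt0.
Qed.

End GaussianDensity.

(** * Independent normal variables on the unit interval *)

Section LawTransport.
Context {R : realType}.
Context {d : measure_display} {T : measurableType d} (P : probability T R).
Variables (m : probability R R) (X : T -> R).
Hypothesis mX : measurable_fun setT X.

Lemma law_ray_restr (H : set T) (c : {nonneg R}) : measurable H ->
  (forall a : R, P (X @^-1` `]a, +oo[%classic `&` H) = ((c%:num)%:E * m `]a, +oo[%classic)%E) ->
  forall A : set R, measurable A -> P (X @^-1` A `&` H) = ((c%:num)%:E * m A)%E.
Proof.
move=> mH h.
apply: (@measure_ray_unique R (pushforward (mrestr P mH) (mfun_Sub (mem_set mX))) (mscale c m)) => //.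
rewrite /= /pushforward /mrestr (le_lt_trans (probability_le1 _ _)) ?ltry//.
by apply: measurableI => //; rewrite -[X in measurable X]setTI; exact: mX.
Qed.

Lemma law_ray : (forall a : R, P (X @^-1` `]a, +oo[%classic) = m `]a, +oo[%classic) ->
  forall A : set R, measurable A -> P (X @^-1` A) = m A.
Proof.
move=> h; apply: (@measure_ray_unique R (pushforward P (mfun_Sub (mem_set mX))) m) => //=.
by rewrite /pushforward preimage_setT [X in (X < _)%E]probability_setT ltry.
Qed.

Lemma Ex_law (g : R -> R) : (forall A : set R, measurable A -> P (X @^-1` A) = m A) ->
  bmeas g -> Ex P (fun w => g (X w)) = Ex m g.
Proof.
move=> h [mg [M gM]]; rewrite /Ex /Rintegral; congr fine.
rewrite -(@eq_measure_integral _ _ _ setT m (distribution P (mfun_Sub (mem_set mX)))); last first.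
  by move=> A mA _; exact: h.
rewrite integral_distribution//; first exact/measurable_EFinP.
apply: bmeas_L1; split; first exact: measurableT_comp mg mX.
by exists M => w; exact: gM.
Qed.

End LawTransport.

(** * Independent uniform variables from binary digits *)

Section IidNormals.
Context {R : realType}.

Let mid : measurable_fun setT (id : measurableTypeR R -> R). Proof. exact: measurable_id. Qed.

(** The uniform and normal laws are measures on [measurableTypeR R]; the push-forward by the
    identity carries them to the measurable structure of [R] itself. *)
Definition toR (P : probability (measurableTypeR R) R) : probability R R :=
  @distribution _ _ (measurableTypeR R) R R P (@mfun_Sub _ _ (measurableTypeR R) R id (mem_set mid)).

Lemma Ex_toR (P : probability (measurableTypeR R) R) (g : R -> R) : bmeas g ->
  Ex (toR P) g = Ex P g.
Proof.
move=> [mg [M gM]]; rewrite /Ex /Rintegral /toR integral_distribution//.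
  exact/measurable_EFinP.
by apply: bmeas_L1; split; [exact: mg|exists M].
Qed.

Definition unif : probability R R := toR (uniform_prob (@ltr01 R)).
Local Notation Q := unif.
Local Notation mu := (@lebesgue_measure R).

Definition u01 (a : R) : R := clip01 (1 - a).

Lemma unifE (A : set R) : measurable A -> Q A = mu (A `&` `[0, 1]%classic).
Proof.
move=> mA; rewrite [LHS](_ : _ = uniform_prob (@ltr01 R) A)//.
rewrite /uniform_prob integral_uniform_pdf//.
rewrite -[RHS]mul1e -integral_cst//; last exact: measurableI.
apply: eq_integral => x; rewrite inE/= in_itv/= => -[_ x01].
by rewrite /uniform_pdf x01 subr0 invr1.
Qed.

Lemma unif_ray (a : R) : Q `]a, +oo[%classic = (u01 a)%:E.
Proof.
rewrite unifE//; have [a0|a0] := ltP a 0.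
  rewrite setIidr; last by move=> x /=; rewrite !in_itv/= andbT; lra.
  by rewrite lebesgue_measure_itv/= lte01 /u01 /clip01 min_l ?max_r ?sube0//; lra.
have [a1|a1] := leP 1 a.
  rewrite (_ : _ `&` _ = set0) ?measure0; last first.
    by apply/seteqP; split => // x [/=]; rewrite !in_itv/= andbT; lra.
  by rewrite /u01 /clip01 min_r ?max_l//; lra.
rewrite (_ : _ `&` _ = `]a, 1]%classic); last first.
  by apply/seteqP; split => x /=; rewrite !in_itv/= !andbT; lra.
by rewrite lebesgue_measure_itv/= lte_fin a1 /u01 /clip01 min_r ?max_r ?EFinB//; lra.
Qed.

(** The doubling map, which drops the leading binary digit; [bit] reads that digit. *)
Definition dbl (x : R) : R := if x < 1 / 2 then 2 * x else 2 * x - 1.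
Definition bit (x : R) : R := if x < 1 / 2 then 0 else 1.

Lemma measurable_lthalf : measurable [set x : R | x < 1 / 2].
Proof. exact: (@measurable_lt_set _ R R id (cst (1/2))). Qed.

Lemma measurable_dbl : measurable_fun setT dbl.
Proof.
apply: measurable_fun_ifT.
- exact: measurable_fun_ltr.
- exact: measurable_funM.
- by apply: measurable_funB => //; exact: measurable_funM.
Qed.

Lemma measurable_bit : measurable_fun setT bit.
Proof. by apply: measurable_fun_ifT => //; exact: measurable_fun_ltr. Qed.

Let mpre (f : R -> R) (A : set R) : measurable_fun setT f -> measurable A -> measurable (f @^-1` A).
Proof. by move=> mf mA; rewrite -[X in measurable X]setTI; exact: mf. Qed.

Let half : {nonneg R} := NngNum (divr_ge0 (@ler01 R) (ler0n R 2)).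

Lemma measurable_gehalf : measurable [set x : R | 1 / 2 <= x].
Proof.
have -> : [set x : R | 1 / 2 <= x] = ~` [set x | x < 1 / 2].
  by apply/seteqP; split => x /=; rewrite leNgt => /negP.
by apply: measurableC; exact: measurable_lthalf.
Qed.

Let halfE (r : R) : ((half%:num)%:E * r%:E = (r / 2)%:E)%E.
Proof. by rewrite -EFinM /=; congr EFin; field. Qed.

Let u01_lt0 (a : R) : a < 0 -> u01 a = 1.
Proof. by move=> a0; rewrite /u01 /clip01 min_l ?max_r//; lra. Qed.

Let u01_ge1 (a : R) : 1 <= a -> u01 a = 0.
Proof. by move=> a0; rewrite /u01 /clip01 min_r ?max_l//; lra. Qed.

Let u01_mid (a : R) : 0 <= a -> a < 1 -> u01 a = 1 - a.
Proof. by move=> a0 a1; rewrite /u01 /clip01 min_r ?max_r//; lra. Qed.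

(** Together with [unif_dbl1]: the leading digit is fair and independent of the number formed by the
    other digits, which is again uniform. *)
Lemma unif_dbl0 (A : set R) : measurable A ->
  Q (dbl @^-1` A `&` [set x | x < 1 / 2]) = ((half%:num)%:E * Q A)%E.
Proof.
apply: law_ray_restr => //; [exact: measurable_dbl|exact: measurable_lthalf|] => a.
rewrite unif_ray halfE unifE; last first.
  apply: measurableI; last exact: measurable_lthalf.
  by apply: mpre; [exact: measurable_dbl|exact: measurable_itv].
have [a0|a0] := ltP a 0.
  rewrite (_ : _ `&` _ = `[0, (1 / 2)[%classic); last first.
    apply/seteqP; split => x /=; rewrite !in_itv/= /dbl.
      by move=> [[_ ?] ?]; lra.
    by move=> h; rewrite (_ : x < 1 / 2)//; lra.
  have h12 : (0 : R) < 1 / 2 by lra.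
  rewrite lebesgue_measure_itv/= lte_fin h12.
  by rewrite u01_lt0// sube0.
have [a1|a1] := leP 1 a.
  rewrite (_ : _ `&` _ = set0); last first.
    by apply/seteqP; split => // x [[]] /=; rewrite !in_itv/= andbT /dbl => + x2; rewrite x2; lra.
  by rewrite measure0 u01_ge1// mul0r.
rewrite (_ : _ `&` _ = `](a / 2), (1 / 2)[%classic); last first.
  apply/seteqP; split => x /=; rewrite !in_itv/= ?andbT /dbl.
    by move=> [[+ x2]]; rewrite x2; lra.
  by move=> h; rewrite (_ : x < 1 / 2)//; lra.
have h12 : a / 2 < 1 / 2 by lra.
rewrite lebesgue_measure_itv/= lte_fin h12.
by rewrite u01_mid// -EFinB; congr EFin; lra.
Qed.

Lemma unif_dbl1 (A : set R) : measurable A ->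
  Q (dbl @^-1` A `&` [set x | 1 / 2 <= x]) = ((half%:num)%:E * Q A)%E.
Proof.
apply: law_ray_restr => //; [exact: measurable_dbl|exact: measurable_gehalf|] => a.
rewrite unif_ray halfE unifE; last first.
  apply: measurableI; last exact: measurable_gehalf.
  by apply: mpre; [exact: measurable_dbl|exact: measurable_itv].
have dE (x : R) : 1 / 2 <= x -> dbl x = 2 * x - 1 by move=> h; rewrite /dbl ltNge h.
have [a0|a0] := ltP a 0.
  rewrite (_ : _ `&` _ = `[(1 / 2), 1]%classic); last first.
    apply/seteqP; split => x /=; rewrite !in_itv/= ?andbT.
      by move=> [[_ ?] ?]; lra.
    by move=> h; rewrite dE; lra.
  have h12 : 1 / 2 < 1 :> R by lra.
  rewrite lebesgue_measure_itv/= lte_fin h12.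
  by rewrite u01_lt0// -EFinB; congr EFin; lra.
have [a1|a1] := leP 1 a.
  rewrite (_ : _ `&` _ = set0); last first.
    by apply/seteqP; split => // x [[]] /=; rewrite !in_itv/= andbT => + x2; rewrite dE//; lra.
  by rewrite measure0 u01_ge1// mul0r.
rewrite (_ : _ `&` _ = `]((a + 1) / 2), 1]%classic); last first.
  apply/seteqP; split => x /=; rewrite !in_itv/= ?andbT.
    by move=> [[+ x2]]; rewrite dE//; lra.
  by move=> h; rewrite dE; lra.
have h12 : (a + 1) / 2 < 1 by lra.
rewrite lebesgue_measure_itv/= lte_fin h12.
by rewrite u01_mid// -EFinB; congr EFin; lra.
Qed.

Lemma unif_dbl (A : set R) : measurable A -> Q (dbl @^-1` A) = Q A.
Proof.
move=> mA; have h : dbl @^-1` A = (dbl @^-1` A `&` [set x | x < 1 / 2]) `|` (dbl @^-1` A `&` [set x | 1 / 2 <= x]).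
  by rewrite -setIUr (_ : _ `|` _ = setT) ?setIT//; apply/seteqP; split => // x _ /=; case: ltP; [left|right].
rewrite [in LHS]h measureU//.
- rewrite [X in (X + _)%E]unif_dbl0// [X in (_ + X)%E]unif_dbl1// -ge0_muleDl ?lee_fin//.
  by rewrite -EFinD /= -splitr mul1e.
- by apply: measurableI; [exact: mpre measurable_dbl mA|exact: measurable_lthalf].
- by apply: measurableI; [exact: mpre measurable_dbl mA|exact: measurable_gehalf].
- by apply/seteqP; split => // x /= [[_ h1] [_ h2]]; rewrite ltNge h2 in h1.
Qed.

(* [dlim x] is the number formed by every other binary digit of [x], and [dlim (dbl x)]
   the one formed by the remaining digits. *)
Fixpoint dig (n : nat) (x : R) : R :=
  if n is n'.+1 then (bit x + dig n' (dbl (dbl x))) / 2 else 0.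

Lemma bit01 x : 0 <= bit x <= 1. Proof. by rewrite /bit; case: ltP; lra. Qed.

Lemma dig01 n x : 0 <= dig n x <= 1.
Proof. by elim: n x => [|n ih] x /=; [lra|have := ih (dbl (dbl x)); have := bit01 x; lra]. Qed.

Lemma dig_incr n x : dig n x <= dig n.+1 x.
Proof.
elim: n x => [|n ih] x; first by have /andP[] := dig01 1 x.
rewrite /= -/(dig n.+1 (dbl (dbl x))) ler_pM2r ?invr_gt0// lerD2l; exact: ih.
Qed.

Lemma measurable_dig n : measurable_fun setT (dig n).
Proof.
elim: n => [|n ih] /=; first exact: measurable_cst.
apply: measurable_funM => //; apply: measurable_funD; first exact: measurable_bit.
by apply: measurableT_comp => //; exact: measurableT_comp measurable_dbl measurable_dbl.
Qed.

Definition dlim (x : R) : R := limn (dig ^~ x).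

Lemma dig_cvg x : dig ^~ x @ \oo --> dlim x.
Proof.
apply: nondecreasing_is_cvgn.
  by apply/nondecreasing_seqP => n; exact: dig_incr.
by exists 1 => _ [n _ <-]; have /andP[] := dig01 n x.
Qed.

Lemma dlim01 x : 0 <= dlim x <= 1.
Proof.
apply/andP; split.
  by apply: (cvgr_to_ge (@dig_cvg x)); apply: nearW => n; have /andP[] := dig01 n x.
by apply: (cvgr_to_le (@dig_cvg x)); apply: nearW => n; have /andP[] := dig01 n x.
Qed.

Lemma measurable_dlim : measurable_fun setT dlim.
Proof. by apply: (measurable_fun_cvg measurable_dig) => x _; exact: dig_cvg. Qed.

Lemma dlimE x : dlim x = (bit x + dlim (dbl (dbl x))) / 2.
Proof.
have h1 := @dig_cvg x; rewrite -(cvg_shiftS (dig ^~ x)) in h1.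
have h2 : (fun n => dig n.+1 x) @ \oo --> (bit x + dlim (dbl (dbl x))) / 2.
  by apply: cvgM (cvg_cst _); apply: cvgD; [exact: cvg_cst|exact: dig_cvg].
exact: (cvg_unique (@Rhausdorff R) h1 h2).
Qed.

Lemma pow2_small (r : R) : (forall n, `|r| <= 2 ^- n) -> r = 0.
Proof.
move=> h; apply/eqP; rewrite -normr_le0.
have : (fun n => (2 ^- n : R)) @ \oo --> 0.
  by under eq_fun do rewrite -exprVn; apply: cvg_expr; rewrite ger0_norm ?invr_ge0// invf_lt1// ltr1n.
by move=> /cvgr_to_ge; apply; apply: nearW => n; exact: h.
Qed.

Let half_norm (x y e : R) : `|x| <= e -> y = 0 -> `|(x + y) / 2| <= e / 2.
Proof.
by move=> h ->; rewrite addr0 normrM (ger0_norm (_ : 0 <= 2^-1)) ?invr_ge0// ler_pM2r ?invr_gt0.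
Qed.

(** At every [a] one of 2a and 2a - 1 lies outside [0, 1[, where [f] vanishes. The equation
    therefore halves any uniform bound on [f], and iteration leaves zero. *)
Lemma halving_unique1 (f : R -> R) : (forall a, `|f a| <= 1) ->
  (forall a, a < 0 -> f a = 0) -> (forall a, 1 <= a -> f a = 0) ->
  (forall a, f a = (f (2 * a) + f (2 * a - 1)) / 2) -> forall a, f a = 0.
Proof.
move=> f1 fN fP fE a; apply: pow2_small => n.
elim: n a => [|n ih] a; first by rewrite expr0 invr1.
rewrite fE exprSr invfM.
have [a2|a2] := ltP a (1 / 2); first by apply: half_norm => //; apply: fN; lra.
by rewrite addrC; apply: half_norm => //; apply: fP; lra.
Qed.

Lemma halving_unique2 (f : R -> R -> R) : (forall a b, `|f a b| <= 1) ->
  (forall a b, a < 0 -> f a b = 0) -> (forall a b, 1 <= a -> f a b = 0) ->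
  (forall a b, b < 0 -> f a b = 0) -> (forall a b, 1 <= b -> f a b = 0) ->
  (forall a b, f a b = (f b (2 * a) + f b (2 * a - 1)) / 2) -> forall a b, f a b = 0.
Proof.
move=> f1 fN fP fN' fP' fE a b; apply: pow2_small => n.
elim: n a b => [|n ih] a b; first by rewrite expr0 invr1.
rewrite fE exprSr invfM.
have [a2|a2] := ltP a (1 / 2); first by apply: half_norm => //; apply: fN'; lra.
by rewrite addrC; apply: half_norm => //; apply: fP'; lra.
Qed.

Let S (a b : R) : R := fine (Q [set x | a < dlim x /\ b < dlim (dbl x)]).

Let mS (a b : R) : measurable [set x | a < dlim x /\ b < dlim (dbl x)].
Proof.
rewrite (_ : [set x | _] = [set x | a < dlim x] `&` [set x | b < dlim (dbl x)])//.
apply: measurableI; apply: measurable_lt_set => //; first exact: measurable_dlim.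
exact: measurableT_comp measurable_dlim measurable_dbl.
Qed.

(** Condition on the leading digit. After one doubling the second number becomes the first, and the
    first, without its leading digit, becomes the second: hence the exchanged arguments. The
    threshold [a] turns into 2a or 2a - 1 according to the digit. *)
Let SE a b : S a b = (S b (2 * a) + S b (2 * a - 1)) / 2.
Proof.
have dE (x : R) : (a < dlim x) = (if x < 1 / 2 then 2 * a < dlim (dbl (dbl x)) else 2 * a - 1 < dlim (dbl (dbl x))).
  by rewrite (@dlimE x) /bit; case: (ltP x (1 / 2)) => x2; rewrite ltr_pdivlMr// mulrC ?add0r ?ltrBlDl.
have h : [set x | a < dlim x /\ b < dlim (dbl x)] =
  (dbl @^-1` [set x | b < dlim x /\ 2 * a < dlim (dbl x)] `&` [set x | x < 1 / 2]) `|`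
  (dbl @^-1` [set x | b < dlim x /\ 2 * a - 1 < dlim (dbl x)] `&` [set x | 1 / 2 <= x]).
  apply/seteqP; split => x /=; rewrite dE.
    by case: ltP => x2 [h1 h2]; [left|right].
  by case: (ltP x (1 / 2)) => x2 -[[[h1 h2] h3]|[[h1 h2] h3]]; split.
rewrite /S h measureU//.
- have q c e : Q [set x | c < dlim x /\ e < dlim (dbl x)] = (S c e)%:E by rewrite /S fineK ?fin_num_measure.
  rewrite [X in (X + _)%E]unif_dbl0// [X in (_ + X)%E]unif_dbl1// !q !halfE -EFinD /=.
  by rewrite [RHS]mulrDl.
- by apply: measurableI; [exact: mpre measurable_dbl (mS _ _)|exact: measurable_lthalf].
- by apply: measurableI; [exact: mpre measurable_dbl (mS _ _)|exact: measurable_gehalf].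
- by apply/seteqP; split => // x /= [[_ h1] [_ h2]]; rewrite ltNge h2 in h1.
Qed.

Let S01 a b : 0 <= S a b <= 1.
Proof.
exact: fine_prob01.
Qed.

Let S_ge1l a b : 1 <= a -> S a b = 0.
Proof.
move=> a1; rewrite /S (_ : [set x | _] = set0) ?measure0//.
by apply/seteqP; split => // x /= [h _]; have := dlim01 x; lra.
Qed.

Let S_ge1r a b : 1 <= b -> S a b = 0.
Proof.
move=> a1; rewrite /S (_ : [set x | _] = set0) ?measure0//.
by apply/seteqP; split => // x /= [_ h]; have := dlim01 (dbl x); lra.
Qed.

Let G (a : R) : R := fine (Q [set x | a < dlim x]).

Let mG (a : R) : measurable [set x | a < dlim x].
Proof. by apply: measurable_lt_set => //; exact: measurable_dlim. Qed.

Let S_lt0r a b : b < 0 -> S a b = G a.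
Proof.
move=> b0; rewrite /S /G; congr (fine (Q _)); apply/seteqP; split => x /= => [[]//|h].
by split => //; have := dlim01 (dbl x); lra.
Qed.

Let S_lt0l a b : a < 0 -> S a b = G b.
Proof.
move=> b0; rewrite /S /G -(unif_dbl (mG b)); congr (fine (Q _)).
apply/seteqP; split => x /= => [[]//|h].
by split => //; have := dlim01 x; lra.
Qed.

Lemma u01E (a : R) : u01 a = (u01 (2 * a) + u01 (2 * a - 1)) / 2.
Proof.
have [a0|a0] := ltP a 0; first by rewrite !u01_lt0; lra.
have [a2|a2] := ltP a (1 / 2).
  by rewrite (@u01_lt0 (2 * a - 1)) ?u01_mid; lra.
have [a1|a1] := leP 1 a; first by rewrite !u01_ge1; lra.
by rewrite (@u01_ge1 (2 * a)) ?u01_mid; lra.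
Qed.

Lemma u01_bound a : 0 <= u01 a <= 1. Proof. exact: clip01_bound. Qed.

Let GE a : G a = u01 a.
Proof.
apply/eqP; rewrite -subr_eq0; apply/eqP; move: a; apply: halving_unique1.
- move=> a; rewrite -(@S_lt0r a (-1)) ?ltrN10// ler_norml.
  by have := S01 a (-1); have := u01_bound a; lra.
- move=> a a0; rewrite u01_lt0// /G (_ : [set x | _] = setT).
    by rewrite [X in fine X]probability_setT subrr.
  by apply/seteqP; split => // x _ /=; have := dlim01 x; lra.
- by move=> a a1; rewrite u01_ge1// -(@S_lt0r a (-1)) ?ltrN10// S_ge1l// subrr.
- move=> a; rewrite [in LHS]u01E.
  rewrite -(@S_lt0r a (-1)) ?ltrN10// SE !S_lt0l ?ltrN10//; lra.
Qed.

(** The product of two uniform tails has the boundary values of [S] and satisfies the same halving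
    equation. This contains both the independence and the uniformity of the two numbers. *)
Let SuE a b : S a b = u01 a * u01 b.
Proof.
apply/eqP; rewrite -subr_eq0; apply/eqP; move: a b; apply: halving_unique2.
- move=> a b; rewrite ler_norml; have := S01 a b; have := u01_bound a; have := u01_bound b; nra.
- by move=> a b a0; rewrite S_lt0l// GE [u01 a]u01_lt0// mul1r subrr.
- by move=> a b a1; rewrite S_ge1l// [u01 a]u01_ge1// mul0r subrr.
- by move=> a b b0; rewrite S_lt0r// GE [u01 b]u01_lt0// mulr1 subrr.
- by move=> a b b1; rewrite S_ge1r// [u01 b]u01_ge1// mulr0 subrr.
- by move=> a b; rewrite SE [in LHS](@u01E a); ring.
Qed.

Lemma dlim_law (A : set R) : measurable A -> Q (dlim @^-1` A) = Q A.
Proof.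
apply: law_ray; first exact: measurable_dlim.
move=> a; rewrite unif_ray -GE /G fineK ?fin_num_measure//.
by congr (Q _); apply/seteqP; split => x /=; rewrite in_itv/= andbT.
Qed.

Definition shift_dig (x : R) : R := dlim (dbl x).

Lemma measurable_shift_dig : measurable_fun setT shift_dig.
Proof. exact: measurableT_comp measurable_dlim measurable_dbl. Qed.

Lemma shift_dig_law (A : set R) : measurable A -> Q (shift_dig @^-1` A) = Q A.
Proof.
move=> mA; rewrite -[RHS]dlim_law// -[RHS]unif_dbl//.
exact: mpre measurable_dlim mA.
Qed.

Lemma indep_dig : indep2 Q dlim shift_dig.
Proof.
move=> A B mA mB; rewrite dlim_law// shift_dig_law//.
have fE (C : set R) : measurable C -> exists2 c : {nonneg R}, ((c%:num)%:E = Q C)%E & true.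
  move=> mC; exists (NngNum (fine_ge0 (measure_ge0 Q C))) => //.
  by rewrite /= fineK// fin_num_measure.
have step1 b : Q (dlim @^-1` A `&` shift_dig @^-1` `]b, +oo[%classic) = (Q A * Q `]b, +oo[%classic)%E.
  have mb : measurable (`]b, +oo[%classic : set R) by exact: measurable_itv.
  have [c cE _] := fE _ mb; rewrite -cE muleC.
  apply: (law_ray_restr measurable_dlim) => //; first exact: mpre measurable_shift_dig mb.
  move=> a; rewrite cE !unif_ray -EFinM mulrC -SuE /S fineK ?fin_num_measure//.
  by congr (Q _); apply/seteqP; split => x /=; rewrite !in_itv/= !andbT.
have [c cE _] := fE _ mA; rewrite setIC -cE.
apply: (law_ray_restr measurable_shift_dig) => //; first exact: mpre measurable_dlim mA.
by move=> b; rewrite setIC cE step1.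
Qed.

(** * Quantile transform and the normal sequence *)

Definition stdN : probability R R := toR (normal_prob 0 1).

Let F (z : R) : R := fine (stdN `]z, +oo[%classic).

Let idR : {mfun R >-> R} := mfun_Sub (mem_set (@measurable_id _ R setT)).

Let FE (z : R) : (F z)%:E = @ccdf _ R R stdN idR z.
Proof. by rewrite /F fineK ?fin_num_measure. Qed.

Let F_anti (x y : R) : x <= y -> F y <= F x.
Proof. by move=> xy; rewrite -lee_fin !FE; exact: ccdf_nonincreasing. Qed.

Let F01 z : 0 <= F z <= 1.
Proof. exact: fine_prob01. Qed.

Let F_right (y z : R) : y < F z -> exists2 z', z < z' & y < F z'.
Proof.
move=> yF; have := @ccdf_right_continuous _ R R stdN idR z.
rewrite -FE => /fine_cvg /cvgr_gt /(_ _ yF) [e /= e0 h].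
exists (z + e / 2); first by lra.
apply: h; last by lra.
by rewrite /= opprD addrA subrr add0r normrN gtr0_norm; lra.
Qed.

Let F_small (y : R) : 0 < y -> exists z, F z < y.
Proof.
move=> y0; have /fine_cvg /cvgr_lt /(_ _ y0) [M [_ h]] := @cvg_ccdfy0 _ R R stdN idR.
by exists (M + 1); apply: h; lra.
Qed.

Let F_large (y : R) : y < 1 -> exists z, y < F z.
Proof.
move=> y1; have /fine_cvg /cvgr_gt /(_ _ y1) [M [_ h]] := @cvg_ccdfNy1 _ R R stdN idR.
by exists (M - 1); apply: h; lra.
Qed.

(** Generalized inverse of the decreasing tail [F]. Outside ]0, 1[, a null set for the uniform law,
    the value 0 is a default. *)
Definition quant (y : R) : R := if (0 < y) && (y < 1) then sup [set z | y <= F z] else 0.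

Let has_sup_quant y : 0 < y -> y < 1 -> has_sup [set z | y <= F z].
Proof.
move=> y0 y1; split.
  by have [z /ltW] := F_large y1; exists z.
have [z0 h] := F_small y0; exists z0 => z /= yz; rewrite leNgt; apply/negP => /ltW /F_anti; lra.
Qed.

Let quant_gt y z : 0 < y -> y < 1 -> y < F z -> z < quant y.
Proof.
move=> y0 y1 /F_right[z' zz' yF']; rewrite /quant y0 y1/=; apply: (lt_le_trans zz').
by apply: ub_le_sup; [have [] := has_sup_quant y0 y1|exact: ltW].
Qed.

Let quant_le y z : 0 < y -> y < 1 -> z < quant y -> y <= F z.
Proof.
move=> y0 y1; rewrite /quant y0 y1/= => /sup_gt[]; first by have [] := has_sup_quant y0 y1.
by move=> z' /= h /ltW /F_anti; exact: le_trans.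
Qed.

Lemma measurable_quant : measurable_fun setT quant.
Proof.
apply: (measurability _ (RGenOInfty.measurableE R)) => // _ [_ [z ->] <-]; rewrite setTI.
have -> : quant @^-1` `]z, +oo[%classic = [set y | (0 < y < 1) /\ z < quant y] `|`
    ([set y | ~~ (0 < y < 1) /\ z < 0]).
  apply/seteqP; split => y /=; rewrite in_itv/= andbT.
    by case: (boolP (0 < y < 1)) => h1 h2; [left|right; rewrite /quant (negbTE h1) in h2].
  by move=> [[]//|[h1 h2]]; rewrite /quant (negbTE h1).
apply: measurableU.
  apply: is_interval_measurable => x y [x01 hx] [y01 hy] w /andP[xw wy] /=.
  have /andP[x0 _] := x01; have /andP[y0 y1] := y01.
  have w0 : 0 < w by exact: lt_le_trans xw.
  have w1 : w < 1 by exact: le_lt_trans y1.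
  rewrite w0 w1; split => //; move: hy; rewrite /quant y0 y1 w0 w1/= => hy.
  apply: (lt_le_trans hy); apply: le_sup.
  - by move=> v /= h; exists v; split => //=; exact: le_trans wy h.
  - by have [] := has_sup_quant y0 y1.
  - exact: has_sup_quant.
have [z0|z0] := ltP z 0; last first.
  by rewrite (_ : [set y | _] = set0)//; apply/seteqP; split => // y [].
rewrite (_ : [set y | _] = ~` `]0, 1[%classic); first by apply: measurableC; exact: measurable_itv.
by apply/seteqP; split => y /=; rewrite in_itv/=; [case=> /negP|move=> /negP].
Qed.

(** Within [0, 1] the set where [quant] exceeds [z] lies between ]0, F z[ and the union of [0, F z]
    and the point 1; both have length F z. *)
Lemma quant_law (A : set R) : measurable A -> Q (quant @^-1` A) = stdN A.
Proof.
apply: law_ray; first exact: measurable_quant.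
move=> z; have mB : measurable (quant @^-1` `]z, +oo[%classic).
  by apply: mpre; [exact: measurable_quant|exact: measurable_itv].
rewrite -[RHS]fineK ?fin_num_measure// -/(F z); have /andP[F0 F1] := F01 z.
apply/eqP; rewrite eq_le; apply/andP; split.
  rewrite unifE//.
  apply: (@le_trans _ _ (mu (`[0, F z]%classic `|` [set 1]))).
    apply: le_measure; rewrite ?inE.
    - exact: measurableI.
    - by apply: measurableU; [exact: measurable_itv|exact: measurable_set1].
    - move=> y [/=]; rewrite !in_itv/= andbT => h /andP[y0 y1].
      have [y1'|y1'] := ltP y 1; last by right; apply/eqP; rewrite eq_le y1.
      left; rewrite y0/=; have [y00|y00] := ltP 0 y; first exact: quant_le.
      exact: le_trans F0.
  apply: (le_trans (measureU2 _ _ _)) => //.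
  have h1 : mu [set 1] = 0%E by exact: lebesgue_measure_set1.
  have h2 : (mu (`[0, F z]%classic)%R <= (F z)%:E)%E.
    by rewrite lebesgue_measure_itv/= lte_fin; case: ltP => _; rewrite ?sube0.
  by rewrite [X in (_ + X <= _)%E]h1 adde0.
rewrite unifE//; apply: (@le_trans _ _ (mu `]0, F z[%classic)).
  rewrite lebesgue_measure_itv/= lte_fin; case: ltP => h; first by rewrite sube0.
  by rewrite lee_fin.
apply: le_measure; rewrite ?inE//; first exact: measurableI.
move=> y /=; rewrite !in_itv/= andbT => /andP[y0 yF]; split; last by lra.
by apply: quant_gt => //; lra.
Qed.

(** [dlim] and [shift_dig] split a uniform variable into two independent uniform ones. Splitting the
    second again and again gives a sequence, which [quant] makes normal. *)
Definition nseqZ (p : nat) (x : R) : R := quant (dlim (iter p shift_dig x)).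

Lemma iter_shift_law p (A : set R) : measurable A -> Q (iter p shift_dig @^-1` A) = Q A.
Proof.
elim: p A => [|p ih] A mA //.
rewrite -[RHS]shift_dig_law// -(ih (shift_dig @^-1` A))//; exact: mpre measurable_shift_dig mA.
Qed.

Lemma measurable_iter_shift p : measurable_fun setT (iter p shift_dig).
Proof.
elim: p => [|p ih]; first exact: measurable_id.
exact: measurableT_comp measurable_shift_dig ih.
Qed.

Lemma measurable_nseqZ p : measurable_fun setT (nseqZ p).
Proof.
apply: measurableT_comp; first exact: measurable_quant.
by apply: measurableT_comp; [exact: measurable_dlim|exact: measurable_iter_shift].
Qed.

Lemma nseqZ_law p (A : set R) : measurable A -> Q (nseqZ p @^-1` A) = stdN A.
Proof.
move=> mA; rewrite -quant_law//.
have m1 : measurable (quant @^-1` A) by exact: mpre measurable_quant mA.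
have m2 : measurable (dlim @^-1` (quant @^-1` A)) by exact: mpre measurable_dlim m1.
by rewrite -[RHS](dlim_law m1) -[RHS](iter_shift_law p m2).
Qed.

Lemma nseqZ_cos p (a th : R) : Ex Q (fun x => cos (a * nseqZ p x + th)) = cos th * expR (- (a ^+ 2 / 2)).
Proof.
have mc : measurable_fun setT (fun z : R => cos (a * z + th)).
  by apply: measurable_cos_fun; apply: measurable_funD => //; exact: measurable_funM.
rewrite (@Ex_law _ _ _ Q stdN (nseqZ p) (measurable_nseqZ p) (fun z => cos (a * z + th)) (nseqZ_law p)); last first.
  by split => //; exists 1 => w; exact: cos_max.
have := @normal_cos R 1 ltr01 th a; rewrite expr1n mul1r => <-.
by apply: Ex_toR; split => //; exists 1 => w; exact: cos_max.
Qed.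

(** Variable 0 is peeled off: the others form the same sequence at [shift_dig x], independent of
    [dlim x]. In the addition formula the sine term vanishes by symmetry of the normal law. Later
    sections use the independence of the sequence through this identity alone. *)
Lemma nseqZ_lin_cos M (a : nat -> R) (th : R) :
  Ex Q (fun x => cos (\sum_(p < M) a p * nseqZ p x + th)) =
  cos th * expR (- ((\sum_(p < M) a p ^+ 2) / 2)).
Proof.
elim: M a th => [|M ih] a th.
  under [X in Ex Q X]funext do rewrite big_ord0 add0r.
  by rewrite Ex_cst big_ord0 mul0r oppr0 expR0 mulr1.
pose Sm (x : R) : R := \sum_(p < M) a p.+1 * nseqZ p x.
have mS' : measurable_fun setT Sm.
  by apply: measurable_sum => p; apply: measurable_funM => //; exact: measurable_nseqZ.
have E x : \sum_(p < M.+1) a p * nseqZ p x + th = a 0%N * nseqZ 0 x + (Sm (shift_dig x) + th).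
  rewrite big_ord_recl addrA; congr (_ + _ + _); apply: eq_bigr => i _.
  by rewrite /nseqZ /= -iterSr.
have msin (f : R -> R) : measurable_fun setT f -> measurable_fun setT (fun w => sin (f w)).
  by move=> mf; apply: measurableT_comp => //; apply: continuous_measurable_fun; exact: continuous_sin.
have b1 : bmeas (fun y : R => cos (a 0%N * quant y)).
  split; last by exists 1 => w; exact: cos_max.
  by apply: measurable_cos_fun; apply: measurable_funM => //; exact: measurable_quant.
have b2 : bmeas (fun y : R => sin (a 0%N * quant y)).
  split; last by exists 1 => w; exact: sin_max.
  by apply: msin; apply: measurable_funM => //; exact: measurable_quant.
have b3 : bmeas (fun y : R => cos (Sm y + th)).
  split; last by exists 1 => w; exact: cos_max.
  by apply: measurable_cos_fun; apply: measurable_funD.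
have b4 : bmeas (fun y : R => sin (Sm y + th)).
  split; last by exists 1 => w; exact: sin_max.
  by apply: msin; apply: measurable_funD.
have bd (g : R -> R) (X : R -> R) : measurable_fun setT X -> bmeas g -> mom Q (fun x => g (X x)).
  move=> mX [mg [C gC]]; apply: bmeas_mom; split; first exact: measurableT_comp mg mX.
  by exists C => w; exact: gC.
have prod (f g : R -> R) : bmeas f -> bmeas g ->
    Ex Q (fun x => f (dlim x) * g (shift_dig x)) = Ex Q (fun x => f (dlim x)) * Ex Q g.
  move=> bf bg; rewrite (@Ex_indepM _ _ _ Q (fun x => f (dlim x)) (fun x => g (shift_dig x))).
  - by congr (_ * _); exact: (@Ex_law _ _ _ Q Q shift_dig measurable_shift_dig g shift_dig_law).
  - by apply: bd => //; exact: measurable_dlim.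
  - by apply: bd => //; exact: measurable_shift_dig.
  - by apply: indep2_comp; [case: bf|case: bg|exact: indep_dig].
have -> : (fun x => cos (\sum_(p < M.+1) a p * nseqZ p x + th)) = fun x =>
    cos (a 0%N * quant (dlim x)) * cos (Sm (shift_dig x) + th) - sin (a 0%N * quant (dlim x)) * sin (Sm (shift_dig x) + th).
  by apply/funext => x; rewrite E [LHS]cosD.
have L (f g : R -> R) : bmeas f -> bmeas g -> L1 Q (fun x => f (dlim x) * g (shift_dig x)).
  by move=> bf bg; apply/mom_L1/momM; apply: bd => //; [exact: measurable_dlim|exact: measurable_shift_dig].
rewrite ExB; [|exact: (L _ _ b1 b3)|exact: (L _ _ b2 b4)].
rewrite (prod _ _ b1 b3) (prod _ _ b2 b4).
have -> : Ex Q (fun x => cos (a 0%N * quant (dlim x))) = expR (- (a 0%N ^+ 2 / 2)).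
  have := nseqZ_cos 0 (a 0%N) 0; rewrite cos0 mul1r => <-.
  by congr Ex; apply/funext => x; rewrite addr0.
have -> : Ex Q (fun x => sin (a 0%N * quant (dlim x))) = 0.
  have := nseqZ_cos 0 (a 0%N) (- (pi / 2)); rewrite cosN cos_pihalf mul0r => <-.
  by congr Ex; apply/funext => x; rewrite cosBpihalf.
rewrite mul0r subr0 /Sm (ih (fun p => a p.+1)) big_ord_recl mulrCA -expRD; congr (_ * expR _).
by rewrite mulrDl opprD.
Qed.

Lemma nseqZ_tail4 : exists C : R, forall p l, 0 < l ->
  fine (Q [set x | l < `|nseqZ p x|]) <= C / l ^+ 4.
Proof.
have [C hC] := @normal_tail4 R 1 ltr01; exists C => p l l0.
have mA : measurable [set x : R | l < `|x|] by exact: (@measurable_gt_norm _ R R id).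
by rewrite -[X in fine X](_ : stdN [set x | l < `|x|] = _); [exact: hC|rewrite -(nseqZ_law p mA)].
Qed.

End IidNormals.

(** * The Brownian bridge *)

Section TentSums.
Context {R : realType}.
Implicit Types (x y : R).

Definition tent x : R := Num.max 0 (Num.min x (1 - x)).

Lemma tent_ge0 x : 0 <= tent x. Proof. by rewrite /tent le_max lexx. Qed.

Lemma tent_out x : x <= 0 \/ 1 <= x -> tent x = 0.
Proof.
by move=> h; rewrite /tent max_l// ge_min; apply/orP; case: h => h; [left|right]; lra.
Qed.

Lemma tent_le1 x : tent x <= 1.
Proof. by rewrite /tent ge_max ler01/= ge_min; case: (leP x 1) => //=; lra. Qed.

Lemma continuous_tent : continuous (tent : R -> R).
Proof.
move=> x; rewrite /tent; apply: (@continuous_max R R (cst 0) (fun x => Num.min x (1 - x))).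
  exact: cvg_cst.
apply: (@continuous_min R R id (fun x => 1 - x)); first exact: cvg_id.
by apply: cvgB; [exact: cvg_cst|exact: cvg_id].
Qed.

Definition level (n : nat) x y : R := \sum_(k < 2 ^ n) tent (2 ^+ n * x - k%:R) * tent (2 ^+ n * y - k%:R).

Definition lsum (n : nat) x : R := \sum_(k < 2 ^ n) tent (2 ^+ n * x - k%:R).

Lemma dyadic_sumS (F : R -> R -> R) n x y :
  \sum_(k < 2 ^ n.+1) F (2 ^+ n.+1 * x - k%:R) (2 ^+ n.+1 * y - k%:R) =
  \sum_(k < 2 ^ n) F (2 ^+ n * (2 * x) - k%:R) (2 ^+ n * (2 * y) - k%:R) +
  \sum_(k < 2 ^ n) F (2 ^+ n * (2 * x - 1) - k%:R) (2 ^+ n * (2 * y - 1) - k%:R).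
Proof.
have E : (2 ^ n.+1 = 2 ^ n + 2 ^ n)%N by rewrite expnS mul2n addnn.
rewrite -(big_mkord predT (fun k => F (2 ^+ n.+1 * x - k%:R) (2 ^+ n.+1 * y - k%:R))) E.
rewrite (big_cat_nat (n := 2 ^ n))//= ?leq_addr// big_mkord; congr (_ + _).
  by apply: eq_bigr => k _; rewrite exprSr !mulrA.
rewrite -{1}[(2 ^ n)%N]add0n big_addn addnK big_mkord; apply: eq_bigr => k _.
by rewrite natrD natrX; congr F; rewrite exprSr; ring.
Qed.

Lemma levelS n x y : level n.+1 x y = level n (2 * x) (2 * y) + level n (2 * x - 1) (2 * y - 1).
Proof. exact: (dyadic_sumS (fun a b => tent a * tent b)). Qed.

Lemma lsumS n x : lsum n.+1 x = lsum n (2 * x) + lsum n (2 * x - 1).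
Proof. exact: (dyadic_sumS (fun a b => tent a) n x x). Qed.

(** The tents of one generation have supports with disjoint interiors, so their sum is bounded like
    a single tent. *)
Lemma lsum_bound n x : 0 <= lsum n x <= 1 /\ (x <= 0 \/ 1 <= x -> lsum n x = 0).
Proof.
elim: n x => [|n ih] x.
  rewrite /lsum expn0 big_ord1 expr0 mul1r subr0 tent_ge0 tent_le1; split => //; exact: tent_out.
have [/andP[h1 h2] h3] := ih (2 * x); have [/andP[h4 h5] h6] := ih (2 * x - 1).
rewrite lsumS; split.
  have [x2|x2] := leP x (1 / 2); first by rewrite h6; [lra|left; lra].
  by rewrite h3; [lra|right; lra].
by move=> [x0|x1]; rewrite h3 ?h6 ?addr0//; [left|left|right|right]; lra.
Qed.

(* Covariance of the Brownian bridge on [0, 1], extended by 0. *)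
Definition bcov x y : R := Num.max 0 (Num.min x y) * Num.max 0 (1 - Num.max x y).

(** Midpoint displacement at the level of covariances: a bridge is a tent carrying the value at 1/2,
    plus two independent bridges of half the length. The midpoint variance 1/4 is tent(1/2)^2, and
    Brownian scaling produces the factor 1/2. *)
Lemma bcovE x y : bcov x y = tent x * tent y + (bcov (2 * x) (2 * y) + bcov (2 * x - 1) (2 * y - 1)) / 2.
Proof.
wlog xy : x y / x <= y.
  move=> W; case: (leP x y) => [/W//|/ltW/W].
  have C u v : bcov u v = bcov v u by rewrite /bcov (minC u) (maxC u).
  by rewrite C [tent y * _]mulrC (C (2 * y)) (C (2 * y - 1)).
have E u v : u <= v -> bcov u v = Num.max 0 u * Num.max 0 (1 - v).
  by move=> uv; rewrite /bcov (min_l uv) (max_r uv).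
have Pp (z : R) : 0 <= z -> Num.max 0 z = z by move=> h; rewrite max_r.
have Pn (z : R) : z <= 0 -> Num.max 0 z = 0 by move=> h; rewrite max_l.
have tL z : z <= 1 / 2 -> tent z = Num.max 0 z by move=> h; rewrite /tent min_l//; lra.
have tR z : 1 / 2 <= z -> tent z = Num.max 0 (1 - z) by move=> h; rewrite /tent min_r//; lra.
have cases (a b : R) : a <= b \/ b <= a by case: (leP a b) => h; [left|right; exact: ltW].
rewrite !E; try lra.
have [x0|x0] := cases x 0.
  by rewrite (tL x) ?(Pn x) ?(Pn (2 * x)) ?(Pn (2 * x - 1)); lra.
have [y1|y1] := cases 1 y.
  by rewrite (tR y) ?(Pn (1 - y)) ?(Pn (1 - 2 * y)) ?(Pn (1 - (2 * y - 1))); lra.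
have [y2|y2] := cases y (1 / 2).
  by rewrite (tL y) ?(tL x) ?(Pn (2 * x - 1)) ?(Pp x) ?(Pp y) ?(Pp (1 - y)) ?(Pp (2 * x)) ?(Pp (1 - 2 * y)); lra.
rewrite (tR y) ?(Pn (1 - 2 * y)) ?(Pp (1 - y)) ?(Pp x) ?(Pp (1 - (2 * y - 1))); try lra.
have [x2|x2] := cases x (1 / 2).
  by rewrite (tL x) ?(Pp x) ?(Pn (2 * x - 1)); lra.
by rewrite (tR x) ?(Pp (1 - x)) ?(Pp (2 * x - 1)); lra.
Qed.

Lemma cvg_sumr (J : Type) (F : set_system J) (FF : Filter F) (I : Type) (s : seq I)
    (f : I -> J -> R) (l : I -> R) :
  (forall i, f i @ F --> l i) -> (fun j => \sum_(i <- s) f i j) @ F --> \sum_(i <- s) l i.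
Proof.
move=> h; elim: s => [|i s ih].
  by under eq_fun do rewrite big_nil; rewrite big_nil; exact: cvg_cst.
by under eq_fun do rewrite big_cons; rewrite big_cons; exact: cvgD.
Qed.

Lemma bcov_bound x y : 0 <= bcov x y <= 1 /\ (x <= 0 \/ 1 <= x -> bcov x y = 0).
Proof.
rewrite /bcov; set a := Num.max 0 (Num.min x y); set b := Num.max 0 _.
have a0 : 0 <= a by rewrite /a le_max lexx.
have b0 : 0 <= b by rewrite /b le_max lexx.
have h0 : x <= 0 -> a = 0 by move=> h; rewrite /a max_l// ge_min h.
have h1 : 1 <= x -> b = 0 by move=> h; rewrite /b max_l// subr_le0 le_max h.
split; last by case=> [/h0 ->|/h1 ->]; rewrite ?mul0r ?mulr0.
have [x0|x0] := leP x 0; first by rewrite h0// mul0r lexx ler01.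
have [x1|x1] := leP 1 x; first by rewrite h1// mulr0 lexx ler01.
have a1 : a <= 1 by rewrite /a ge_max ler01/= ge_min (ltW x1).
have b1 : b <= 1 by rewrite /b ge_max ler01/= lerBlDr lerDl le_max (ltW x0).
by rewrite mulr_ge0//= mulr_ile1.
Qed.

Definition psumcov (N : nat) x y : R := \sum_(n < N) 2 ^- n * level n x y.

Lemma psumcovS N x y : psumcov N.+1 x y =
  tent x * tent y + (psumcov N (2 * x) (2 * y) + psumcov N (2 * x - 1) (2 * y - 1)) / 2.
Proof.
rewrite /psumcov big_ord_recl expr0 invr1 mul1r; congr (_ + _).
  by rewrite /level expn0 big_ord1 expr0 !mul1r !subr0.
rewrite mulrDl !mulr_suml -big_split/=; apply: eq_bigr => n _.
by rewrite levelS /bump leq0n add1n exprS invfM; ring.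
Qed.

(** [bcov] and its partial sums obey the same recursion, and for every [x] one of the two half-scale
    errors is zero; each generation thus halves the bound. *)
Lemma psumcov_bound N x y : `|bcov x y - psumcov N x y| <= 2 ^- N /\
  (x <= 0 \/ 1 <= x -> bcov x y - psumcov N x y = 0).
Proof.
elim: N x y => [|N ih] x y.
  rewrite /psumcov big_ord0 subr0 expr0 invr1; have [/andP[h1 h2] h3] := bcov_bound x y.
  by rewrite ger0_norm.
have [h1 h2] := ih (2 * x) (2 * y); have [h3 h4] := ih (2 * x - 1) (2 * y - 1).
have E : bcov x y - psumcov N.+1 x y = ((bcov (2 * x) (2 * y) - psumcov N (2 * x) (2 * y)) +
  (bcov (2 * x - 1) (2 * y - 1) - psumcov N (2 * x - 1) (2 * y - 1))) / 2.
  by rewrite bcovE psumcovS; field.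
have hn (a : R) : `|a| <= 2 ^- N -> `|a / 2| <= 2 ^- N.+1.
  by rewrite exprSr invfM normrM (ger0_norm (_ : 0 <= 2^-1)) ?invr_ge0// ler_pM2r ?invr_gt0.
rewrite E; split.
  have [x2|x2] := leP x (1 / 2).
    by rewrite h4 ?addr0; [exact: hn|left; lra].
  by rewrite h2 ?add0r; [exact: hn|right; lra].
by move=> [x0|x1]; rewrite h2 ?h4 ?addr0 ?mul0r//; [left|left|right|right]; lra.
Qed.

Lemma pow2_cvg0 : (fun n => (2 ^- n : R)) @ \oo --> 0.
Proof.
by under eq_fun do rewrite -exprVn; apply: cvg_expr; rewrite ger0_norm ?invr_ge0// invf_lt1// ltr1n.
Qed.

Lemma psumcov_cvg x y : psumcov N x y @[N --> \oo] --> bcov x y.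
Proof.
apply/cvgrPdist_le => e e0; have /cvgrPdist_le/(_ _ e0) := pow2_cvg0.
apply: filterS => N; rewrite sub0r normrN ger0_norm ?invr_ge0// => h.
by have [h1 _] := psumcov_bound N x y; exact: le_trans h.
Qed.

(** Subtracting the geometric remainder [g] makes the sequence monotone and bounded from [n0] on, so
    it converges. *)
Lemma geometric_cvg (u : nat -> R) (r : R) n0 : 0 <= r -> r < 1 ->
  (forall n, (n0 <= n)%N -> `|u n.+1 - u n| <= r ^+ n) ->
  exists2 l, u @ \oo --> l & forall n, (n0 <= n)%N -> `|l - u n| <= r ^+ n / (1 - r).
Proof.
move=> r0 r1 hu; have s0 : 0 < 1 - r by lra.
pose g n := r ^+ n / (1 - r).
have gS n : g n - g n.+1 = r ^+ n by rewrite /g exprS; field; rewrite gt_eqF.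
have g0 n : 0 <= g n by rewrite divr_ge0 ?exprn_ge0// ltW.
have close n k : (n0 <= n)%N -> `|u (n + k)%N - u n| <= g n - g (n + k)%N.
  move=> nn; elim: k => [|k ih]; first by rewrite addn0 !subrr normr0.
  have h := hu (n + k)%N (leq_trans nn (leq_addr _ _)).
  rewrite addnS; apply: (le_trans (ler_distD (u (n + k)%N) _ _)).
  by have := gS (n + k)%N; lra.
have cg : g @ \oo --> 0.
  rewrite -[X in _ --> X](mul0r (1 - r)^-1); apply: cvgM; last exact: cvg_cst.
  by apply: cvg_expr; rewrite ger0_norm.
pose a n := u (n + n0)%N - g (n + n0)%N.
have ia : nondecreasing_seq a.
  apply/nondecreasing_seqP => n; rewrite /a addSn.
  by have := hu (n + n0)%N (leq_addl _ _); rewrite ler_norml; have := gS (n + n0)%N; lra.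
have ba : has_ubound (range a).
  exists (u n0 + g n0) => _ [n _ <-]; rewrite /a.
  by have := close n0 n (leqnn _); rewrite addnC ler_norml; have := g0 (n + n0)%N; lra.
have /cvg_ex[l ca] := nondecreasing_is_cvgn ia ba.
have cu : u @ \oo --> l.
  rewrite -(cvg_shiftn n0).
  have -> : [sequence u (n + n0)%N]_n = (fun n => a n + g (n + n0)%N).
    by apply/funext => n; rewrite /a/= subrK.
  rewrite -[l]addr0; apply: cvgD => //.
  by rewrite (cvg_shiftn n0 g).
exists l => // n nn.
have : (fun k => `|u (k + n)%N - u n|) @ \oo --> `|l - u n|.
  apply: cvg_norm; apply: cvgB; last exact: cvg_cst.
  by rewrite (cvg_shiftn n u).
move=> /cvgr_to_le; apply; apply: nearW => k.
by rewrite addnC (le_trans (close n k nn))// lerBlDr lerDl.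
Qed.

End TentSums.

(** * The Schauder series *)

Section BrownianBridge.
Context {R : realType}.
Context {d : measure_display} {T : measurableType d} (P : probability T R).
Variable Z : nat -> T -> R.
Hypothesis mZ : forall p, measurable_fun setT (Z p).
Hypothesis Z_cos : forall M (a : nat -> R) (th : R),
  Ex P (fun w => cos (\sum_(p < M) a p * Z p w + th)) = cos th * expR (- ((\sum_(p < M) a p ^+ 2) / 2)).

Let c : R := (Num.sqrt 2)^-1.
(** The growth rate allowed to the normal variables lies between 2^(1/4) and sqrt 2. Above the
    former, fourth-moment tails over 2^n variables are summable; below the latter, c q < 1 and the
    series converges uniformly. *)
Let q : R := 5 / 4.

Let c0 : 0 < c. Proof. by rewrite invr_gt0 sqrtr_gt0. Qed.

Let c2 : c ^+ 2 = 2^-1. Proof. by rewrite exprVn sqr_sqrtr. Qed.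

Hypothesis Z_growth : forall w, exists n0 : nat, forall n k, (n0 <= n)%N -> (k < 2 ^ n)%N ->
  `|Z (2 ^ n + k)%N w| <= q ^+ n.

(** Tent [k] of generation [n] has index p = 2^n + k. At p = 0 stands 0 in place of the linear
    function, whose term would turn the bridge into Brownian motion. *)
Definition schauder (p : nat) (x : R) : R :=
  let n := trunc_log 2 p in
  if p is 0%N then 0 else c ^+ n * tent (2 ^+ n * x - (p - 2 ^ n)%:R).

Lemma schauderE n k x : (k < 2 ^ n)%N -> schauder (2 ^ n + k) x = c ^+ n * tent (2 ^+ n * x - k%:R).
Proof.
move=> kn; have tl : trunc_log 2 (2 ^ n + k) = n.
  by apply: trunc_log_eq => //; rewrite leq_addr expnS mul2n -addnn ltn_add2l.
rewrite /schauder tl addKn; case E : (2 ^ n + k)%N => //.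
by move: E => /eqP; rewrite addn_eq0 expn_eq0.
Qed.

Lemma sum_dyadic_blocks (F : nat -> R) N :
  \sum_(p < 2 ^ N) F p = F 0%N + \sum_(n < N) \sum_(k < 2 ^ n) F (2 ^ n + k)%N.
Proof.
elim: N => [|N ih]; first by rewrite expn0 big_ord1 big_ord0 addr0.
have E : (2 ^ N.+1 = 2 ^ N + 2 ^ N)%N by rewrite expnS mul2n addnn.
rewrite big_ord_recr/= addrA -ih E -(big_mkord predT F) (big_cat_nat (n := 2 ^ N))//= ?leq_addr// big_mkord.
congr (_ + _); rewrite -{1}[(2 ^ N)%N]add0n big_addn addnK big_mkord.
by apply: eq_bigr => k _; rewrite addnC.
Qed.

Definition pbridge (N : nat) (x : R) (w : T) : R := \sum_(p < 2 ^ N) schauder p x * Z p w.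

Definition bridge (x : R) (w : T) : R := limn (fun N => pbridge N x w).

Lemma pbridgeS N x w : pbridge N.+1 x w - pbridge N x w =
  c ^+ N * \sum_(k < 2 ^ N) tent (2 ^+ N * x - k%:R) * Z (2 ^ N + k)%N w.
Proof.
rewrite /pbridge !(sum_dyadic_blocks (fun p => schauder p x * Z p w)) big_ord_recr/=.
rewrite opprD addrACA subrr add0r addrAC subrr add0r mulr_sumr.
by apply: eq_bigr => k _; rewrite schauderE// mulrA.
Qed.

Let r : R := c * q.

Let r0 : 0 <= r. Proof. by rewrite mulr_ge0 ?(ltW c0)// divr_ge0. Qed.

Let r1 : r < 1.
Proof.
rewrite -(@ltr_pXn2r _ 2)// ?nnegrE// expr1n exprMn c2 /q; lra.
Qed.

Lemma bridge_approx w : exists n0 : nat, forall x,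
  (fun N => pbridge N x w) @ \oo --> bridge x w /\
  forall N, (n0 <= N)%N -> `|bridge x w - pbridge N x w| <= r ^+ N / (1 - r).
Proof.
have [n0 hn0] := Z_growth w; exists n0 => x.
have [|l cl hl] := @geometric_cvg R (fun N => pbridge N x w) r n0 r0 r1.
  move=> n nn; rewrite pbridgeS normrM ger0_norm ?exprn_ge0 ?(ltW c0)//.
  rewrite /r exprMn ler_pM2l ?exprn_gt0//; apply: (le_trans (ler_norm_sum _ _ _)).
  apply: (@le_trans _ _ (\sum_(k < 2 ^ n) tent (2 ^+ n * x - k%:R) * q ^+ n)).
    apply: ler_sum => k _; rewrite normrM ger0_norm ?tent_ge0// ler_wpM2l ?tent_ge0//.
    exact: hn0.
  rewrite -mulr_suml -/(lsum n x); have [/andP[_ h] _] := lsum_bound n x.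
  by rewrite ler_piMl// exprn_ge0// divr_ge0.
have E : bridge x w = l by apply: cvg_lim => //; exact: Rhausdorff.
by rewrite E.
Qed.

Lemma bridge_cvg x w : (fun N => pbridge N x w) @ \oo --> bridge x w.
Proof. by have [n0 h] := bridge_approx w; have [] := h x. Qed.

Lemma measurable_pbridge N x : measurable_fun setT (pbridge N x).
Proof. by apply: measurable_sum => p; exact: measurable_funM. Qed.

Lemma measurable_bridge x : measurable_fun setT (bridge x).
Proof.
apply: (@measurable_fun_cvg _ _ _ setT (fun N => pbridge N x)) => [N|w _]; first exact: measurable_pbridge.
exact: bridge_cvg.
Qed.

Lemma continuous_schauder p : continuous (schauder p : R -> R).
Proof.
case: p => [|p] x; first exact: cvg_cst.
rewrite /schauder; apply: cvgM; first exact: cvg_cst.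
apply: (@continuous_comp _ _ _ (fun x : R => 2 ^+ _ * x - _) tent); last exact: continuous_tent.
by apply: cvgB; [apply: cvgM; [exact: cvg_cst|exact: cvg_id]|exact: cvg_cst].
Qed.

Lemma continuous_pbridge N w : continuous (pbridge N ^~ w : R -> R).
Proof.
move=> x; apply: cvg_sumr => p.
by apply: cvgM; [exact: continuous_schauder|exact: cvg_cst].
Qed.

Lemma continuous_bridge w : continuous (bridge ^~ w : R -> R).
Proof.
have [n0 h] := bridge_approx w; move=> x; apply/cvgrPdist_le => e e0.
have e3 : 0 < e / 3 by rewrite divr_gt0.
have : (fun N => r ^+ N / (1 - r)) @ \oo --> 0.
  rewrite -[X in _ --> X](mul0r (1 - r)^-1); apply: cvgM; last exact: cvg_cst.
  by apply: cvg_expr; rewrite ger0_norm.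
move=> /cvgrPdist_le/(_ _ e3) [n1 _ hn1].
pose N := maxn n0 n1.
have hN y : `|bridge y w - pbridge N y w| <= e / 3.
  have [_ h2] := h y; apply: (le_trans (h2 N (leq_maxl _ _))).
  have := hn1 N (leq_maxr _ _); rewrite sub0r normrN; apply: le_trans; exact: ler_norm.
have /cvgrPdist_le/(_ _ e3) := @continuous_pbridge N w x; apply: filterS => y hy.
have h1 := hN x; have h2 := hN y.
rewrite !ler_norml in h1 h2 hy *; lra.
Qed.

Definition lin_time (s : seq (R * R)) (B : R -> T -> R) (w : T) : R := \sum_(p <- s) p.2 * B p.1 w.

Definition quad_form (K : R -> R -> R) (s : seq (R * R)) : R :=
  \sum_(p <- s) \sum_(p' <- s) p.2 * p'.2 * K p.1 p'.1.

Lemma schauder_cov N x y : \sum_(p < 2 ^ N) schauder p x * schauder p y = psumcov N x y.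
Proof.
rewrite (sum_dyadic_blocks (fun p => schauder p x * schauder p y)) /= mul0r add0r.
apply: eq_bigr => n _; rewrite /level mulr_sumr; apply: eq_bigr => k _.
rewrite !schauderE//; have -> : 2 ^- n = c ^+ n * c ^+ n by rewrite -expr2 -exprM mulnC exprM c2 exprVn.
by ring.
Qed.

Let acoef (s : seq (R * R)) (p : nat) : R := \sum_(j <- s) j.2 * schauder p j.1.

Let acoef_sqr s N : \sum_(p < 2 ^ N) acoef s p ^+ 2 = quad_form (psumcov N) s.
Proof.
rewrite /quad_form.
under [RHS]eq_bigr => j _ do under eq_bigr => l _ do rewrite -schauder_cov mulr_sumr.
under [RHS]eq_bigr => j _ do rewrite exchange_big/=.
rewrite exchange_big/=; apply: eq_bigr => p _; rewrite expr2 /acoef big_distrlr/=.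
by apply: eq_bigr => j _; apply: eq_bigr => l _; ring.
Qed.

Let quad_cvg s : quad_form (psumcov N) s @[N --> \oo] --> quad_form bcov s.
Proof.
rewrite /quad_form; apply: cvg_sumr => j; apply: cvg_sumr => l.
by apply: cvgM; [exact: cvg_cst|exact: psumcov_cvg].
Qed.

Lemma bridge_quad_ge0 s : 0 <= quad_form bcov s.
Proof.
apply: (cvgr_to_ge (@quad_cvg s)); apply: nearW => N.
by rewrite -acoef_sqr; apply: sumr_ge0 => p _; exact: sqr_ge0.
Qed.

(** A partial sum is a combination of finitely many [Z], to which [Z_cos] applies. The left side
    passes to the limit by bounded convergence, the right side by [psumcov_cvg]. *)
Lemma bridge_cos s th :
  Ex P (fun w => cos (lin_time s bridge w + th)) = cos th * expR (- (quad_form bcov s / 2)).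
Proof.
have mlin B : (forall x, measurable_fun setT (B x)) -> measurable_fun setT (fun w => cos (lin_time s B w + th)).
  move=> mB; apply: measurable_cos_fun; apply: measurable_funD => //.
  by apply: measurable_sum => j; exact: measurable_funM.
have ce : continuous (fun v : R => cos th * expR (- (v / 2))).
  move=> v; apply: cvgM; first exact: cvg_cst.
  apply: (@continuous_comp _ _ _ (fun v : R => - (v / 2)) expR); last exact: continuous_expR.
  by apply: cvgN; apply: cvgM; [exact: cvg_id|exact: cvg_cst].
have lim1 : Ex P (fun w => cos (lin_time s (pbridge N) w + th)) @[N --> \oo] -->
    Ex P (fun w => cos (lin_time s bridge w + th)).
  apply: (@Ex_cvg _ _ _ P _ _ 1).
  - by move=> N; apply: mlin => x; exact: measurable_pbridge.
  - by move=> N w; exact: cos_max.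
  - move=> w; apply: (@cvg_comp _ _ _ (fun N => lin_time s (pbridge N) w + th) cos); last exact: continuous_cos.
    apply: cvgD; last exact: cvg_cst.
    by apply: cvg_sumr => j; apply: cvgM; [exact: cvg_cst|exact: bridge_cvg].
have lim2 : Ex P (fun w => cos (lin_time s (pbridge N) w + th)) @[N --> \oo] -->
    cos th * expR (- (quad_form bcov s / 2)).
  have E N : Ex P (fun w => cos (lin_time s (pbridge N) w + th)) = cos th * expR (- (quad_form (psumcov N) s / 2)).
    rewrite -acoef_sqr -Z_cos; congr Ex; apply/funext => w; congr (cos (_ + _)).
    rewrite /lin_time /pbridge; under eq_bigr => j _ do rewrite mulr_sumr.
    rewrite exchange_big/=; apply: eq_bigr => p _; rewrite /acoef mulr_suml.
    by apply: eq_bigr => j _; rewrite mulrA.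
  under eq_fun do rewrite E.
  by apply: (@cvg_comp _ _ _ (fun N => quad_form (psumcov N) s) (fun v => cos th * expR (- (v / 2))) _ _ _ _ (ce _)); exact: quad_cvg.
exact: (cvg_unique (@Rhausdorff R) lim1 lim2).
Qed.

End BrownianBridge.

Section UnionBound.
Context {d : measure_display} {T : measurableType d} {R : realType}.
Variable P : probability T R.

Lemma Pr_union_le (m : nat) (A : nat -> set T) : (forall k, measurable (A k)) ->
  fine (P (\bigcup_(k in `I_m) A k)) <= \sum_(k < m) fine (P (A k)).
Proof.
move=> mA; rewrite bigcup_mkord -lee_fin fineK; last first.
  by apply: fin_num_measure; apply: bigsetU_measurable.
apply: (le_trans (@Boole_inequality _ _ _ P A m (fun i _ => mA i))).
by rewrite -sumEFin le_eqVlt; apply/orP; left; apply/eqP; apply: eq_bigr => k _; rewrite fineK ?fin_num_measure.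
Qed.

Lemma borel_cantelli_geometric (F : nat -> set T) (C r : R) : (forall k, measurable (F k)) ->
  0 <= C -> 0 < r -> r < 1 -> (forall n, fine (P (F n)) <= C * r ^+ n) ->
  P (lim_sup_set F) = 0%E.
Proof.
move=> mF C0 r0 r1 hF; apply: lim_sup_set_cvg0 => //.
apply: (@le_lt_trans _ _ (C * (1 - r)^-1)%:E); last exact: ltry.
apply: lime_le; first by apply: is_cvg_ereal_nneg_natsum => n _; exact: measure_ge0.
apply: nearW => N; rewrite big_mkord.
have -> : (\sum_(i < N) P (F i) = (\sum_(i < N) fine (P (F i)))%:E)%E.
  by rewrite -sumEFin; apply: eq_bigr => k _; rewrite fineK ?fin_num_measure.
rewrite lee_fin; apply: (@le_trans _ _ (series (geometric C r) N)).
  by rewrite /series/= big_mkord; apply: ler_sum => k _; exact: hF.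
by apply: geometric_le_lim => //; rewrite ger0_norm// ltW.
Qed.

End UnionBound.

(** * A bridge with every path continuous *)

Section BridgeExistence.
Context {R : realType}.
Local Notation Q := (@unif R).
Let q : R := 5 / 4.

Let bad (n : nat) : set R := \bigcup_(k in `I_(2 ^ n)) [set x | q ^+ n < `|nseqZ (2 ^ n + k) x|].

Let mbad1 n k : measurable [set x : R | q ^+ n < `|nseqZ (2 ^ n + k) x|].
Proof. by apply: measurable_gt_norm; exact: measurable_nseqZ. Qed.

Let mbad n : measurable (bad n).
Proof. by apply: fin_bigcup_measurable => // k _; exact: mbad1. Qed.

Let good : set R := ~` lim_sup_set bad.

Let mlimsup : measurable (lim_sup_set bad).
Proof. by apply: bigcapT_measurable => n; apply: bigcup_measurable => k _; exact: mbad. Qed.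

Let good1 : Q good = 1%E.
Proof.
have [C hC] := @nseqZ_tail4 R.
have C0 : 0 <= C.
  have := hC 0%N 1 ltr01; rewrite expr1n divr1; apply: le_trans.
  by have /andP[] := @fine_prob01 _ _ R Q _ (measurable_gt_norm 1 (@measurable_nseqZ R 0)).
have Z0 : Q (lim_sup_set bad) = 0%E.
  (* Generation n has 2^n variables, each exceeding q^n with probability at most C q^(-4n). The
     ratio 2 / q^4 is 512/625. *)
  have r0 : 0 < 2 / q ^+ 4 :> R by rewrite divr_gt0// exprn_gt0// divr_gt0.
  apply: (@borel_cantelli_geometric _ _ R Q bad C (2 / q ^+ 4) mbad C0 r0).
    by rewrite /q; lra.
  move=> n; apply: (le_trans (@Pr_union_le _ _ R Q _ _ (mbad1 n))).
  apply: (@le_trans _ _ (\sum_(k < 2 ^ n) C / (q ^+ n) ^+ 4)).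
    by apply: ler_sum => k _; apply: hC; rewrite exprn_gt0// divr_gt0.
  have -> : (q ^+ n) ^+ 4 = (q ^+ 4) ^+ n by rewrite -!exprM mulnC.
  rewrite sumr_const card_ord -[leLHS]mulr_natl natrX (expr_div_n 2 (q ^+ 4)).
  by rewrite mulrCA.
by rewrite probability_setC// Z0 sube0.
Qed.

Let mgood : measurable good. Proof. exact: measurableC. Qed.

(** Setting the variables to zero off a full event makes the growth bound hold for every [w], and
    with it the continuity of every path. *)
Definition goodZ (p : nat) (x : R) : R := \1_good x * nseqZ p x.

Lemma measurable_goodZ p : measurable_fun setT (goodZ p).
Proof. by apply: measurable_funM; [exact: measurable_indic|exact: measurable_nseqZ]. Qed.

Lemma goodZ_cos M (a : nat -> R) (th : R) :
  Ex Q (fun w => cos (\sum_(p < M) a p * goodZ p w + th)) = cos th * expR (- ((\sum_(p < M) a p ^+ 2) / 2)).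
Proof.
rewrite -nseqZ_lin_cos; apply: (@Ex_ae _ _ _ Q _ _ good) => //.
- apply: measurable_cos_fun; apply: measurable_funD => //; apply: measurable_sum => p.
  by apply: measurable_funM => //; exact: measurable_goodZ.
- apply: measurable_cos_fun; apply: measurable_funD => //; apply: measurable_sum => p.
  by apply: measurable_funM => //; exact: measurable_nseqZ.
- move=> w gw; congr (cos (_ + _)); apply: eq_bigr => p _.
  by rewrite /goodZ indicE mem_set// mul1r.
Qed.

Lemma goodZ_growth w : exists n0 : nat, forall n k, (n0 <= n)%N -> (k < 2 ^ n)%N ->
  `|goodZ (2 ^ n + k)%N w| <= (5 / 4) ^+ n.
Proof.
rewrite /goodZ indicE; case: (boolP (w \in good)) => [|_]; last first.
  by exists 0%N => n k _ _; rewrite mul0r normr0 exprn_ge0// divr_ge0.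
rewrite inE /good/= /lim_sup_set => h.
have [n0 hn0] : exists n0, forall n, (n0 <= n)%N -> ~ bad n w.
  apply: contrapT => H; apply: h => m _; apply: contrapT => H'; apply: H; exists m => n mn bn.
  by apply: H'; exists n.
exists n0 => n k nn kn; rewrite mul1r leNgt; apply/negP => H; apply: (hn0 n nn).
by exists k.
Qed.

Theorem brownian_bridge_exists : exists (B : R -> R -> R),
  [/\ forall x, measurable_fun setT (B x),
      forall w, continuous (B ^~ w : R -> R),
      forall s : seq (R * R), 0 <= quad_form bcov s &
      forall s th, Ex Q (fun w => cos (lin_time s B w + th)) = cos th * expR (- (quad_form bcov s / 2))].
Proof.
exists (bridge goodZ); split.
- move=> x; exact: measurable_bridge measurable_goodZ goodZ_growth x.
- move=> w; exact: continuous_bridge goodZ_growth w.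
- move=> s; exact: bridge_quad_ge0.
- move=> s th; exact: (@bridge_cos R _ R Q goodZ measurable_goodZ goodZ_cos goodZ_growth s th).
Qed.

End BridgeExistence.

(** * Exponential moments of Levy processes *)

Section NonnegativeProduct.
Context {d : measure_display} {T : measurableType d} {R : realType}.
Variable P : probability T R.

Section product_ge0.
Variables U V : {mfun T >-> R}.
Hypotheses (U0 : forall w, 0 <= U w) (V0 : forall w, 0 <= V w) (UV : indep2 P U V).

Let W w := (U w, V w).
Let mW : measurable_fun setT W. Proof. exact: measurable_fun_pair. Qed.
HB.instance Definition _ := isMeasurableFun.Build _ _ _ _ W mW.
Let m : probability (R * R)%type R := distribution P W.
Let m1 : probability R R := distribution P U.
Let m2 : probability R R := distribution P V.
(** Absolute values make the integrand nonnegative on the whole plane, as Tonelli requires; they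
    change nothing on the range of (U, V). *)
Let f (z : R * R) : \bar R := (`|z.1| * `|z.2|)%:E.

Let mf : measurable_fun setT f.
Proof.
by apply/measurable_EFinP; apply: measurable_funM; apply: measurableT_comp.
Qed.

Let f0 z : (0 <= f z)%E. Proof. by rewrite lee_fin mulr_ge0. Qed.

Let mE X : measurable X -> (m1 \x m2)%E X = m X.
Proof. by apply: product_measure_unique => A B mA mB; exact: UV. Qed.

Let intE (Z : {mfun T >-> R}) : (forall w, 0 <= Z w) ->
  (\int[distribution P Z]_y `|y|%:E = \int[P]_w (Z w)%:E)%E.
Proof.
move=> Z0; rewrite ge0_integral_distribution//; last by apply/measurable_EFinP; exact: normr_measurable.
by apply: eq_integral => w _ /=; rewrite ger0_norm.
Qed.

Lemma ge0_integral_indepM_mfun :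
  (\int[P]_w (U w * V w)%:E = \int[P]_w (U w)%:E * \int[P]_w (V w)%:E)%E.
Proof.
transitivity (\int[m]_z f z)%E.
  rewrite ge0_integral_distribution//; apply: eq_integral => w _ /=.
  by rewrite /f/= !ger0_norm.
rewrite (@eq_measure_integral _ _ _ _ (m1 \x m2)%E); last first.
  by move=> A mA _; exact/esym/mE.
rewrite fubini_tonelli1// /fubini_F/=.
transitivity (\int[m1]_x (`|x|%:E * \int[P]_w (V w)%:E))%E.
  apply: eq_integral => x _; rewrite -intE// -ge0_integralZl//.
  by apply/measurable_EFinP; exact: normr_measurable.
rewrite ge0_integralZr//; first by rewrite intE.
- by apply/measurable_EFinP; exact: normr_measurable.
- by apply: integral_ge0 => w _; rewrite lee_fin.
Qed.

End product_ge0.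

(** A version that admits infinite values: [Ex_indepM] presupposes the very moments whose finiteness
    is still to be shown at times other than 1. *)
Lemma ge0_integral_indepM (U V : T -> R) : measurable_fun setT U -> measurable_fun setT V ->
  (forall w, 0 <= U w) -> (forall w, 0 <= V w) -> indep2 P U V ->
  (\int[P]_w (U w * V w)%:E = \int[P]_w (U w)%:E * \int[P]_w (V w)%:E)%E.
Proof.
move=> mU mV U0 V0 UV.
exact: (@ge0_integral_indepM_mfun (mfun_Sub (mem_set mU)) (mfun_Sub (mem_set mV))).
Qed.

Lemma ge0_integral_same_law d' (T' : measurableType d') (P' : probability T' R)
  (U : T -> R) (V : T' -> R) (g : R -> R) :
  measurable_fun setT U -> measurable_fun setT V ->
  (forall B : set R, measurable B -> P (U @^-1` B) = P' (V @^-1` B)) ->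
  measurable_fun setT g -> (forall x, 0 <= g x) ->
  (\int[P]_w (g (U w))%:E = \int[P']_w (g (V w))%:E)%E.
Proof.
move=> mU mV UV mg g0.
have key d0 (T0 : measurableType d0) (P0 : probability T0 R) (Z : T0 -> R) (mZ : measurable_fun setT Z) :
    (\int[distribution P0 (mfun_Sub (mem_set mZ))]_y (g y)%:E = \int[P0]_w (g (Z w))%:E)%E.
  by rewrite ge0_integral_distribution//; exact/measurable_EFinP.
rewrite -(key _ _ P U mU) -(key _ _ P' V mV); apply: eq_measure_integral => A mA _.
exact: UV.
Qed.

End NonnegativeProduct.

(** * Cauchy's functional equation with a local lower bound *)

Section CauchyEquation.
Context {R : realType}.

(** g(t) = phi(t) - t phi(1) is additive and vanishes at the nonnegative rationals, so the bound
    near 0 spreads to all t >= 0. A bound below on every multiple n t forces g >= 0, and g(t) + g(K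
    - t) = g(K) = 0 for an integer K >= t then forces g = 0. *)
Lemma additive_linear (phi : R -> R) (delta C : R) : 0 < delta ->
  (forall s t, 0 <= s -> 0 <= t -> phi (s + t) = phi s + phi t) ->
  (forall t, 0 <= t -> t <= delta -> - C <= phi t) ->
  forall t, 0 <= t -> phi t = t * phi 1.
Proof.
move=> d0 add lb.
pose g t := phi t - t * phi 1.
have gadd s t : 0 <= s -> 0 <= t -> g (s + t) = g s + g t.
  by move=> s0 t0; rewrite /g add//; ring.
have gn n t : 0 <= t -> g (n%:R * t) = n%:R * g t.
  move=> t0; elim: n => [|n ih].
    by rewrite !mul0r; have := gadd 0 0 (lexx 0) (lexx 0); rewrite addr0; lra.
  by rewrite -natr1 mulrDl mul1r gadd ?mulr_ge0// ih; ring.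
have g1 : g 1 = 0 by rewrite /g; ring.
have gq n m : (0 < m)%N -> g (n%:R / m%:R) = 0.
  move=> m0; have mR : 0 < m%:R :> R by rewrite ltr0n.
  have h : m%:R * g (n%:R / m%:R) = 0.
    rewrite -gn ?divr_ge0//.
    have -> : m%:R * (n%:R / m%:R) = n%:R * 1 :> R by field; rewrite gt_eqF.
    by rewrite gn// g1 mulr0.
  by move/eqP: h; rewrite mulf_eq0 gt_eqF//= => /eqP.
pose C' := C + delta * `|phi 1|.
have glb t : 0 <= t -> t <= delta -> - C' <= g t.
  move=> t0 td; rewrite /g /C'; have := lb t t0 td.
  have : t * phi 1 <= delta * `|phi 1|.
    by apply: (le_trans (ler_norm _)); rewrite normrM (ger0_norm t0) ler_wpM2r.
  lra.
have gall t : 0 <= t -> - C' <= g t.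
  move=> t0; pose m := (Num.truncn delta^-1).+1.
  have mR : 0 < m%:R :> R by rewrite ltr0n.
  have md : m%:R^-1 <= delta.
    by rewrite invf_ple ?posrE// ltW// truncnS_gt.
  pose n := Num.truncn (t * m%:R).
  have tm : 0 <= t * m%:R by rewrite mulr_ge0// ltW.
  have /andP[n1 n2] := truncn_itv tm; rewrite -/n in n1 n2.
  have h1 : n%:R / m%:R <= t by rewrite ler_pdivrMr.
  have h2 : t - n%:R / m%:R <= m%:R^-1.
    have -> : t - n%:R / m%:R = (t * m%:R - n%:R) / m%:R by field; rewrite gt_eqF.
    by rewrite ler_pdivrMr// mulVf ?gt_eqF//; move: n2; rewrite -natr1; lra.
  have -> : t = n%:R / m%:R + (t - n%:R / m%:R) by ring.
  rewrite gadd ?divr_ge0// ?subr_ge0// gq// add0r; apply: glb; first by rewrite subr_ge0.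
  exact: le_trans md.
have gge t : 0 <= t -> 0 <= g t.
  move=> t0; rewrite leNgt; apply/negP => gt0.
  pose n := (Num.truncn (C' / - g t)).+1.
  have : C' / - g t < n%:R by exact: truncnS_gt.
  rewrite ltr_pdivrMr ?oppr_gt0// => h.
  by have := gall (n%:R * t) (mulr_ge0 (ler0n _ _) t0); rewrite gn//; lra.
move=> t t0; pose K := (Num.truncn t).+1.
have tK : t <= K%:R by rewrite ltW// truncnS_gt.
have := gadd t (K%:R - t) t0; rewrite subr_ge0 => /(_ tK).
have -> : t + (K%:R - t) = K%:R / 1%:R by field.
rewrite gq// => h; have := gge t t0.
by have := gge (K%:R - t); rewrite subr_ge0 => /(_ tK); rewrite /g in h *; lra.
Qed.

End CauchyEquation.

(** * Independence from the past and the Laplace transform *)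

Section LevyProcess.
Context {d : measure_display} {T : measurableType d} {R : realType}.
Variable P : probability T R.
Variable X : R -> T -> R.
Hypothesis levyX : levy_process P X.

Let mX (t : R) : 0 <= t -> measurable_fun setT (X t). Proof. by case: levyX => + _ _ _ _; exact. Qed.

Let mpreT (f : T -> R) (A : set R) : measurable_fun setT f -> measurable A -> measurable (f @^-1` A).
Proof. by move=> mf mA; rewrite -[X in measurable X]setTI; exact: mf. Qed.

Let A0 : set T := [set w | X 0 w = 0].
Let mA0 : measurable A0.
Proof.
rewrite (_ : A0 = X 0 @^-1` [set 0])//.
by apply: mpreT; [exact: mX|exact: measurable_set1].
Qed.
Let PA0 : P A0 = 1%E. Proof. by case: levyX. Qed.

Section past.
Variables (j : nat) (ts : nat -> R).
Hypotheses (ts0 : ts 0%N = 0) (tsS : forall k, (k <= j)%N -> ts k < ts k.+1).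

Let ts_ge0 k : (k <= j.+1)%N -> 0 <= ts k.
Proof.
elim: k => [|k ih] kj; first by rewrite ts0.
by rewrite (le_trans (ih (ltnW kj)))// ltW// tsS.
Qed.

Let D k w := X (ts k.+1) w - X (ts k) w.

Let mD k : (k <= j)%N -> measurable_fun setT (D k).
Proof. by move=> kj; apply: measurable_funB; apply: mX; apply: ts_ge0 => //; exact: leqW. Qed.

Let G : set (set T) := [set E | exists B : nat -> set R, (forall k, measurable (B k)) /\
  E = \bigcap_(k in `I_j) [set w | B k (D k w)]].

Let Gm : G `<=` measurable.
Proof.
move=> _ [B [mB ->]]; apply: fin_bigcap_measurable => // k /= kj.
by apply: mpreT; [apply: mD; exact: ltnW|exact: mB].
Qed.

Let GI : setI_closed G.
Proof.
move=> _ _ [B [mB ->]] [B' [mB' ->]]; exists (fun k => B k `&` B' k); split.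
  by move=> k; exact: measurableI.
apply/seteqP; split => w /=.
  by move=> [h1 h2] k kj; split; [exact: h1|exact: h2].
by move=> h; split => k kj; have [] := h k kj.
Qed.

Let GT : G setT.
Proof. by exists (fun=> setT); split => //; apply/seteqP; split. Qed.

Let levy_indep n (B : nat -> set R) : (n <= j.+1)%N -> (forall k, measurable (B k)) ->
  P (\bigcap_(k in `I_n) [set w | B k (D k w)]) = (\prod_(k < n) P [set w | B k (D k w)])%E.
Proof.
move=> nj mB; case: levyX => _ _ _ h _; apply: h => //; first by rewrite ts0.
by move=> k kn; apply: tsS; rewrite -ltnS (leq_trans kn).
Qed.

Let indepG (C : set R) : measurable C -> forall E, <<s G >> E ->
  P (E `&` [set w | C (D j w)]) = (P E * P [set w | C (D j w)])%E.
Proof.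
move=> mC; apply: indep_sigma => //; first by apply: mpreT => //; exact: mD.
move=> _ [B [mB ->]].
pose B' k := if k == j then C else B k.
have mB' k : measurable (B' k) by rewrite /B'; case: ifP.
have E1 : \bigcap_(k in `I_j) [set w | B k (D k w)] `&` [set w | C (D j w)] =
    \bigcap_(k in `I_j.+1) [set w | B' k (D k w)].
  apply/seteqP; split => w /=.
    move=> [h1 h2] k; rewrite /= ltnS leq_eqVlt /B' => /orP[/eqP ->|kj]; first by rewrite eqxx.
    by rewrite ltn_eqF//; exact: h1.
  move=> h; split; last by have := h j (ltnSn j); rewrite /B'/= eqxx.
  by move=> k kj; have := h k (ltnW kj); rewrite /B'/= ltn_eqF.
rewrite E1 levy_indep// big_ord_recr/= levy_indep//; congr (_ * _)%E.
  by apply: eq_bigr => k _; rewrite /B' ltn_eqF.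
by rewrite /B' eqxx.
Qed.

Let mG (q : nat) : (q <= j)%N -> measurable_fun setT (fun w : g_sigma_algebraType G => X (ts q) w - X 0 w).
Proof.
elim: q => [|q ih] qj.
  by under eq_fun do rewrite ts0 subrr; exact: measurable_cst.
have -> : (fun w => X (ts q.+1) w - X 0 w) = (fun w => D q w + (X (ts q) w - X 0 w)).
  by apply/funext => w; rewrite /D; ring.
apply: (@measurable_funD _ (g_sigma_algebraType G)); last by apply: ih; exact: ltnW.
move=> _ A mA; rewrite setTI; apply: sub_sigma_algebra.
exists (fun k => if k == q then A else setT); split; first by move=> k; case: ifP.
apply/seteqP; split => w /=.
  by move=> h k kj; case: ifP => // /eqP ->.
by move=> h; have := h q qj; rewrite /= eqxx.
Qed.

(** The definition of a Levy process speaks of increments. A value relative to [X 0] is a sum of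
    increments, hence measurable for the sigma-algebra they generate; as [X 0] vanishes only almost
    surely, the events are exchanged by [Pr_ae]. *)
Lemma levy_past (B : nat -> set R) (C : set R) : (forall k, measurable (B k)) -> measurable C ->
  P (\bigcap_(q in `I_j.+1) [set w | B q (X (ts q) w)] `&` [set w | C (X (ts j.+1) w - X (ts j) w)%R]) =
  (P (\bigcap_(q in `I_j.+1) [set w | B q (X (ts q) w)]) * P [set w | C (X (ts j.+1) w - X (ts j) w)%R])%E.
Proof.
move=> mB mC.
pose E' := \bigcap_(q in `I_j.+1) [set w | B q (X (ts q) w - X 0 w)].
have sE' : <<s G >> E'.
  rewrite /E' bigcap_mkord; apply: (@bigsetI_measurable _ (g_sigma_algebraType G)) => q _.
  by have := @mG q _ measurableT (B q) (mB q); rewrite setTI; apply; rewrite -ltnS.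
have mE' : measurable E' by apply: (smallest_sub (@sigma_algebra_measurable _ T) Gm).
have mE : measurable (\bigcap_(q in `I_j.+1) [set w | B q (X (ts q) w)]).
  by apply: fin_bigcap_measurable => // q /= qj; apply: mpreT => //; apply: mX; apply: ts_ge0; exact: ltnW.
have mH : measurable [set w | C (X (ts j.+1) w - X (ts j) w)] by apply: mpreT => //; exact: (mD (leqnn j)).
have EE' w : A0 w -> (\bigcap_(q in `I_j.+1) [set w | B q (X (ts q) w)]) w <-> E' w.
  by rewrite /A0/= => w0; split => h q qj; have := h q qj; rewrite /= w0 subr0.
rewrite (@Pr_ae _ _ _ P (_ `&` _) (E' `&` [set w | C (X (ts j.+1) w - X (ts j) w)]) A0)//; last 3 first.
- exact: measurableI.
- exact: measurableI.
- by move=> w w0; have [h1 h2] := EE' w w0; split => -[a b]; split => //; [exact: h1|exact: h2].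
rewrite (@Pr_ae _ _ _ P (\bigcap_(q in `I_j.+1) [set w | B q (X (ts q) w)]) E' A0)//.
exact: indepG.
Qed.

End past.

Let incr_law (s t : R) (B : set R) : 0 <= s -> 0 <= t -> measurable B ->
  P [set w | B (X (s + t) w - X s w)] = P [set w | B (X t w)].
Proof.
move=> s0 t0 mB; case: levyX => _ _ _ _ h; rewrite h//.
apply: (@Pr_ae _ _ _ P _ _ A0) => //.
- by apply: mpreT => //; apply: measurable_funB; exact: mX.
- by apply: mpreT => //; exact: mX.
- by move=> w; rewrite /A0/= => ->; rewrite subr0.
Qed.

Let mincr (s t : R) : 0 <= s -> 0 <= t -> measurable_fun setT (fun w => X (s + t) w - X s w).
Proof. by move=> s0 t0; apply: measurable_funB; apply: mX => //; exact: addr_ge0. Qed.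

Let incr_indep (s t : R) : 0 < s -> 0 < t -> indep2 P (X s) (fun w => X (s + t) w - X s w).
Proof.
move=> s0 t0 A B mA mB.
pose ts (k : nat) : R := if k == 0%N then 0 else if k == 1%N then s else s + t.
have tsS k : (k <= 1)%N -> ts k < ts k.+1.
  by case: k => [|[|]]//= _; rewrite /ts/= ?ltrDl.
have := @levy_past 1 ts erefl tsS (fun k => if k == 1%N then A else setT) B.
have -> : \bigcap_(q in `I_2) [set w | (if q == 1%N then A else setT) (X (ts q) w)] = X s @^-1` A.
  apply/seteqP; split => w /=; first by move=> /(_ 1%N)/=; exact.
  by move=> h [|[|]].
by apply => // k; case: ifP.
Qed.

Local Notation M u t := (\int[P]_w (expR (u * X t w))%:E)%E.

Hypothesis fin1 : forall u, (M u 1 < +oo)%E.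

Let mexp (u t : R) : 0 <= t -> measurable_fun setT (fun w => expR (u * X t w)).
Proof.
by move=> t0; apply: measurableT_comp => //; apply: measurable_funM => //; exact: mX.
Qed.

Let M_incr (u s t : R) : 0 <= s -> 0 <= t ->
  (\int[P]_w (expR (u * (X (s + t) w - X s w)))%:E = M u t)%E.
Proof.
move=> s0 t0; apply: (@ge0_integral_same_law _ _ _ P _ _ P _ _ (fun x => expR (u * x))) => //.
- exact: mincr.
- exact: mX.
- by move=> B mB; exact: incr_law.
- by apply: measurableT_comp => //; exact: measurable_funM.
Qed.

Let M_mul (u s t : R) : 0 < s -> 0 < t -> (M u (s + t) = M u s * M u t)%E.
Proof.
move=> s0 t0; rewrite -(@M_incr u s t (ltW s0) (ltW t0)) -ge0_integral_indepM//.
- by apply: eq_integral => w _; congr EFin; rewrite -expRD; congr expR; ring.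
- by apply: mexp; exact: ltW.
- by apply: measurableT_comp => //; apply: measurable_funM => //; apply: mincr; exact: ltW.
- by apply: (@indep2_comp _ _ _ P (X s) _ (fun x => expR (u * x)) (fun x => expR (u * x)));
    [apply: measurableT_comp => //; exact: measurable_funM|apply: measurableT_comp => //; exact: measurable_funM|exact: incr_indep].
Qed.

Let M_gt0 (u t : R) : 0 <= t -> (0 < M u t)%E.
Proof.
move=> t0; rewrite lt_neqAle; apply/andP; split; last by apply: integral_ge0 => w _; rewrite lee_fin expR_ge0.
apply/eqP => h.
have mf : measurable_fun setT (EFin \o (fun w => expR (u * X t w))).
  by apply/measurable_EFinP; exact: mexp.
have [+ _] := ae_eq_integral_abs P measurableT mf.
have -> : (\int[P]_w `|(EFin \o (fun w => expR (u * X t w))) w| = M u t)%E.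
  by apply: eq_integral => w _ /=; rewrite ger0_norm// expR_ge0.
rewrite -h => /(_ erefl) [A [mA PA sub]].
have AT : A = setT.
  apply/seteqP; split => // w _; apply: sub => /= /(_ I) [] /eqP.
  by rewrite gt_eqF// expR_gt0.
by have := @probability_setT _ _ _ P; rewrite -AT PA => -[] /eqP; rewrite eq_sym oner_eq0.
Qed.

(** Integer times follow from time 1 by multiplicativity. Other times are reached downwards: M(n +
    1) = M(t) M(n + 1 - t) with positive factors would be infinite if M(t) were. *)
Let M_fin (u t : R) : 0 <= t -> (M u t < +oo)%E.
Proof.
rewrite le_eqVlt => /predU1P[<-|t0].
  rewrite (@ae_eq_integral _ _ _ P setT (EFin \o (fun=> 1)) _ measurableT)//.
  - by rewrite integral_cst// mul1e (le_lt_trans (probability_le1 _ _))// ltry.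
  - by apply/measurable_EFinP; exact: mexp.
  - exact/measurable_EFinP.
  - have E : P (~` A0) = 0%E by rewrite probability_setC// PA0 subee.
    exists (~` A0); split; [exact: measurableC|exact: E|].
    by move=> w /= h w0; apply: h => _; rewrite w0 mulr0 expR0.
have Mn n : (M u n.+1%:R < +oo)%E.
  elim: n => [|n ih]; first exact: fin1.
  by rewrite -addn1 natrD M_mul// lte_mul_pinfty ?ge0_fin_numE ?ltW ?M_gt0.
pose n := Num.truncn t.
have tn : t < n.+1%:R by exact: truncnS_gt.
have := Mn n; rewrite (_ : n.+1%:R = t + (n.+1%:R - t)); last by ring.
rewrite M_mul ?subr_gt0// => h; rewrite ltNge leye_eq; apply/negP => /eqP h'.
by move: h; rewrite h' gt0_mulye ?M_gt0 ?subr_ge0 ?ltW.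
Qed.

Let L1_exp (u t : R) : 0 <= t -> L1 P (fun w => expR (u * X t w)).
Proof.
move=> t0; apply/integrableP; split; first by apply/measurable_EFinP; exact: mexp.
rewrite (le_lt_trans _ (M_fin u t0))//; apply: ge0_le_integral => //.
- by apply/measurable_EFinP; apply: measurableT_comp => //; exact: mexp.
- by apply/measurable_EFinP; exact: mexp.
- by move=> w _ /=; rewrite lee_fin ger0_norm// expR_ge0.
Qed.

Lemma levy_mom (u t : R) : 0 <= t -> mom P (fun w => expR (u * X t w)).
Proof.
move=> t0; split; first exact: mexp.
move=> n; under [X in L1 _ X]funext do rewrite ger0_norm ?expR_ge0// -expRM_natl mulrA.
exact: L1_exp.
Qed.

Lemma levy_incr_mom (u s t : R) : 0 <= s -> 0 <= t ->
  mom P (fun w => expR (u * (X (s + t) w - X s w))).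
Proof.
move=> s0 t0; under [X in mom _ X]funext do rewrite mulrBr expRD -mulNr.
by apply: momM; apply: levy_mom => //; exact: addr_ge0.
Qed.

Let E (u t : R) := Ex P (fun w => expR (u * X t w)).

Let E0 u : E u 0 = 1.
Proof.
rewrite /E (@Ex_ae _ _ _ P _ (fun=> 1) A0)// ?Ex_cst//; first exact: mexp.
by move=> w; rewrite /A0/= => ->; rewrite mulr0 expR0.
Qed.

Let E_gt0 (u t : R) : 0 <= t -> 0 < E u t.
Proof.
by move=> t0; rewrite -lte_fin -ExE; [exact: M_gt0|exact: L1_exp].
Qed.

Let ED (u s t : R) : 0 <= s -> 0 <= t -> E u (s + t) = E u s * E u t.
Proof.
rewrite le_eqVlt => /predU1P[<-|s0]; first by rewrite add0r E0 mul1r.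
rewrite le_eqVlt => /predU1P[<-|t0]; first by rewrite addr0 E0 mulr1.
have [s1 t1] := (ltW s0, ltW t0); have st := addr_ge0 s1 t1.
by apply: EFin_inj; rewrite EFinM -(ExE (L1_exp u st)) -(ExE (L1_exp u s1)) -(ExE (L1_exp u t1)); exact: M_mul.
Qed.

(* The only use of the paths: right continuity at 0 and bounded convergence. *)
Let E_near0 u : exists2 delta : R, 0 < delta & forall t : R, 0 <= t -> t <= delta -> 2^-1 <= E u t.
Proof.
apply: contrapT => H.
have H' n : exists t : R, [/\ 0 < t, t <= n.+1%:R^-1 & E u t < 2^-1].
  apply: contrapT => h; apply: H; exists n.+1%:R^-1; first by rewrite invr_gt0 ltr0n.
  move=> t; rewrite le_eqVlt => /predU1P[<- _|t0 tn]; first by rewrite E0; lra.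
  by rewrite leNgt; apply/negP => h'; apply: h; exists t.
have [t ht] := choice H'.
have t0 n : 0 < t n by have [] := ht n.
have cvt : t @ \oo --> (0 : R).
  apply: (@squeeze_cvgr _ _ _ _ (fun=> 0) (@harmonic R)); last 2 first.
  - exact: cvg_cst.
  - exact: cvg_harmonic.
  by apply: nearW => n; rewrite ltW//=; have [] := ht n.
pose F n w := clip01 (expR (u * X (t n) w)).
have mclip s : 0 <= s -> measurable_fun setT (fun w => clip01 (expR (u * X s w))).
  by move=> s0; apply: measurable_maxr => //; apply: measurable_minr => //; exact: mexp.
have mF n : measurable_fun setT (F n) by apply: mclip; exact: ltW.
have Fb n w : `|F n w| <= 1.
  by have /andP[h1 h2] := clip01_bound (expR (u * X (t n) w)); rewrite ger0_norm.
have FX w : F ^~ w @ \oo --> clip01 (expR (u * X 0 w)).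
  have : expR (u * X (t n) w) @[n --> \oo] --> expR (u * X 0 w).
    apply: (@cvg_comp _ _ _ _ expR _ (nbhs (u * X 0 w))); last exact: continuous_expR.
    apply: cvgM; first exact: cvg_cst.
    case: levyX => _ /(_ w) [/(_ 0 (lexx 0)) h _] _ _ _.
    by have /cvg_at_rightP := h; apply; split.
  move=> /cvgrPdist_le h; apply/cvgrPdist_le => e /h; apply: filterS => n.
  by apply: le_trans; exact: clip01_lip.
have := Ex_cvg (P := P) mF Fb FX.
rewrite (@Ex_ae _ _ _ P _ (fun=> 1) A0)// ?Ex_cst//; last first.
- by move=> w; rewrite /A0/= => ->; rewrite mulr0 expR0 /clip01 minxx max_r.
- exact: mclip.
move=> h; suff : (1 : R) <= 2^-1 by lra.
apply: (cvgr_to_le h); apply: nearW => n; have [t1 _ /ltW] := ht n; apply: le_trans.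
apply: Ex_le; [by apply: bmeas_L1; split => //; exists 1|by apply: L1_exp; exact: ltW|].
by move=> w; rewrite /F /clip01 ge_max expR_ge0 ge_min lexx orbT.
Qed.

(** The logarithm of the transform is additive in [t] by independence and stationarity, and bounded
    below near 0 by [E_near0]; [additive_linear] applies. *)
Lemma levy_mgf (u t : R) : 0 <= t ->
  Ex P (fun w => expR (u * X t w)) = expR (t * log_mgf P (X 1) u).
Proof.
move=> t0; have [delta d0 lb] := E_near0 u.
rewrite -[log_mgf _ _ _]/(ln (E u 1)) -(@additive_linear _ (fun s => ln (E u s)) delta (- ln 2^-1))//.
- by rewrite lnK// posrE; exact: E_gt0.
- by move=> r s r0 s0; rewrite ED// lnM// posrE; exact: E_gt0.
- by move=> s s0 sd; rewrite opprK ler_ln ?posrE ?lb ?E_gt0// invr_gt0.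
Qed.

Lemma levy_mgf_incr (u v s t : R) : 0 <= s -> 0 <= t ->
  Ex P (fun w => expR (u * X s w) * expR (v * (X (s + t) w - X s w))) =
  expR (s * log_mgf P (X 1) u + t * log_mgf P (X 1) v).
Proof.
have inc r q : 0 <= r -> 0 <= q -> Ex P (fun w => expR (v * (X (r + q) w - X r w))) = expR (q * log_mgf P (X 1) v).
  move=> r0 q0; rewrite -(levy_mgf v q0); apply: EFin_inj; rewrite -(ExE (mom_L1 (levy_incr_mom v r0 q0))) -(ExE (L1_exp v q0)).
  exact: M_incr.
(* [incr_indep] needs two intervals of positive length, so s = 0 and t = 0 are treated apart. *)
rewrite expRD le_eqVlt => /predU1P[<-|s0] t0.
  rewrite mul0r expR0 mul1r -(inc 0)//; apply: (@Ex_ae _ _ _ P _ _ A0) => //.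
  - by have [] := momM (@levy_mom u 0 (lexx 0)) (@levy_incr_mom v 0 t (lexx 0) t0).
  - by have [] := @levy_incr_mom v 0 t (lexx 0) t0.
  - by move=> w; rewrite /A0/= => ->; rewrite mulr0 expR0 mul1r.
have s1 := ltW s0.
move: t0; rewrite le_eqVlt => /predU1P[<-|t0].
  under [X in Ex _ X]funext do rewrite addr0 subrr mulr0 expR0 mulr1.
  by rewrite levy_mgf// mul0r expR0 mulr1.
have t1 := ltW t0.
rewrite (Ex_indepM (levy_mom u s1) (levy_incr_mom v s1 t1)); first by rewrite (levy_mgf u s1) (inc _ _ s1 t1).
by apply: (@indep2_comp _ _ _ P (X s) _ (fun x => expR (u * x)) (fun x => expR (v * x)));
    [apply: measurableT_comp => //; exact: measurable_funM|apply: measurableT_comp => //; exact: measurable_funM|exact: incr_indep].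
Qed.

End LevyProcess.

(** * Independent copies *)

Section SigmaMeasurable.
Context {d : measure_display} {T : measurableType d} {R : realType}.

Definition sigma_fun (G : set (set T)) (f : T -> R) :=
  measurable_fun setT (f : g_sigma_algebraType G -> R).

Lemma sigma_fun_set (G : set (set T)) (f : T -> R) (A : set R) :
  sigma_fun G f -> measurable A -> <<s G >> (f @^-1` A).
Proof. by move=> mf mA; have := mf measurableT A mA; rewrite setTI. Qed.

End SigmaMeasurable.

Section IidCopies.
Context {d : measure_display} {T : measurableType d} {R : realType}.
Variables (P : probability T R) (xi : nat -> R -> T -> R).
Hypothesis levy_xi : forall i, levy_process P (xi i).
Hypothesis iid_xi : iid_copies P xi.

Let mxi i t : 0 <= t -> measurable_fun setT (xi i t).
Proof. by case: (levy_xi i) => + _ _ _ _; exact. Qed.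

Section times.
Variables (m : nat) (ts : nat -> R).
Hypothesis ts_ge0 : forall k, 0 <= ts k.

Let rect i (B : nat -> set R) := \bigcap_(k in `I_m) [set w | B k (xi i (ts k) w)].

Let mpre (f : T -> R) (A : set R) : measurable_fun setT f -> measurable A -> measurable (f @^-1` A).
Proof. by move=> mf mA; rewrite -[X in measurable X]setTI; exact: mf. Qed.

Let mrect i B : (forall k, measurable (B k)) -> measurable (rect i B).
Proof. by move=> mB; apply: fin_bigcap_measurable => // k _; apply: mpre => //; exact: mxi. Qed.

(** Kept as a pi-system, because rectangles are what [iid_copies] speaks of; [indep_sigma] passes to
    the generated sigma-algebra. *)
Definition one_past i : set (set T) :=
  [set E | exists B : nat -> set R, (forall k, measurable (B k)) /\
    E = \bigcap_(k in `I_m) [set w | B k (xi i (ts k) w)]].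

Definition all_past n : set (set T) :=
  [set E | exists B : nat -> nat -> set R, (forall l k, measurable (B l k)) /\
    E = \bigcap_(l in `I_n) \bigcap_(k in `I_m) [set w | B l k (xi l (ts k) w)]].

Lemma one_past_measurable i : one_past i `<=` measurable.
Proof. by move=> _ [B [mB ->]]; exact: mrect. Qed.

Lemma all_past_measurable n : all_past n `<=` measurable.
Proof.
by move=> _ [B [mB ->]]; apply: fin_bigcap_measurable => // l _; exact: mrect.
Qed.

Lemma one_past_setI i : setI_closed (one_past i).
Proof.
move=> _ _ [B [mB ->]] [B' [mB' ->]]; exists (fun k => B k `&` B' k); split.
  by move=> k; exact: measurableI.
apply/seteqP; split => w /=.
  by move=> [h1 h2] k kj; split; [exact: h1|exact: h2].
by move=> h; split => k kj; have [] := h k kj.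
Qed.

Lemma all_past_setI n : setI_closed (all_past n).
Proof.
move=> _ _ [B [mB ->]] [B' [mB' ->]]; exists (fun l k => B l k `&` B' l k); split.
  by move=> l k; exact: measurableI.
apply/seteqP; split => w /=.
  by move=> [h1 h2] l ln k kj; split; [exact: h1|exact: h2].
by move=> h; split => l ln k kj; have [] := h l ln k kj.
Qed.

Lemma one_past_setT i : one_past i setT.
Proof. by exists (fun=> setT); split => //; apply/seteqP; split. Qed.

Lemma all_past_setT n : all_past n setT.
Proof. by exists (fun _ _ => setT); split => //; apply/seteqP; split. Qed.

Let prod_rect n (B : nat -> nat -> set R) : (forall l k, measurable (B l k)) ->
  P (\bigcap_(l in `I_n) rect l (B l)) = (\prod_(l < n) P (rect l (B l)))%E.
Proof. by move=> mB; apply: iid_xi.2. Qed.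

(** A rectangle is free of copy [i] when its sides [B i k] are full. Keeping the index [i] in place
    lets both probabilities be read off one product formula. *)
Lemma all_past_indep_one n i (B : nat -> nat -> set R) (H : set T) : (i < n)%N ->
  (forall l k, measurable (B l k)) -> (forall k, B i k = setT) -> <<s one_past i >> H ->
  P (H `&` \bigcap_(l in `I_n) \bigcap_(k in `I_m) [set w | B l k (xi l (ts k) w)]) =
  (P H * P (\bigcap_(l in `I_n) \bigcap_(k in `I_m) [set w | B l k (xi l (ts k) w)]))%E.
Proof.
move=> ni mB BT; apply: indep_sigma.
- exact: one_past_measurable.
- exact: one_past_setI.
- exact: one_past_setT.
- by apply: all_past_measurable; exists B.
move=> _ [C [mC ->]].
pose B' (l : nat) := if l == i then C else B l.
have mB' l k : measurable (B' l k) by rewrite /B'; case: ifP.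
have -> : rect i C `&` \bigcap_(l in `I_n) rect l (B l) = \bigcap_(l in `I_n) rect l (B' l).
  apply/seteqP; split => w /=.
    move=> [h1 h2] l ln k km; rewrite /B'; case: eqP => [->|_]; [exact: h1|exact: h2].
  move=> h; split => [k km|l ln k km].
    by have := h i ni k km; rewrite /B' eqxx.
  by have := h l ln k km; rewrite /B'; case: eqP => // -> _; rewrite /= BT.
rewrite (prod_rect n mB') (prod_rect n mB) (bigD1 (Ordinal ni))//= [in RHS](bigD1 (Ordinal ni))//=.
rewrite {1}/B' eqxx.
have -> : P (rect i (B i)) = 1%E.
  rewrite -(@probability_setT _ _ _ P); congr (P _); apply/seteqP; split => // w _ k km.
  by rewrite /= BT.
rewrite mul1e; congr (_ * _)%E; apply: eq_bigr => l; rewrite -val_eqE /= => li.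
by rewrite /B' (negbTE li).
Qed.

Lemma all_past_indep n (E H : set T) : <<s all_past n >> E -> <<s one_past n >> H ->
  P (E `&` H) = (P E * P H)%E.
Proof.
move=> sE sH; move: E sE; apply: indep_sigma.
- exact: all_past_measurable.
- exact: all_past_setI.
- exact: all_past_setT.
- by apply: (smallest_sub (@sigma_algebra_measurable _ T) (@one_past_measurable n)).
move=> _ [B [mB ->]].
pose B' (l : nat) := if l == n then fun=> setT else B l.
have mB' l k : measurable (B' l k) by rewrite /B'; case: ifP.
have -> : \bigcap_(l in `I_n) rect l (B l) = \bigcap_(l in `I_n.+1) rect l (B' l).
  apply/seteqP; split => w /= h l.
    rewrite /= ltnS leq_eqVlt /B' => /predU1P[->|ln] k km; first by rewrite /= eqxx.
    by rewrite /= ltn_eqF//; exact: h.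
  by move=> ln k km; have := h l (ltnW ln) k km; rewrite /= /B' ltn_eqF.
rewrite setIC muleC; apply: (@all_past_indep_one n.+1 n) => //.
by move=> k; rewrite /B' eqxx.
Qed.

Lemma sigma_fun_one i k : (k < m)%N -> sigma_fun (one_past i) (xi i (ts k)).
Proof.
move=> km _ A mA; rewrite setTI; apply: sub_sigma_algebra.
exists (fun k' => if k' == k then A else setT); split; first by move=> k'; case: ifP.
apply/seteqP; split => w /=.
  by move=> h k' k'm; case: ifP => // /eqP ->.
by move=> h; have := h k km; rewrite /= eqxx.
Qed.

Lemma sigma_fun_all n l k : (l < n)%N -> (k < m)%N -> sigma_fun (all_past n) (xi l (ts k)).
Proof.
move=> ln km _ A mA; rewrite setTI; apply: sub_sigma_algebra.
exists (fun l' k' => if (l' == l) && (k' == k) then A else setT).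
split; first by move=> l' k'; case: ifP.
apply/seteqP; split => w /=.
  by move=> h l' l'n k' k'm; rewrite /=; case: ifP => // /andP[/eqP -> /eqP ->].
by move=> h; have := h l ln k km; rewrite /= !eqxx.
Qed.

Lemma sigma_fun_indep2 n (U V : T -> R) : sigma_fun (all_past n) U -> sigma_fun (one_past n) V ->
  indep2 P U V.
Proof.
by move=> mU mV A B mA mB; apply: (@all_past_indep n); exact: sigma_fun_set.
Qed.

End times.

Section grid.
Variables (h : R) (h0 : 0 < h) (j n N i : nat).
Hypotheses (jn : (j < n)%N) (iN : (i < N)%N).

Let grid (k : nat) : R := k%:R * h.

(** A rectangle is cut into [E2], which concerns copy [i], and [E1], which concerns the others.
    Independence of the copies separates [E1] from both [E2] and the increment; [levy_past]
    separates [E2] from the increment. *)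
Lemma past_indep_increment (E : set T) (C : set R) : <<s all_past j.+1 grid N >> E -> measurable C ->
  P (E `&` [set w | C (xi i (n%:R * h) w - xi i (j%:R * h) w)]) =
  (P E * P [set w | C (xi i (n%:R * h) w - xi i (j%:R * h) w)%R])%E.
Proof.
move=> sE mC; have grid_ge0 k : 0 <= grid k by rewrite mulr_ge0// ltW.
(* The grid up to [j], followed by the end of the increment: entries [j] and [j.+1] are its end
   points, which makes it a single step for [levy_past]. *)
pose ts' k : R := if (k <= j)%N then grid k else n%:R * h.
have ts'_ge0 k : 0 <= ts' k by rewrite /ts'; case: ifP => // _; exact: grid_ge0.
set D := [set w | _].
have mD : measurable D.
  rewrite -[D]setTI; apply: (measurable_funB (mxi i _) (mxi i _) measurableT mC); exact: grid_ge0.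
move: E sE; apply: indep_sigma => //; [exact: all_past_measurable|exact: all_past_setI|exact: all_past_setT|].
move=> _ [B [mB ->]].
pose B1 (l : nat) := if l == i then fun=> setT else B l.
pose E1 := \bigcap_(l in `I_N) \bigcap_(k in `I_j.+1) [set w | B1 l k (xi l (grid k) w)].
pose E2 := \bigcap_(k in `I_j.+1) [set w | B i k (xi i (grid k) w)].
have mB1 l k : measurable (B1 l k) by rewrite /B1; case: ifP.
have -> : \bigcap_(l in `I_N) \bigcap_(k in `I_j.+1) [set w | B l k (xi l (grid k) w)] = E2 `&` E1.
  apply/seteqP; split => w /=.
    move=> H; split => [k kj|l lN k kj]; first exact: H.
    by rewrite /B1 /=; case: eqP => // _; exact: H.
  move=> [H2 H1] l lN k kj; have := H1 l lN k kj; rewrite /B1/=.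
  by case: eqP => // -> _; exact: H2.
have past (H : set T) : <<s one_past j.+2 ts' i >> H -> P (H `&` E1) = (P H * P E1)%E.
  pose B2 l k := if (k <= j)%N then B1 l k else setT.
  have mB2 l k : measurable (B2 l k) by rewrite /B2; case: ifP.
  have -> : E1 = \bigcap_(l in `I_N) \bigcap_(k in `I_j.+2) [set w | B2 l k (xi l (ts' k) w)].
    apply/seteqP; split => w /= H' l lN k /= kj.
      by rewrite /B2 /ts'; case: ifP => // kj'; exact: H'.
    by have := H' l lN k (leqW kj); rewrite /= /B2 /ts'; rewrite /= ltnS in kj; rewrite kj.
  move=> sH; apply: (@all_past_indep_one j.+2 ts' ts'_ge0 N i) => // k.
  by rewrite /B2 /B1 eqxx; case: ifP.
have sE2 : <<s one_past j.+2 ts' i >> E2.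
  apply: sub_sigma_algebra; exists (fun k => if (k <= j)%N then B i k else setT).
  split; first by move=> k; case: ifP.
  apply/seteqP; split => w /= H' k /= kj.
    by rewrite /ts'; case: ifP => // kj'; exact: H'.
  by have := H' k (leqW kj); rewrite /= /ts'; rewrite /= ltnS in kj; rewrite kj.
have sD : <<s one_past j.+2 ts' i >> D.
  have m1 := @sigma_fun_one j.+2 ts' i j.+1 (ltnSn _).
  have m2 := @sigma_fun_one j.+2 ts' i j (leqnSn _).
  have := sigma_fun_set (measurable_funB m1 m2 : sigma_fun _ _) mC.
  by rewrite /ts' ltnn leqnn.
have ts'0 : ts' 0%N = 0 by rewrite /ts' /grid/= mul0r.
have ts'S k : (k <= j)%N -> ts' k < ts' k.+1.
  move=> kj; rewrite /ts' kj; case: ifP => _; rewrite /grid ltr_pM2r// ltr_nat//.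
  exact: leq_ltn_trans jn.
have E2D : P (E2 `&` D) = (P E2 * P D)%E.
  have := @levy_past _ _ _ P (xi i) (levy_xi i) j ts' ts'0 ts'S (B i) C (mB i) mC.
  have -> : \bigcap_(q in `I_j.+1) [set w | B i q (xi i (ts' q) w)] = E2.
    by apply/seteqP; split => w /= H' k /= kj; have := H' k kj; rewrite /= /ts'; rewrite /= ltnS in kj; rewrite kj.
  by rewrite /ts' ltnn leqnn.
have sI : <<s one_past j.+2 ts' i >> (E2 `&` D).
  by apply: (@measurableI _ (g_sigma_algebraType (one_past j.+2 ts' i))).
rewrite -setIA [E1 `&` _]setIC setIA (past _ sI) (past _ sE2) E2D -!muleA; congr (_ * _)%E.
by rewrite muleC.
Qed.

Lemma past_indep2_increment (U : T -> R) : sigma_fun (all_past j.+1 grid N) U ->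
  indep2 P U (fun w => xi i (n%:R * h) w - xi i (j%:R * h) w).
Proof.
by move=> mU A B mA mB; apply: past_indep_increment => //; exact: sigma_fun_set.
Qed.

End grid.

End IidCopies.

(** * Central limit theorem *)

Section TaylorBounds.
Context {R : realType}.

(** Taylor bounds by repeated integration, with constant 1 in place of the factorials: starting from
    |cos| <= 1, every use raises the exponent by one. *)
Lemma integrate_pow_bound (n : nat) (f g : R -> R) : (forall x : R, is_derive x 1 f (g x)) ->
  f 0 = 0 -> (forall x, `|g x| <= `|x| ^+ n) -> forall x, `|f x| <= `|x| ^+ n.+1.
Proof.
move=> fg f0 gb x.
have cf (a b : R) : {within `[a, b], continuous f}.
  apply: continuous_subspaceT => y.
  by apply: differentiable_continuous; apply/derivable1_diffP; case: (fg y).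
have pow (c : R) : `|c| <= `|x| -> `|g c * x| <= `|x| ^+ n.+1.
  move=> cx; rewrite normrM exprSr ler_wpM2r// (le_trans (gb c))//.
  by rewrite lerXn2r// nnegrE.
case: (leP 0 x) => x0.
  have [c cx] := @MVT_segment R f g 0 x x0 (fun z _ => fg z) (cf _ _).
  rewrite f0 !subr0 => ->; apply: pow; move: cx; rewrite in_itv/= => /andP[c0 cx].
  by rewrite !ger0_norm.
have [c cx] := @MVT_segment R f g x 0 (ltW x0) (fun z _ => fg z) (cf _ _).
rewrite f0 !sub0r => /eqP; rewrite mulrN eqr_opp => /eqP ->; apply: pow.
by move: cx; rewrite in_itv/= => /andP[cx c0]; rewrite !ler0_norm ?(ltW x0)// lerN2.
Qed.

Lemma sin_taylor (x : R) : `|sin x - x| <= `|x| ^+ 3.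
Proof.
move: x; apply: (@integrate_pow_bound 2 _ (fun x => cos x - 1)); last 2 first.
- by rewrite sin0 subrr.
- apply: (@integrate_pow_bound 1 _ (fun x => - sin x)); last 2 first.
  + by rewrite cos0 subrr.
  + move=> x; rewrite normrN; move: x; apply: (@integrate_pow_bound 0 _ cos).
    * exact: sin0.
    * by move=> x; rewrite expr0 cos_le1_norm.
  + by move=> x; apply: is_derive_eq; rewrite subr0.
Qed.

Lemma cos_taylor (x : R) : `|cos x - 1 + x ^+ 2 / 2| <= x ^+ 4.
Proof.
rewrite -(ger0_norm (_ : 0 <= x ^+ 4)) ?normrX; last by rewrite (exprM x 2 2) sqr_ge0.
move: x; apply: (@integrate_pow_bound 3 _ (fun x => - (sin x - x))); last 2 first.
- by rewrite cos0 subrr add0r expr2 !mul0r.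
- by move=> x; rewrite normrN; exact: sin_taylor.
- by move=> x; apply: is_derive_eq; rewrite /GRing.scale/=; field.
Qed.

Lemma expRN_taylor (y : R) : 0 <= y -> `|1 - y - expR (- y)| <= y ^+ 2.
Proof.
move=> y0; have h1 := expR_ge1Dx (- y).
have h2 : expR (- y) <= (1 + y)^-1.
  by rewrite expRN lef_pV2 ?posrE ?expR_gt0 ?expR_ge1Dx//; lra.
have h3 : (1 + y)^-1 <= 1 - y + y ^+ 2.
  rewrite -[leLHS]mul1r ler_pdivrMr; last by lra.
  by have := exprn_ge0 3 y0; nra.
by rewrite ler0_norm; lra.
Qed.

End TaylorBounds.

Section CentralLimit.
Context {d : measure_display} {T : measurableType d} {R : realType}.
Variable P : probability T R.
Variables (W : nat -> T -> R) (v C : R).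
Hypotheses (mW : forall i, mom P (W i)) (EW : forall i, Ex P (W i) = 0)
  (EW2 : forall i, Ex P (fun w => W i w ^+ 2) = v)
  (EW4 : forall i, Ex P (fun w => W i w ^+ 4) <= C)
  (indW : forall k, indep2 P (fun w => \sum_(i < k) W i w) (W k)).

Let S k w := \sum_(i < k) W i w.

Let mS k : mom P (S k). Proof. exact: mom_sum. Qed.

Let SS k w : S k.+1 w = S k w + W k w.
Proof. by rewrite /S big_ord_recr. Qed.

Let Ecross k (f g : R -> R) : measurable_fun setT f -> measurable_fun setT g ->
  mom P (fun w => f (S k w)) -> mom P (fun w => g (W k w)) ->
  Ex P (fun w => f (S k w) * g (W k w)) = Ex P (fun w => f (S k w)) * Ex P (fun w => g (W k w)).
Proof. by move=> mf mg mfS mgW; apply: Ex_indepM => //; exact: (indep2_comp mf mg (@indW k)). Qed.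

Let ES k : Ex P (S k) = 0.
Proof.
rewrite /S Ex_sum; last by move=> i; exact: mom_L1.
by rewrite big1.
Qed.

Let v0 : 0 <= v.
Proof. by rewrite -(EW2 0); apply: Ex_ge0 => w; exact: sqr_ge0. Qed.

Lemma sum_indep_sqr k : Ex P (fun w => S k w ^+ 2) = k%:R * v.
Proof.
elim: k => [|k ih].
  by under [X in Ex _ X]funext do rewrite /S big_ord0 expr0n/=; rewrite Ex_cst mul0r.
have E w : S k.+1 w ^+ 2 = S k w ^+ 2 + W k w ^+ 2 + 2 * (S k w ^+ 1 * W k w ^+ 1) by rewrite SS; ring.
under [X in Ex _ X]funext do rewrite E.
have m1 := momX 2 (mS k); have m2 := momX 2 (mW k).
have m3 := momM (momX 1 (mS k)) (momX 1 (mW k)).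
rewrite ExD; [|exact/mom_L1/momD|exact/mom_L1/momZ].
rewrite ExD; [|exact/mom_L1|exact/mom_L1].
rewrite ExZ; last exact/mom_L1.
rewrite (@Ecross k (fun x => x ^+ 1) (fun x => x ^+ 1))//; [|exact: momX|exact: momX].
by rewrite ih EW2 EW mulr0 mulr0 -natr1; ring.
Qed.

(** Terms with a first power have mean zero. What remains of the cross terms is 6 k v^2, and 3 (k +
    1)^2 - 3 k^2 = 6 k + 3 absorbs it. *)
Lemma sum_indep_pow4 k : Ex P (fun w => S k w ^+ 4) <= k%:R * C + 3 * k%:R ^+ 2 * v ^+ 2.
Proof.
elim: k => [|k ih].
  by under [X in Ex _ X]funext do rewrite /S big_ord0 expr0n/=; rewrite Ex_cst; lra.
have E4 w : S k.+1 w ^+ 4 = S k w ^+ 4 + W k w ^+ 4 + 6 * (S k w ^+ 2 * W k w ^+ 2)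
    + 4 * (S k w ^+ 3 * W k w ^+ 1) + 4 * (S k w ^+ 1 * W k w ^+ 3) by rewrite SS; ring.
under [X in Ex _ X]funext do rewrite E4.
have mm a b := momM (momX a (mS k)) (momX b (mW k)).
have m1 := momX 4 (mS k); have m2 := momX 4 (mW k).
have E a b : Ex P (fun w => S k w ^+ a * W k w ^+ b) = Ex P (fun w => S k w ^+ a) * Ex P (fun w => W k w ^+ b).
  by rewrite (@Ecross k (fun x => x ^+ a) (fun x => x ^+ b))//; exact: momX.
rewrite ExD; [|by apply/mom_L1; do !apply: momD => //; exact: momZ|exact/mom_L1/momZ].
rewrite ExD; [|by apply/mom_L1; do !apply: momD => //; exact: momZ|exact/mom_L1/momZ].
rewrite ExD; [|by apply/mom_L1; do !apply: momD => //; exact: momZ|exact/mom_L1/momZ].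
rewrite ExD; [|exact/mom_L1|exact/mom_L1].
rewrite !ExZ; [|exact/mom_L1..].
rewrite !E EW sum_indep_sqr EW2 -[Ex P (fun w => S k w ^+ 1)]/(Ex P (S k)) ES.
have := EW4 k; have := sqr_ge0 v; rewrite -natr1; nra.
Qed.

Let C0 : 0 <= C.
Proof.
apply: le_trans (EW4 0); apply: Ex_ge0 => w; by rewrite (exprM _ 2 2) sqr_ge0.
Qed.

Let cosb (u : T -> R) : measurable_fun setT u -> bmeas (fun w => cos (u w)).
Proof. by move=> mu; split; [exact: measurable_cos_fun|exists 1 => w; exact: cos_le1_norm]. Qed.

Let sinb (u : T -> R) : measurable_fun setT u -> bmeas (fun w => sin (u w)).
Proof.
move=> mu; split; last by exists 1 => w; rewrite ler_norml sin_geN1 sin_le1.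
by apply: measurableT_comp => //; apply: continuous_measurable_fun; exact: continuous_sin.
Qed.

(** Adding one summand multiplies the expectation by E cos(a W) = 1 - a^2 v / 2 + O(a^4), up to the
    term with E sin(a W) = O(a^3). Since a <= 1 all errors are put into a^3. *)
Let step (a th : R) k : 0 <= a <= 1 ->
  `|Ex P (fun w => cos (a * S k.+1 w + th)) - expR (- (a ^+ 2 * v / 2)) * Ex P (fun w => cos (a * S k w + th))|
  <= a ^+ 3 * (1 + 2 * C + v ^+ 2).
Proof.
move=> /andP[a0 a1].
have mu : measurable_fun setT (fun w => a * S k w + th).
  by have [] := momD (momZ a (mS k)) (mom_cst P th).
have mz : measurable_fun setT (fun w => a * W k w) by have [] := momZ a (mW k).
have mf (f : R -> R) : continuous f -> measurable_fun setT f by exact: continuous_measurable_fun.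
have mth : measurable_fun setT (fun x : R => a * x + th) by apply: measurable_funD => //; exact: measurable_funM.
have ma : measurable_fun setT (fun x : R => a * x) by exact: measurable_funM.
have mcosR := mf _ (@continuous_cos R); have msinR := mf _ (@continuous_sin R).
have E w : cos (a * S k.+1 w + th) =
    cos (a * S k w + th) * cos (a * W k w) - sin (a * S k w + th) * sin (a * W k w).
  by rewrite -cosD SS; congr cos; ring.
under [X in `|Ex _ X - _|]funext do rewrite E.
have [c1 s1] := (bmeas_mom P (cosb mu), bmeas_mom P (sinb mu)).
have [c2 s2] := (bmeas_mom P (cosb mz), bmeas_mom P (sinb mz)).
rewrite ExB; [|exact/mom_L1/momM|exact/mom_L1/momM].
rewrite (@Ecross k (fun x => cos (a * x + th)) (fun x => cos (a * x)))//; last 2 first.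
- exact: measurableT_comp mcosR mth.
- exact: measurableT_comp mcosR ma.
rewrite (@Ecross k (fun x => sin (a * x + th)) (fun x => sin (a * x)))//; last 2 first.
- exact: measurableT_comp msinR mth.
- exact: measurableT_comp msinR ma.
set cs := Ex P (fun w => cos (a * S k w + th)); set sn := Ex P (fun w => sin (a * S k w + th)).
set cw := Ex P _; set sw := Ex P _.
have cs1 : `|cs| <= 1 by apply: Ex_bound => [|w]; [have [] := c1|exact: cos_le1_norm].
have sn1 : `|sn| <= 1 by apply: Ex_bound => [|w]; [have [] := s1|rewrite ler_norml sin_geN1 sin_le1].
have m2 := momX 2 (mW k); have m4 := momX 4 (mW k).
have a3 : 0 <= a ^+ 3 by rewrite exprn_ge0.
have a43 : a ^+ 4 <= a ^+ 3 by rewrite exprS ler_piMl.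
have hcw : `|cw - (1 - a ^+ 2 * v / 2)| <= a ^+ 3 * C.
  have -> : cw - (1 - a ^+ 2 * v / 2) = Ex P (fun w => cos (a * W k w) - 1 + a ^+ 2 / 2 * W k w ^+ 2).
    rewrite ExD; [|exact/mom_L1/momB/mom_cst|exact/mom_L1/momZ].
    rewrite ExB; [|exact/mom_L1|exact: L1_cst].
    rewrite Ex_cst ExZ; last exact/mom_L1.
    by rewrite EW2 -/cw; field.
  apply: le_trans (normr_Ex _) _; first by apply/mom_L1/momD; [apply/momB/mom_cst|exact/momZ].
  apply: (@le_trans _ _ (Ex P (fun w => a ^+ 4 * W k w ^+ 4))).
    apply: Ex_le.
    - by apply/mom_L1/mom_norm/momD; [apply/momB/mom_cst|exact/momZ].
    - exact/mom_L1/momZ.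
    - move=> w; rewrite -exprMn (_ : a ^+ 2 / 2 * W k w ^+ 2 = (a * W k w) ^+ 2 / 2); last by ring.
      exact: cos_taylor.
  rewrite ExZ; last exact/mom_L1.
  by rewrite ler_pM ?exprn_ge0 ?EW4//; apply: Ex_ge0 => w; rewrite (exprM _ 2 2) sqr_ge0.
have hsw : `|sw| <= a ^+ 3 * (1 + C).
  have -> : sw = Ex P (fun w => sin (a * W k w) - a * W k w).
    by rewrite ExB; [|exact/mom_L1|exact/mom_L1/momZ]; rewrite ExZ ?EW ?mulr0 ?subr0//; exact/mom_L1.
  apply: le_trans (normr_Ex _) _; first by apply/mom_L1/momB => //; exact/momZ.
  apply: (@le_trans _ _ (Ex P (fun w => a ^+ 3 * (1 + W k w ^+ 4)))).
    apply: Ex_le.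
    - by apply/mom_L1/mom_norm/momB => //; exact/momZ.
    - by apply/mom_L1/momZ/momD => //; exact: mom_cst.
    - move=> w; apply: le_trans (sin_taylor _) _.
      rewrite normrM exprMn (ger0_norm a0) ler_wpM2l//.
      have -> : W k w ^+ 4 = `|W k w| ^+ 4.
        by rewrite -normrX ger0_norm// (exprM _ 2 2) sqr_ge0.
      (* |x|^3 <= 1 + x^4, so the bound on fourth moments suffices. *)
      have := normr_ge0 (W k w); set x := `|W k w| => x0.
      by have := sqr_ge0 (x ^+ 2 - x); have := sqr_ge0 (x - 1); have := sqr_ge0 x; nra.
  rewrite ExZ; last by apply/mom_L1/momD => //; exact: mom_cst.
  rewrite ler_wpM2l// ExD; [|exact: L1_cst|exact/mom_L1].
  by rewrite Ex_cst lerD2l EW4.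
have hexp : `|1 - a ^+ 2 * v / 2 - expR (- (a ^+ 2 * v / 2))| <= a ^+ 3 * v ^+ 2.
  apply: le_trans (expRN_taylor _) _; first by rewrite divr_ge0// mulr_ge0// sqr_ge0.
  rewrite (_ : (a ^+ 2 * v / 2) ^+ 2 = a ^+ 4 * (v ^+ 2 / 4)); last by field.
  by rewrite ler_pM ?exprn_ge0 ?divr_ge0 ?sqr_ge0//; have := sqr_ge0 v; lra.
set e := expR _ in hexp *.
have -> : cs * cw - sn * sw - e * cs =
  cs * (cw - (1 - a ^+ 2 * v / 2)) + cs * (1 - a ^+ 2 * v / 2 - e) - sn * sw by ring.
have h1 : `|cs * (cw - (1 - a ^+ 2 * v / 2))| <= a ^+ 3 * C.
  by rewrite normrM -[leRHS]mul1r ler_pM.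
have h2 : `|cs * (1 - a ^+ 2 * v / 2 - e)| <= a ^+ 3 * v ^+ 2.
  by rewrite normrM -[leRHS]mul1r ler_pM.
have h3 : `|sn * sw| <= a ^+ 3 * (1 + C).
  by rewrite normrM -[leRHS]mul1r ler_pM.
apply: le_trans (ler_normB _ _) _; have := ler_normD (cs * (cw - (1 - a ^+ 2 * v / 2))) (cs * (1 - a ^+ 2 * v / 2 - e)).
by lra.
Qed.

Let iter (a th : R) k : 0 <= a <= 1 ->
  `|Ex P (fun w => cos (a * S k w + th)) - expR (- (k%:R * (a ^+ 2 * v / 2))) * cos th|
  <= k%:R * (a ^+ 3 * (1 + 2 * C + v ^+ 2)).
Proof.
move=> a01; elim: k => [|k ih].
  under [X in Ex _ X]funext do rewrite /S big_ord0 mulr0 add0r.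
  by rewrite Ex_cst !mul0r oppr0 expR0 mul1r subrr normr0.
have := step th k a01; set e := expR (- (a ^+ 2 * v / 2)) => h.
have e01 : `|e| <= 1.
  by rewrite ger0_norm ?expR_ge0// -expR0 ler_expR oppr_le0 divr_ge0// mulr_ge0// sqr_ge0.
have -> : expR (- (k.+1%:R * (a ^+ 2 * v / 2))) = e * expR (- (k%:R * (a ^+ 2 * v / 2))).
  by rewrite -expRD; congr expR; rewrite -natr1; ring.
set f := Ex P _ in h *; set g := Ex P _ in ih h; set q := expR (- (k%:R * _)) in ih *.
have -> : f - e * q * cos th = (f - e * g) + e * (g - q * cos th) by ring.
apply: le_trans (ler_normD _ _) _; rewrite -natr1 mulrDl mul1r addrC lerD//.
by rewrite normrM -[leRHS]mul1r ler_pM.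
Qed.

(** The factor of each step is at most 1, so the errors of [step] add up to N a^3 D, which is D /
    sqrt N at a = 1 / sqrt N. *)
Lemma clt_cos (th : R) :
  Ex P (fun w => cos ((Num.sqrt N%:R)^-1 * \sum_(i < N) W i w + th)) @[N --> \oo] -->
  cos th * expR (- (v / 2)).
Proof.
(* The shift avoids N = 0, where the inverse root is 0 and N a^2 = 1 fails. *)
rewrite -(cvg_shiftS (fun N => Ex P (fun w => cos ((Num.sqrt N%:R)^-1 * \sum_(i < N) W i w + th)))).
pose D := 1 + 2 * C + v ^+ 2.
apply/cvgrPdist_le => e e0.
have cv0 : D * (Num.sqrt (@harmonic R n)) @[n --> \oo] --> 0.
  rewrite -(mulr0 D); apply: cvgM; first exact: cvg_cst.
  rewrite -[X in _ --> X](sqrtr0 R); apply: (@cvg_comp _ _ _ _ Num.sqrt _ (nbhs (0 : R))).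
    exact: cvg_harmonic.
  exact: sqrt_continuous.
move/cvgrPdist_le : cv0 => /(_ e e0); apply: filterS => n /=; rewrite sub0r normrN.
set a : R := (Num.sqrt n.+1%:R)^-1.
have nR : 0 < n.+1%:R :> R by rewrite ltr0n.
have s0 : 0 < Num.sqrt n.+1%:R :> R by rewrite sqrtr_gt0.
have aE : Num.sqrt n.+1%:R^-1 = a by rewrite sqrtrV// ltW.
rewrite aE ger0_norm; last first.
  rewrite mulr_ge0// ?invr_ge0 ?sqrtr_ge0// /D.
  by rewrite !addr_ge0 ?mulr_ge0 ?sqr_ge0.
apply: le_trans.
have a01 : 0 <= a <= 1.
  rewrite invr_ge0 sqrtr_ge0/= invf_le1//.
  by rewrite -[leLHS](sqrtr1 R) ler_sqrt ?ltr0n// ler1n.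
have na : n.+1%:R * a ^+ 2 = 1 :> R by rewrite exprVn sqr_sqrtr ?mulfV ?gt_eqF// ltW.
have := iter th n.+1 a01.
rewrite (_ : n.+1%:R * (a ^+ 2 * v / 2) = v / 2); last first.
  by transitivity (n.+1%:R * a ^+ 2 * (v / 2)); [ring|rewrite na mul1r].
rewrite (_ : n.+1%:R * (a ^+ 3 * (1 + 2 * C + v ^+ 2)) = D * a); last first.
  by transitivity (n.+1%:R * a ^+ 2 * (D * a)); [rewrite /D; ring|rewrite na mul1r].
by rewrite distrC mulrC.
Qed.

End CentralLimit.

(** * Maximal inequality and exponential martingales *)

Section Doob.
Context {d : measure_display} {T : measurableType d} {R : realType}.
Variables (P : probability T R) (S : nat -> T -> R) (lam : R) (n : nat).
Hypotheses (lam0 : 0 < lam) (mS : forall k, mom P (S k)).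

Definition exceeds k w : R := \1_[set w | lam < `|S k w|] w.

Definition first_exceeds j w : R := exceeds j w * \prod_(k < j) (1 - exceeds k w).

Let exc01 k w : exceeds k w = 0 \/ exceeds k w = 1.
Proof. by rewrite /exceeds indicE; case: (_ \in _); [right|left]. Qed.

Let mexc k : mom P (exceeds k).
Proof. by apply: mom_indic; apply: measurable_gt_norm; have [] := mS k. Qed.

Let mprod j : mom P (fun w => \prod_(k < j) (1 - exceeds k w)).
Proof.
elim: j => [|j ih].
  by under [X in mom _ X]funext do rewrite big_ord0; exact: mom_cst.
under [X in mom _ X]funext do rewrite big_ord_recr/=.
by apply: momM => //; apply: momB => //; exact: mom_cst.
Qed.

Lemma first_exceeds_mom j : mom P (first_exceeds j).
Proof. exact: momM. Qed.

Let prod01 j w : 0 <= \prod_(k < j) (1 - exceeds k w) <= 1.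
Proof.
elim: j => [|j]; first by rewrite big_ord0 ler01 lexx.
by rewrite big_ord_recr/=; case: (exc01 j w) => ->; rewrite ?subr0 ?mulr1// subrr mulr0 lexx ler01.
Qed.

Let first0 j w : 0 <= first_exceeds j w.
Proof. by rewrite mulr_ge0 ?(andP (prod01 j w)).1//; case: (exc01 j w) => ->. Qed.

Let sum_first w m : \sum_(j < m) first_exceeds j w = 1 - \prod_(k < m) (1 - exceeds k w).
Proof.
elim: m => [|m ih]; first by rewrite !big_ord0 subrr.
by rewrite !big_ord_recr/= ih /first_exceeds; ring.
Qed.

Let A := \bigcup_(k in `I_n.+1) [set w | lam < `|S k w|].

Let indicA w : \1_A w = \sum_(j < n.+1) first_exceeds j w :> R.
Proof.
rewrite sum_first indicE; case: (boolP (w \in A)) => [|wA].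
  rewrite inE => -[k kn lk]; rewrite (bigD1 (Ordinal kn))//= {1}/exceeds indicE mem_set//.
  by rewrite subrr mul0r subr0.
rewrite big1 ?subrr// => -[k kn] _; rewrite /exceeds /= indicE memNset ?subr0//.
by move=> /= lk; move/negP : wA; apply; rewrite inE; exists k.
Qed.

(* x^4 >= y^4 + 4y^3(x - y), with y the value at the first exceedance and x the
   terminal value; the linear term has mean zero. *)
Lemma doob_pow4 :
  (forall j, (j <= n)%N -> Ex P (fun w => first_exceeds j w * S j w ^+ 3 * (S n w - S j w)) = 0) ->
  fine (P A) <= Ex P (fun w => S n w ^+ 4) / lam ^+ 4.
Proof.
move=> orth; have l4 : 0 < lam ^+ 4 by rewrite exprn_gt0.
have mA : measurable A.
  by apply: bigcup_measurable => k _; apply: measurable_gt_norm; have [] := mS k.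
rewrite ler_pdivlMr// -Ex_indic// mulrC.
have mf := first_exceeds_mom.
have mS4 j := momX 4 (mS j).
have m3 j : mom P (fun w => first_exceeds j w * S j w ^+ 3 * (S n w - S j w)).
  by apply: momM; [apply: momM => //; exact: momX|exact: momB].
have step j : (j <= n)%N ->
    lam ^+ 4 * Ex P (first_exceeds j) <= Ex P (fun w => first_exceeds j w * S n w ^+ 4).
  move=> jn; rewrite -ExZ; last exact/mom_L1.
  have -> : Ex P (fun w => first_exceeds j w * S n w ^+ 4) =
    Ex P (fun w => first_exceeds j w * S n w ^+ 4 - 4 * (first_exceeds j w * S j w ^+ 3 * (S n w - S j w))).
    rewrite ExB; [|exact/mom_L1/momM|exact/mom_L1/momZ].
    by rewrite ExZ ?orth ?mulr0 ?subr0//; exact/mom_L1.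
  apply: Ex_le.
  - exact/mom_L1/momZ.
  - by apply/mom_L1/momB; [exact: momM|exact: momZ].
  - move=> w; have f0 := first0 j w.
    have -> : first_exceeds j w * S n w ^+ 4 - 4 * (first_exceeds j w * S j w ^+ 3 * (S n w - S j w)) =
       first_exceeds j w * (S n w ^+ 4 - 4 * S j w ^+ 3 * (S n w - S j w)) by ring.
    have h : S j w ^+ 4 <= S n w ^+ 4 - 4 * S j w ^+ 3 * (S n w - S j w).
      set x := S n w; set y := S j w.
      rewrite -subr_ge0 (_ : _ - _ = (x - y) ^+ 2 * ((x + y) ^+ 2 + 2 * y ^+ 2)); last by ring.
      by apply: mulr_ge0; [exact: sqr_ge0|apply: addr_ge0; [exact: sqr_ge0|apply: mulr_ge0 => //; exact: sqr_ge0]].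
    apply: (@le_trans _ _ (first_exceeds j w * S j w ^+ 4)); last by rewrite ler_wpM2l.
    rewrite /first_exceeds /exceeds indicE; case: (boolP (w \in _)) => [|_]; last by rewrite !mul0r mulr0.
    rewrite inE/= => lw; rewrite mul1r mulrC ler_wpM2l ?(andP (prod01 j w)).1//.
    have -> : S j w ^+ 4 = `|S j w| ^+ 4 by rewrite -normrX ger0_norm// (exprM _ 2 2) sqr_ge0.
    by rewrite lerXn2r// ?nnegrE// ltW.
have -> : Ex P (\1_A) = \sum_(j < n.+1) Ex P (first_exceeds j).
  rewrite -Ex_sum; last by move=> j; exact/mom_L1.
  by congr Ex; apply/funext => w; rewrite indicA.
rewrite mulr_sumr; apply: (@le_trans _ _ (\sum_(j < n.+1) Ex P (fun w => first_exceeds j w * S n w ^+ 4))).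
  by apply: ler_sum => j _; apply: step; rewrite -ltnS.
rewrite -Ex_sum; last by move=> j; exact/mom_L1/momM.
apply: Ex_le.
- by apply/mom_L1/mom_sum => j; exact: momM.
- exact/mom_L1.
- move=> w; rewrite -mulr_suml -[leRHS]mul1r ler_wpM2r// ?(exprM _ 2 2) ?sqr_ge0//.
  by rewrite -indicA indicE; case: (_ \in _).
Qed.

End Doob.

(** * Moments of exponential martingales *)

Section ExponentialMartingale.
Context {d : measure_display} {T : measurableType d} {R : realType}.
Variables (P : probability T R) (X : R -> T -> R).
Hypotheses (levyX : levy_process P X)
  (fin1 : forall u : R, (\int[P]_w (expR (u * X 1 w))%:E < +oo)%E).

Let psi := log_mgf P (X 1).

Definition expmart (c t : R) (w : T) := expR (X t w - t * c).

Local Notation Y := (expmart (psi 1)).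

Let a (u : R) := psi u - u * psi 1.

Lemma expmart_mom (c t : R) : 0 <= t -> mom P (expmart c t).
Proof.
move=> t0; rewrite /expmart; under [X in mom _ X]funext => w do rewrite expRD mulrC.
apply: momZ; under [X in mom _ X]funext => w do rewrite -[X t w]mul1r.
exact: levy_mom.
Qed.

Let Z (s t : R) w := expR (X (s + t) w - X s w - t * psi 1).

Let YZ s t w : Y (s + t) w = Y s w * Z s t w.
Proof. by rewrite /expmart /Z -expRD; congr expR; ring. Qed.

Let mZ s t : 0 <= s -> 0 <= t -> mom P (Z s t).
Proof.
move=> s0 t0; rewrite /Z; under [X in mom _ X]funext => w do rewrite expRD mulrC.
apply: momZ; under [X in mom _ X]funext => w do rewrite -[_ - _]mul1r.
exact: levy_incr_mom.
Qed.

(** The source of all moments below: differences of the martingale are polynomials in [Y s] and in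
    the multiplicative increment [Z s t], and are integrated monomial by monomial. *)
Let EYZ (p q : nat) s t : 0 <= s -> 0 <= t ->
  Ex P (fun w => Y s w ^+ p * Z s t w ^+ q) = expR (s * a p%:R + t * a q%:R).
Proof.
move=> s0 t0.
have E w : Y s w ^+ p * Z s t w ^+ q = expR (- (s * p%:R * psi 1) - t * q%:R * psi 1) *
    (expR (p%:R * X s w) * expR (q%:R * (X (s + t) w - X s w))).
  by rewrite /expmart /Z -!expRM_natl -!expRD; congr expR; ring.
under [X in Ex _ X]funext do rewrite E.
rewrite ExZ; last by apply/mom_L1/momM; [exact: levy_mom|exact: levy_incr_mom].
rewrite (@levy_mgf_incr _ _ _ P X levyX fin1 p%:R q%:R s t s0 t0) -expRD; congr expR; rewrite /a -/psi.
by move: (psi p%:R) (psi q%:R) (psi 1) => x y z; ring.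
Qed.

Let a0 : a 0 = 0.
Proof.
have := EYZ 0 0 (lexx 0) (ler01).
under [X in Ex _ X]funext do rewrite !expr0 mulr1.
rewrite Ex_cst mul0r add0r mul1r => /esym/eqP; rewrite -[X in _ == X]expR0 => /eqP/expR_inj; exact.
Qed.

Let a1 : a 1 = 0. Proof. by rewrite /a; ring. Qed.

Lemma expmart_mean (t : R) : 0 <= t -> Ex P (Y t) = 1.
Proof.
move=> t0; have := EYZ 1 0 t0 (lexx 0).
under [X in Ex _ X]funext do rewrite expr0 mulr1 expr1.
by move=> ->; rewrite a1 mulr0 mul0r addr0 expR0.
Qed.

Lemma expmart_pow4 (t : R) : 0 <= t -> Ex P (fun w => Y t w ^+ 4) = expR (t * (psi 4 - 4 * psi 1)).
Proof.
move=> t0; have := EYZ 4 0 t0 (lexx 0).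
under [X in Ex _ X]funext do rewrite expr0 mulr1.
by move=> ->; rewrite mul0r addr0.
Qed.

Lemma expmart_cov (s t : R) : 0 <= s -> 0 <= t ->
  Ex P (fun w => (Y s w - 1) * (Y (s + t) w - 1)) = expR (s * (psi 2 - 2 * psi 1)) - 1.
Proof.
move=> s0 t0; have st := addr_ge0 s0 t0.
have E w : (Y s w - 1) * (Y (s + t) w - 1) = Y s w ^+ 2 * Z s t w ^+ 1 - Y s w - Y (s + t) w + 1.
  by rewrite YZ; ring.
under [X in Ex _ X]funext do rewrite E.
have m1 := momM (momX 2 (expmart_mom (psi 1) s0)) (momX 1 (mZ s0 t0)).
have m2 := expmart_mom (psi 1) s0; have m3 := expmart_mom (psi 1) st.
rewrite ExD; [|by apply/mom_L1/momB => //; exact: momB|exact: L1_cst].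
rewrite ExB; [|by apply/mom_L1/momB|exact/mom_L1].
rewrite ExB; [|exact/mom_L1|exact/mom_L1].
rewrite EYZ// !expmart_mean// Ex_cst a1 mulr0 addr0; rewrite /a; ring.
Qed.

Lemma expmart_incr_mean (s t : R) : 0 <= s -> 0 <= t -> Ex P (fun w => Y (s + t) w - Y s w) = 0.
Proof.
move=> s0 t0; have st := addr_ge0 s0 t0.
rewrite ExB; [|exact/mom_L1/expmart_mom|exact/mom_L1/expmart_mom].
by rewrite !expmart_mean// subrr.
Qed.

Lemma expmart_factor_mean (s t : R) : 0 <= s -> 0 <= t ->
  Ex P (fun w => expR (X (s + t) w - X s w - t * psi 1)) = 1.
Proof.
move=> s0 t0; have := EYZ 0 1 s0 t0.
under [X in Ex _ X]funext do rewrite expr0 mul1r expr1.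
by move=> ->; rewrite a0 a1 !mulr0 addr0 expR0.
Qed.

Lemma expmart_incr_sqr (s t : R) : 0 <= s -> 0 <= t ->
  Ex P (fun w => (Y (s + t) w - Y s w) ^+ 2) =
  expR (s * (psi 2 - 2 * psi 1)) * (expR (t * (psi 2 - 2 * psi 1)) - 1).
Proof.
move=> s0 t0.
have E w : (Y (s + t) w - Y s w) ^+ 2 =
  Y s w ^+ 2 * Z s t w ^+ 2 - 2 * (Y s w ^+ 2 * Z s t w ^+ 1) + Y s w ^+ 2 * Z s t w ^+ 0.
  by rewrite YZ; ring.
under [X in Ex _ X]funext do rewrite E.
have mm q := mom_L1 (momM (momX 2 (expmart_mom (psi 1) s0)) (momX q (mZ s0 t0))).
rewrite ExD//; last by apply: L1B => //; exact: L1Z.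
rewrite ExB//; last exact: L1Z.
by rewrite ExZ// !EYZ// a0 a1 -!/(a 2) !expRD !mulr0 expR0; ring.
Qed.

(** The coefficients 1, -4, 6, -4, 1 of (Z - 1)^4 have sum zero, so every exponential can be written
    with its value at t = 0 subtracted. This form shows that the moment is of order t. *)
Lemma expmart_incr_pow4 (s t : R) : 0 <= s -> 0 <= t ->
  Ex P (fun w => (Y (s + t) w - Y s w) ^+ 4) =
  expR (s * (psi 4 - 4 * psi 1)) * ((expR (t * (psi 4 - 4 * psi 1)) - 1)
    - 4 * (expR (t * (psi 3 - 3 * psi 1)) - 1) + 6 * (expR (t * (psi 2 - 2 * psi 1)) - 1)).
Proof.
move=> s0 t0.
have E w : (Y (s + t) w - Y s w) ^+ 4 =
  Y s w ^+ 4 * Z s t w ^+ 4 - 4 * (Y s w ^+ 4 * Z s t w ^+ 3) + 6 * (Y s w ^+ 4 * Z s t w ^+ 2)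
   - 4 * (Y s w ^+ 4 * Z s t w ^+ 1) + Y s w ^+ 4 * Z s t w ^+ 0.
  by rewrite YZ; ring.
under [X in Ex _ X]funext do rewrite E.
have mm q := mom_L1 (momM (momX 4 (expmart_mom (psi 1) s0)) (momX q (mZ s0 t0))).
rewrite ExD//; last by do ![apply: L1B|apply: L1D] => //; exact: L1Z.
rewrite ExB//; [|by do ![apply: L1B|apply: L1D] => //; exact: L1Z|exact: L1Z].
rewrite ExD//; [|by do ![apply: L1B|apply: L1D] => //; exact: L1Z|exact: L1Z].
rewrite ExB//; last exact: L1Z.
rewrite (ExZ 4 (mm 3%N)) (ExZ 6 (mm 2%N)) (ExZ 4 (mm 1%N)) !(EYZ _ _ s0 t0) a0 a1 !expRD !mulr0 expR0 /a.
move: (expR (s * _)) (expR (t * (psi 4 - _))) (expR (t * (psi 3 - _))) (expR (t * (psi 2 - _))) => e0 e4 e3 e2; ring.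
Qed.

(** The variance of [Y 1] is e^gam - 1. *)
Lemma expmart_var_ge0 : 0 <= psi 2 - 2 * psi 1.
Proof.
have := @expmart_cov 1 0 ler01 (lexx 0).
under [X in Ex _ X]funext do rewrite addr0.
have : 0 <= Ex P (fun w => (Y 1 w - 1) * (Y 1 w - 1)) by apply: Ex_ge0 => w; exact: sqr_ge0.
by move=> + E; rewrite E mul1r subr_ge0 -[leLHS]expR0 ler_expR.
Qed.

End ExponentialMartingale.

(** * Fluctuations of the empirical sum *)

Section Fluctuations.
Context {d : measure_display} {T : measurableType d} {R : realType}.
Variables (P : probability T R) (xi : nat -> R -> T -> R).
Hypotheses (levy_xi : forall i, levy_process P (xi i)) (iid_xi : iid_copies P xi)
  (fin0 : forall u : R, (\int[P]_w (expR (u * xi 0%N 1 w))%:E < +oo)%E).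

Let psi := log_mgf P (xi 0%N 1).

Let mxi i (t : R) : 0 <= t -> measurable_fun setT (xi i t).
Proof. by case: (levy_xi i) => + _ _ _ _; exact. Qed.

Let same_mgf i (u : R) :
  (\int[P]_w (expR (u * xi i 1 w))%:E = \int[P]_w (expR (u * xi 0%N 1 w))%:E)%E.
Proof.
apply: (@ge0_integral_same_law _ _ _ P _ _ P _ _ (fun x => expR (u * x))) => //.
- exact: mxi.
- exact: mxi.
- move=> B mB; have := iid_xi.1 i 1%N (fun=> 1) (fun=> B) (fun=> ler01) (fun=> mB).
  have E j : \bigcap_(k in `I_1) [set w | B (xi j 1 w)] = xi j 1 @^-1` B.
    by apply/seteqP; split => w /=; [move=> /(_ 0%N erefl)|move=> h].
  by rewrite !E.
- by apply: measurableT_comp => //; exact: measurable_funM.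
Qed.

Lemma levy_fin i (u : R) : (\int[P]_w (expR (u * xi i 1 w))%:E < +oo)%E.
Proof. by rewrite same_mgf. Qed.

Lemma levy_psi i : log_mgf P (xi i 1) = log_mgf P (xi 0%N 1).
Proof. by apply/funext => u; rewrite /psi /log_mgf same_mgf. Qed.

Local Notation gam := (psi 2 - 2 * psi 1).

Let Y i := expmart (xi i) (psi 1).

Let mY i (t : R) : 0 <= t -> mom P (Y i t).
Proof. by move=> t0; apply: (expmart_mom (levy_xi i) (levy_fin i)). Qed.

Let EY i (t : R) : 0 <= t -> Ex P (Y i t) = 1.
Proof. by move=> t0; have := expmart_mean (levy_xi i) (levy_fin i) t0; rewrite levy_psi. Qed.

Let mY1 i (t : R) : 0 <= t -> mom P (fun w => Y i t w - 1).
Proof. by move=> t0; apply: momB; [exact: mY|exact: mom_cst]. Qed.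

Definition fluct (N : nat) (t : R) (w : T) : R :=
  (Num.sqrt N%:R)^-1 * \sum_(i < N) (Y i t w - 1).

Lemma fluct_mom N (t : R) : 0 <= t -> mom P (fluct N t).
Proof. by move=> t0; apply: momZ; apply: mom_sum => i; exact: mY1. Qed.

Let covY i (s t : R) : 0 <= s -> 0 <= t ->
  Ex P (fun w => (Y i s w - 1) * (Y i t w - 1)) = expR (Num.min s t * gam) - 1.
Proof.
wlog st : s t / s <= t.
  move=> W s0 t0; case: (leP s t) => [st|/ltW ts]; first by rewrite W// min_l.
  by under [X in Ex _ X]funext do rewrite mulrC; rewrite W// min_l.
move=> s0 t0; rewrite min_l//.
have := expmart_cov (levy_xi i) (levy_fin i) s0 (_ : 0 <= t - s); rewrite subr_ge0 st levy_psi => /(_ isT).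
by rewrite (_ : s + (t - s) = t)//; ring.
Qed.

Let sigma_fun_Y G i (t : R) : sigma_fun G (xi i t) -> sigma_fun G (Y i t).
Proof.
move=> mx; apply: (@measurableT_comp _ _ _ (g_sigma_algebraType G) _ _ expR) => //.
by apply: (@measurable_funB _ (g_sigma_algebraType G)).
Qed.

Section fdd.
Variables (ts : nat -> R) (s : seq (nat * R)).
Hypothesis ts_ge0 : forall k, 0 <= ts k.

Let W i w := lin s (fun k => Y i (ts k) w - 1).

Let mW i : mom P (W i).
Proof. by apply: mom_sum => p; apply: momZ; exact: mY1. Qed.

Let v := quad_form (fun x y => expR (Num.min x y * gam) - 1) [seq (ts p.1, p.2) | p <- s].

Let EW i : Ex P (W i) = 0.
Proof.
rewrite /W /lin Ex_sum; last by move=> p; apply/mom_L1/momZ; exact: mY1.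
rewrite big1// => p _; rewrite ExZ; last exact/mom_L1/mY1.
rewrite ExB; [|exact/mom_L1/mY|exact: L1_cst].
by rewrite EY// Ex_cst subrr mulr0.
Qed.

Let EW2 i : Ex P (fun w => W i w ^+ 2) = v.
Proof.
have E w : W i w ^+ 2 = \sum_(p <- s) \sum_(q <- s) p.2 * q.2 * ((Y i (ts p.1) w - 1) * (Y i (ts q.1) w - 1)).
  rewrite expr2 /W /lin mulr_suml; apply: eq_bigr => p _.
  by rewrite mulr_sumr; apply: eq_bigr => q _; ring.
have mm p q : mom P (fun w => p.2 * q.2 * ((Y i (ts p.1) w - 1) * (Y i (ts q.1) w - 1))).
  by apply: momZ; apply: momM; exact: mY1.
under [X in Ex _ X]funext do rewrite E.
rewrite Ex_sum; last by move=> p; apply/mom_L1/mom_sum => q.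
rewrite /v /quad_form big_map; apply: eq_bigr => p _.
rewrite Ex_sum; last by move=> q; exact/mom_L1.
rewrite big_map; apply: eq_bigr => q _ /=.
by rewrite ExZ ?covY//; apply/mom_L1/momM; exact: mY1.
Qed.

Let EW4 : exists C : R, forall i, Ex P (fun w => W i w ^+ 4) <= C.
Proof.
have p4 (x : R) : 0 <= x ^+ 4 by rewrite (exprM _ 2 2) sqr_ge0.
have n4 (x : R) : x ^+ 4 = `|x| ^+ 4 by rewrite -normrX ger0_norm.
have N14 : (-1) ^+ 4 = 1 :> R by ring.
have D4 (x y : R) : (x + y) ^+ 4 <= 2 ^+ 4 * (x ^+ 4 + y ^+ 4).
  rewrite n4 (n4 x) (n4 y); apply: le_trans (exprD_le_max 4 (normr_ge0 x) (normr_ge0 y)).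
  by rewrite lerXn2r// ?nnegrE ?addr_ge0// ler_normD.
rewrite /W; elim: s => [|p s' [C hC]].
  exists 0 => i; under [X in Ex _ X]funext do rewrite /lin big_nil expr0n/=.
  by rewrite Ex_cst.
have m1 i : mom P (fun w => lin s' (fun k => Y i (ts k) w - 1)).
  by apply: mom_sum => q; apply: momZ; exact: mY1.
have m2 i := mY1 i (ts_ge0 p.1).
exists (2 ^+ 4 * (p.2 ^+ 4 * (2 ^+ 4 * (expR (ts p.1 * (psi 4 - 4 * psi 1)) + 1)) + C)) => i.
apply: (@le_trans _ _ (Ex P (fun w => 2 ^+ 4 * (p.2 ^+ 4 * (Y i (ts p.1) w - 1) ^+ 4 + lin s' (fun k => Y i (ts k) w - 1) ^+ 4)))).
  apply: Ex_le.
  - by apply/mom_L1/momX; apply: mom_sum => q; apply: momZ; exact: mY1.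
  - by apply/mom_L1/momZ/momD; [exact/momZ/momX|exact: momX].
  - by move=> w; rewrite /lin big_cons -exprMn.
rewrite ExZ; last by apply/mom_L1/momD; [exact/momZ/momX|exact: momX].
rewrite ler_wpM2l// ?exprn_ge0// ExD; [|exact/mom_L1/momZ/momX|exact/mom_L1/momX].
rewrite lerD//; rewrite ExZ; last exact/mom_L1/momX.
rewrite ler_wpM2l//.
have m4 := momX 4 (mY i (ts_ge0 p.1)).
apply: (@le_trans _ _ (Ex P (fun w => 2 ^+ 4 * (Y i (ts p.1) w ^+ 4 + 1)))).
  apply: Ex_le.
  - exact/mom_L1/momX.
  - by apply/mom_L1/momZ/momD => //; exact: mom_cst.
  - by move=> w; apply: le_trans (D4 _ _) _; rewrite N14.
rewrite ExZ; last by apply/mom_L1/momD => //; exact: mom_cst.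
rewrite ler_wpM2l// ?exprn_ge0// ExD; [|exact/mom_L1|exact: L1_cst].
rewrite Ex_cst lerD2r; have := expmart_pow4 (levy_xi i) (levy_fin i) (ts_ge0 p.1).
by rewrite levy_psi /Y => ->.
Qed.

Let indW k : indep2 P (fun w => \sum_(i < k) W i w) (W k).
Proof.
pose m := (\max_(p <- s) p.1).+1.
have pm p : p \in s -> (p.1 < m)%N by move=> ps; rewrite ltnS; exact: leq_bigmax_seq.
have sW G i : (forall p, p \in s -> sigma_fun G (xi i (ts p.1))) -> sigma_fun G (W i).
  rewrite /W /lin; elim: s => [|p s' ih] h.
    by under [X in sigma_fun _ X]funext do rewrite big_nil; exact: measurable_cst.
  under [X in sigma_fun _ X]funext do rewrite big_cons.
  apply: (@measurable_funD _ (g_sigma_algebraType G)); last first.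
    by apply: ih => q qs; apply: h; rewrite inE qs orbT.
  apply: (@measurable_funM _ (g_sigma_algebraType G)) => //.
  apply: (@measurable_funB _ (g_sigma_algebraType G)) => //.
  by apply: sigma_fun_Y; apply: h; rewrite mem_head.
apply: (@sigma_fun_indep2 _ _ _ P xi levy_xi iid_xi m ts ts_ge0 k).
- apply: (@measurable_sum _ (g_sigma_algebraType _)) => i; apply: sW => p ps.
  by apply: sigma_fun_all => //; exact: pm.
- by apply: sW => p ps; apply: sigma_fun_one; exact: pm.
Qed.

Lemma fluct_cos (th : R) :
  Ex P (fun w => cos (lin s (fun k => fluct N (ts k) w) + th)) @[N --> \oo] -->
  cos th * expR (- (v / 2)).
Proof.
have [C hC] := EW4.
have E N w : lin s (fun k => fluct N (ts k) w) = (Num.sqrt N%:R)^-1 * \sum_(i < N) W i w.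
  rewrite /lin /W /fluct exchange_big/= mulr_sumr; apply: eq_bigr => p _.
  by rewrite -mulr_sumr; ring.
under eq_fun do under [X in Ex _ X]funext do rewrite E.
exact: (clt_cos mW EW EW2 hC indW).
Qed.

(** Equality holds for N > 0; at N = 0 the left side is 0. *)
Lemma fluct_sqr N : Ex P (fun w => lin s (fun k => fluct N (ts k) w) ^+ 2) <= v.
Proof.
have v0 : 0 <= v by rewrite -(EW2 0); apply: Ex_ge0 => w; exact: sqr_ge0.
have E w : lin s (fun k => fluct N (ts k) w) ^+ 2 = (Num.sqrt N%:R)^-1 ^+ 2 * (\sum_(i < N) W i w) ^+ 2.
  rewrite -exprMn; congr (_ ^+ 2); rewrite /lin /W /fluct exchange_big/= mulr_sumr; apply: eq_bigr => p _.
  by rewrite -mulr_sumr; ring.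
under [X in Ex _ X]funext do rewrite E.
rewrite ExZ; last by apply/mom_L1/momX/mom_sum.
rewrite (sum_indep_sqr mW EW EW2 indW) mulrA exprVn sqr_sqrtr ?ler0n//.
clear E; case: N => [|N]; first by rewrite mulr0 mul0r.
by rewrite mulVf ?mul1r// pnatr_eq0.
Qed.

End fdd.

Lemma fluct_tight (t e : R) : 0 <= t -> 0 < e ->
  exists2 A : R, 0 < A & forall N, fine (P [set w | A < `|fluct N t w|]) <= e.
Proof.
move=> t0 e0; pose v := expR (t * gam) - 1.
have hv N : Ex P (fun w => fluct N t w ^+ 2) <= v.
  have := @fluct_sqr (fun=> t) [:: (0%N, 1)] (fun=> t0) N.
  under [X in Ex _ X]funext do rewrite /lin big_seq1 mul1r.
  by rewrite /quad_form /= !big_seq1/= !mul1r minxx.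
have v0 : 0 <= v by apply: le_trans (hv 0%N); apply: Ex_ge0 => w; exact: sqr_ge0.
exists (Num.sqrt ((v + 1) / e)); first by rewrite sqrtr_gt0 divr_gt0//; lra.
move=> N; have A0 : 0 < Num.sqrt ((v + 1) / e) by rewrite sqrtr_gt0 divr_gt0//; lra.
apply: le_trans (Ex_markov 2 (fluct_mom N t0) A0) _.
rewrite sqr_sqrtr; last by rewrite divr_ge0 ?ltW//; lra.
under [X in Ex _ X]funext do rewrite -normrX ger0_norm ?sqr_ge0//.
rewrite ler_pdivrMr; last by rewrite divr_gt0//; lra.
rewrite mulrC divfK ?gt_eqF//; have := hv N; lra.
Qed.

Let sig2 (s t : R) := expR (s * gam) * (expR (t * gam) - 1).

Let kap (s t : R) := expR (s * (psi 4 - 4 * psi 1)) * ((expR (t * (psi 4 - 4 * psi 1)) - 1)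
    - 4 * (expR (t * (psi 3 - 3 * psi 1)) - 1) + 6 * (expR (t * gam) - 1)).

(** [sum_indep_pow4] divided by N^2: individual fourth moments [kap] survive with weight 1/N,
    products of variances [sig2] with weight one. As both are of order [t], this is O(t/N + t^2). *)
Lemma fluct_incr_pow4 N (s t : R) : 0 <= s -> 0 <= t ->
  Ex P (fun w => (fluct N (s + t) w - fluct N s w) ^+ 4) <= kap s t / N%:R + 3 * sig2 s t ^+ 2.
Proof.
move=> s0 t0; have st := addr_ge0 s0 t0.
pose W i w := Y i (s + t) w - Y i s w.
have mW i : mom P (W i) by apply: momB; exact: mY.
have EW i : Ex P (W i) = 0.
  by have := expmart_incr_mean (levy_xi i) (levy_fin i) s0 t0; rewrite levy_psi.
have EW2 i : Ex P (fun w => W i w ^+ 2) = sig2 s t.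
  by have := expmart_incr_sqr (levy_xi i) (levy_fin i) s0 t0; rewrite levy_psi.
have EW4 i : Ex P (fun w => W i w ^+ 4) <= kap s t.
  by have := expmart_incr_pow4 (levy_xi i) (levy_fin i) s0 t0; rewrite levy_psi /W /Y => ->.
have indW k : indep2 P (fun w => \sum_(i < k) W i w) (W k).
  pose ts (k : nat) := if k == 0%N then s else s + t.
  have ts_ge0 q : 0 <= ts q by rewrite /ts; case: ifP.
  have sW G i : sigma_fun G (xi i (ts 0%N)) -> sigma_fun G (xi i (ts 1%N)) -> sigma_fun G (W i).
    by move=> h0 h1; apply: (@measurable_funB _ (g_sigma_algebraType G)); exact: sigma_fun_Y.
  apply: (@sigma_fun_indep2 _ _ _ P xi levy_xi iid_xi 2 ts ts_ge0 k).
  - apply: (@measurable_sum _ (g_sigma_algebraType _)) => i; apply: sW; exact: sigma_fun_all.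
  - by apply: sW; exact: sigma_fun_one.
have E w : (fluct N (s + t) w - fluct N s w) ^+ 4 =
    (Num.sqrt N%:R)^-1 ^+ 4 * (\sum_(i < N) W i w) ^+ 4.
  rewrite -exprMn; congr (_ ^+ 4); rewrite /fluct -mulrBr -sumrB; congr (_ * _).
  by apply: eq_bigr => i _; rewrite /W; ring.
under [X in Ex _ X]funext do rewrite E.
rewrite ExZ; last by apply/mom_L1/momX/mom_sum.
have h := sum_indep_pow4 mW EW EW2 EW4 indW N.
have k0 : 0 <= kap s t.
  by apply: le_trans (EW4 0%N); apply: Ex_ge0 => w; rewrite (exprM _ 2 2) sqr_ge0.
clear E; case: N h => [|N] h.
  rewrite sqrtr0 invr0 expr0n/= !mul0r mulr0 add0r; apply: mulr_ge0 => //; exact: sqr_ge0.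
have N0 : 0 < N.+1%:R :> R by rewrite ltr0n.
have -> : (Num.sqrt N.+1%:R)^-1 ^+ 4 = (N.+1%:R ^+ 2)^-1 :> R.
  by rewrite exprVn (exprM _ 2 2) sqr_sqrtr// ltW.
rewrite mulrC ler_pdivrMr ?exprn_gt0//; apply: (le_trans h).
by rewrite [leRHS](_ : _ = N.+1%:R * kap s t + 3 * N.+1%:R ^+ 2 * sig2 s t ^+ 2)//; field; rewrite gt_eqF.
Qed.

Let expR_sub1_le (T0 a t : R) : 0 <= t <= T0 ->
  `|expR (t * a) - 1| <= t * (`|a| * expR (T0 * `|a|)).
Proof.
move=> /andP[t0 tT]; set x := t * a.
have xe : `|x| * expR (T0 * `|a|) = t * (`|a| * expR (T0 * `|a|)) by rewrite /x normrM (ger0_norm t0); ring.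
rewrite -xe; have xT : `|x| <= T0 * `|a| by rewrite /x normrM (ger0_norm t0) ler_wpM2r.
have e1 : 1 <= expR (T0 * `|a|) by rewrite -[leLHS]expR0 ler_expR (le_trans _ xT).
have h1 := expR_ge1Dx x.
have h2 : expR x - 1 <= x * expR x.
  have h : (1 - x) * expR x <= 1.
    by rewrite -[leRHS](expRxMexpNx_1 x) mulrC ler_wpM2l ?expR_ge0//; have := expR_ge1Dx (- x).
  by lra.
have h3 : x * expR x <= `|x| * expR (T0 * `|a|).
  apply: (@le_trans _ _ (`|x| * expR x)); first by rewrite ler_wpM2r ?expR_ge0// ler_norm.
  by rewrite ler_wpM2l// ler_expR (le_trans (ler_norm x)).
have h4 : - (`|x| * expR (T0 * `|a|)) <= x.
  rewrite lerNl (@le_trans _ _ `|x|) ?ler_peMr//.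
  by rewrite -normrN ler_norm.
by rewrite ler_norml; apply/andP; split; lra.
Qed.

Let incr_const (T0 : R) : exists2 C : R, 0 <= C & forall s t, 0 <= s <= T0 -> 0 <= t <= T0 ->
  kap s t <= C * t /\ sig2 s t <= C * t.
Proof.
pose K (b : R) := `|b| * expR (T0 * `|b|).
have K0 b : 0 <= K b by rewrite mulr_ge0// expR_ge0.
have eT (s b : R) : 0 <= s <= T0 -> expR (s * b) <= expR (T0 * `|b|).
  move=> /andP[s0 sT]; rewrite ler_expR (le_trans (ler_norm _))// normrM (ger0_norm s0).
  by rewrite ler_wpM2r.
pose b4 := psi 4 - 4 * psi 1; pose b3 := psi 3 - 3 * psi 1.
pose C1 := expR (T0 * `|b4|) * (K b4 + 4 * K b3 + 6 * K gam).
pose C2 := expR (T0 * `|gam|) * K gam.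
have [C10 C20] : 0 <= C1 /\ 0 <= C2.
  by split; rewrite mulr_ge0 ?expR_ge0// !addr_ge0// mulr_ge0.
exists (C1 + C2) => [|s t s0T t0T]; first exact: addr_ge0.
have t0 : 0 <= t by case/andP : t0T.
have k4 := expR_sub1_le b4 t0T; have k3 := expR_sub1_le b3 t0T; have k2 := expR_sub1_le gam t0T.
split.
  apply: (@le_trans _ _ (C1 * t)); last by rewrite ler_wpM2r// lerDl.
  rewrite -[kap s t]/(expR (s * b4) * (expR (t * b4) - 1 - 4 * (expR (t * b3) - 1) + 6 * (expR (t * gam) - 1))).
  rewrite /C1 -mulrA; apply: (@le_trans _ _ (expR (s * b4) * ((K b4 + 4 * K b3 + 6 * K gam) * t))).
    rewrite ler_wpM2l ?expR_ge0//.
    have := ler_norm (expR (t * b4) - 1); have := ler_norm (expR (t * gam) - 1).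
    have := ler_norm (- (expR (t * b3) - 1)); rewrite normrN -/(K b4) -/(K b3) -/(K gam) in k4 k3 k2 *; lra.
  by rewrite ler_wpM2r ?eT// mulr_ge0// !addr_ge0// mulr_ge0.
apply: (@le_trans _ _ (C2 * t)); last by rewrite ler_wpM2r// lerDr.
rewrite /sig2 /C2 -mulrA; apply: (@le_trans _ _ (expR (s * gam) * (K gam * t))).
  rewrite ler_wpM2l ?expR_ge0//; have := ler_norm (expR (t * gam) - 1).
  by rewrite -/(K gam) in k2; lra.
by rewrite ler_wpM2r ?eT// mulr_ge0.
Qed.

Let sig2_ge0 (s t : R) : 0 <= t -> 0 <= sig2 s t.
Proof.
move=> t0; rewrite mulr_ge0 ?expR_ge0// subr_ge0 -[leLHS]expR0 ler_expR mulr_ge0//.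
exact: expmart_var_ge0 (levy_xi 0%N) fin0.
Qed.

(** * The maximal inequality along a grid *)

Section grid.
Variables (h lam : R) (b n N : nat).
Hypotheses (h0 : 0 < h) (lam0 : 0 < lam).

Let S k w := fluct N ((b + k)%:R * h) w - fluct N (b%:R * h) w.

Let g0 (k : nat) : 0 <= k%:R * h. Proof. by rewrite mulr_ge0// ltW. Qed.

Let mS k : mom P (S k). Proof. by apply: momB; exact: fluct_mom. Qed.

Let past j := all_past xi j.+1 (fun k => k%:R * h) N.

Let sfluct j k : (k <= j)%N -> sigma_fun (past j) (fluct N (k%:R * h)).
Proof.
move=> kj; apply: (@measurable_funM _ (g_sigma_algebraType (past j))) => //.
apply: (@measurable_sum _ (g_sigma_algebraType (past j))) => i.
apply: (@measurable_funB _ (g_sigma_algebraType (past j))) => //.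
by apply: sigma_fun_Y; apply: (@sigma_fun_all _ _ _ xi j.+1 (fun k => k%:R * h) N i k).
Qed.

Let sS j k : (k <= j)%N -> sigma_fun (past (b + j)) (S k).
Proof.
move=> kj; apply: (@measurable_funB _ (g_sigma_algebraType (past (b + j)))); apply: sfluct.
  by rewrite leq_add2l.
exact: leq_addr.
Qed.

Let sexc j k : (k <= j)%N -> sigma_fun (past (b + j)) (exceeds S lam k).
Proof.
move=> kj; have -> : exceeds S lam k = (\1_[set x : R | lam < `|x|] : R -> R) \o S k.
  by apply/funext => w; rewrite /exceeds /= !indicE; congr (nat_of_bool _)%:R; apply/idP/idP; rewrite !inE.
apply: (@measurableT_comp _ _ _ (g_sigma_algebraType (past (b + j))) _ _ (\1_[set x : R | lam < `|x|] : R -> R)).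
  apply: measurable_indic; apply: (@measurable_lt_set _ (measurableTypeR R) R (cst lam) (fun x : R => `|x|)) => //.
  exact: normr_measurable.
exact: sS.
Qed.

Let sfirst j : sigma_fun (past (b + j)) (first_exceeds S lam j).
Proof.
apply: (@measurable_funM _ (g_sigma_algebraType (past (b + j)))); first exact: sexc.
suff : forall m, (m <= j)%N -> sigma_fun (past (b + j)) (fun w => \prod_(k < m) (1 - exceeds S lam k w)) by exact.
elim=> [|m ih] mj.
  by under [X in sigma_fun _ X]funext do rewrite big_ord0; exact: measurable_cst.
under [X in sigma_fun _ X]funext do rewrite big_ord_recr/=.
apply: (@measurable_funM _ (g_sigma_algebraType (past (b + j)))); first by apply: ih; exact: ltnW.
apply: (@measurable_funB _ (g_sigma_algebraType (past (b + j)))) => //.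
by apply: sexc; exact: ltnW.
Qed.

(** The martingale property in the form [doob_pow4] needs. The later increment is a sum over copies
    of a value known at time [s] times the factor [V i], which has mean zero and is independent of
    the past of all copies. *)
Let orth j : (j <= n)%N -> Ex P (fun w => first_exceeds S lam j w * S j w ^+ 3 * (S n w - S j w)) = 0.
Proof.
rewrite leq_eqVlt => /predU1P[->|jn].
  by under [X in Ex _ X]funext do rewrite subrr mulr0; rewrite Ex_cst.
pose s := (b + j)%:R * h; pose t := (n - j)%:R * h.
have st : s + t = (b + n)%:R * h by rewrite /s /t -mulrDl -natrD -addnA subnKC// ltnW.
have [s0 t0] : 0 <= s /\ 0 <= t by split; exact: g0.
pose U i w := first_exceeds S lam j w * S j w ^+ 3 * ((Num.sqrt N%:R)^-1 * Y i s w).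
pose V i w := expR (xi i (s + t) w - xi i s w - t * psi 1) - 1.
have mU i : mom P (U i).
  apply: momM; last by apply: momZ; exact: mY.
  by apply: momM; [exact: first_exceeds_mom|exact: momX].
have mZ i : mom P (fun w => expR (xi i (s + t) w - xi i s w - t * psi 1)).
  under [X in mom _ X]funext => w do rewrite expRD mulrC.
  apply: momZ; under [X in mom _ X]funext => w do rewrite -[_ - _]mul1r.
  by apply: (levy_incr_mom (levy_xi i) (levy_fin i)).
have mV i : mom P (V i) by apply: momB => //; exact: mom_cst.
have EV i : Ex P (V i) = 0.
  rewrite ExB ?Ex_cst; [|exact/mom_L1|exact: L1_cst].
  by have := expmart_factor_mean (levy_xi i) (levy_fin i) s0 t0; rewrite levy_psi => ->; rewrite subrr.
have E w : first_exceeds S lam j w * S j w ^+ 3 * (S n w - S j w) = \sum_(i < N) U i w * V i w.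
  have -> : S n w - S j w = \sum_(i < N) (Num.sqrt N%:R)^-1 * (Y i (s + t) w - Y i s w).
    transitivity (fluct N (s + t) w - fluct N s w); first by rewrite /S -st; ring.
    rewrite /fluct -mulrBr -sumrB -mulr_sumr; congr (_ * _).
    by apply: eq_bigr => i _; ring.
  rewrite mulr_sumr; apply: eq_bigr => i _; rewrite /U /V.
  have -> : Y i (s + t) w = Y i s w * expR (xi i (s + t) w - xi i s w - t * psi 1).
    by rewrite /Y /expmart -expRD; congr expR; ring.
  ring.
under [X in Ex _ X]funext do rewrite E.
rewrite Ex_sum; last by move=> i; exact/mom_L1/momM.
rewrite big1// => i _; rewrite Ex_indepM ?EV ?mulr0//.
have sU : sigma_fun (past (b + j)) (U i).
  apply: (@measurable_funM _ (g_sigma_algebraType (past (b + j)))).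
    apply: (@measurable_funM _ (g_sigma_algebraType (past (b + j)))); first exact: sfirst.
    apply: (@measurable_funX _ (g_sigma_algebraType (past (b + j)))); exact: sS.
  apply: (@measurable_funM _ (g_sigma_algebraType (past (b + j)))) => //.
  apply: sigma_fun_Y; exact: (@sigma_fun_all _ _ _ xi (b + j).+1 (fun k => k%:R * h) N i (b + j)).
have jn' : (b + j < b + n)%N by rewrite ltn_add2l.
have := past_indep2_increment levy_xi iid_xi h0 jn' (ltn_ord i) sU.
rewrite -/s -st => /(@indep2_comp _ _ _ P _ _ id (fun x => expR (x - t * psi 1) - 1)); apply => //.
apply: measurable_funB => //; apply: measurableT_comp => //; exact: measurable_funB.
Qed.

Lemma fluct_grid_max :
  fine (P (\bigcup_(k in `I_n.+1) [set w | lam < `|fluct N ((b + k)%:R * h) w - fluct N (b%:R * h) w|])) <=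
  (kap (b%:R * h) (n%:R * h) / N%:R + 3 * sig2 (b%:R * h) (n%:R * h) ^+ 2) / lam ^+ 4.
Proof.
apply: le_trans (doob_pow4 lam0 mS orth) _.
rewrite ler_wpM2r ?invr_ge0 ?exprn_ge0 ?(ltW lam0)//.
have := fluct_incr_pow4 N (g0 b) (g0 n).
by rewrite -mulrDl -natrD.
Qed.

End grid.

Lemma fluct_cadlag N w : cadlag_path (fluct N ^~ w).
Proof.
have rc i (t : R) : 0 <= t -> Y i s w @[s --> t^'+] --> Y i t w.
  move=> t0; apply: (@cvg_comp _ _ _ _ expR _ (nbhs (xi i t w - t * psi 1))); last exact: continuous_expR.
  apply: cvgB; first by case: (levy_xi i) => _ /(_ w) [h _] _ _ _; exact: h.
  by apply: cvgM; [apply: cvg_at_right_filter; exact: cvg_id|exact: cvg_cst].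
have lc i (t : R) : 0 < t -> cvg (Y i s w @[s --> t^'-]).
  move=> t0; case: (levy_xi i) => _ /(_ w) [_ /(_ t t0) h] _ _ _.
  apply/cvg_ex; exists (expR (lim (xi i s w @[s --> t^'-]) - t * psi 1)).
  apply: (@cvg_comp _ _ _ _ expR _ (nbhs (lim (xi i s w @[s --> t^'-]) - t * psi 1))); last exact: continuous_expR.
  apply: cvgB; first exact: h.
  by apply: cvgM; [apply: cvg_at_left_filter; exact: cvg_id|exact: cvg_cst].
split=> t t0; rewrite /fluct.
  apply: cvgM; first exact: cvg_cst.
  by apply: cvg_sumr => i; apply: cvgB; [exact: rc|exact: cvg_cst].
apply: is_cvgM; first exact: is_cvg_cst.
apply/cvg_ex; exists (\sum_(i < N) (lim (Y i s w @[s --> t^'-]) - 1)).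
by apply: cvg_sumr => i; apply: cvgB; [exact: lc|exact: cvg_cst].
Qed.

(** The bound of [fluct_grid_max] depends on the block and not on the mesh, so it survives the
    increasing union over dyadic grids; right continuity then reaches every time of the block. *)
Let block_osc N (b : nat) (L lam : R) : 0 < L -> 0 < lam ->
  exists A, [/\ measurable A,
    fine (P A) <= (kap (b%:R * L) L / N%:R + 3 * sig2 (b%:R * L) L ^+ 2) / lam ^+ 4 &
    forall w, ~ A w -> forall t, b%:R * L <= t <= b.+1%:R * L ->
      `|fluct N t w - fluct N (b%:R * L) w| <= lam].
Proof.
move=> L0 lam0; have a0 : 0 <= b%:R * L by rewrite mulr_ge0// ltW.
pose h (q : nat) := L / 2 ^+ q.
have h0 q : 0 < h q by rewrite divr_gt0// exprn_gt0.
have hL q : (2 ^ q)%:R * h q = L by rewrite /h natrX; field; rewrite expf_neq0.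
pose E q k := [set w | lam < `|fluct N (b%:R * L + k%:R * h q) w - fluct N (b%:R * L) w|].
have mE q k : measurable (E q k).
  apply: measurable_gt_norm; apply: measurable_funB.
    by have [] := @fluct_mom N (b%:R * L + k%:R * h q) (addr_ge0 a0 (mulr_ge0 (ler0n _ k) (ltW (h0 q)))).
  by have [] := fluct_mom N a0.
pose A q := \bigcup_(k in `I_(2 ^ q).+1) E q k.
have mA q : measurable (A q) by apply: bigcup_measurable.
set bd := (_ / lam ^+ 4).
have PA q : fine (P (A q)) <= bd.
  have := fluct_grid_max (b * 2 ^ q) (2 ^ q) N (h0 q) lam0.
  rewrite hL (_ : (b * 2 ^ q)%:R * h q = b%:R * L); last by rewrite natrM -mulrA hL.
  rewrite /A /E; congr (fine (P _) <= _); apply: eq_bigcupr => k _.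
  by apply/funext => w /=; rewrite natrD mulrDl natrM -mulrA hL.
exists (\bigcup_q A q); split.
- exact: bigcup_measurable.
- have ndA : nondecreasing_seq A.
    apply/nondecreasing_seqP => q; apply/subsetPset => w [k /= kq Ek].
    exists (2 * k)%N; first by rewrite /= ltnS expnS leq_mul2l/= -ltnS.
    rewrite /E/= natrM (_ : 2 * k%:R * h q.+1 = k%:R * h q)//.
    by rewrite /h exprS; field; rewrite expf_neq0.
  have := @nondecreasing_cvg_mu _ _ _ P A mA (bigcupT_measurable _ mA) ndA.
  move=> cvP.
  have cvF : fine (P (A q)) @[q --> \oo] --> fine (P (\bigcup_q A q)).
    by apply: fine_cvg; rewrite fineK ?fin_num_measure//; exact: bigcup_measurable.
  by apply: (cvgr_to_le cvF); apply: nearW => q; exact: PA.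
- move=> w nA t /andP[bt tb]; rewrite leNgt; apply/negP => lt.
  have nE q k : (k <= 2 ^ q)%N -> ~ E q k w.
    by move=> kq Ek; apply: nA; exists q => //; exists k.
  (* The right end of the block is node 1 of the coarsest grid. Any other [t] has dyadic nodes of
     the block to its right. *)
  have := tb; rewrite le_eqVlt => /predU1P[tE|tlt].
    apply: (nE 0%N 1%N) => //; rewrite /E/= /h expr0 divr1 mul1r.
    by rewrite (_ : b%:R * L + L = t)// tE -natr1; ring.
  have [rc _] := fluct_cadlag N w.
  have t0 : 0 <= t by exact: le_trans bt.
  have cvx : `|fluct N s w - fluct N (b%:R * L) w| @[s --> t^'+] --> `|fluct N t w - fluct N (b%:R * L) w|.
    by apply: cvg_norm; apply: cvgB; [exact: rc|exact: cvg_cst].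
  have := cvgr_gt _ cvx lam lt.
  move=> [e /= e0 he].
  have [q hq] : exists q, h q < e.
    have : L * 2 ^- q @[q --> \oo] --> L * 0.
      by apply: cvgM; [exact: cvg_cst|exact: pow2_cvg0].
    rewrite mulr0 => /cvgrPdist_lt /(_ e e0) [q _ /(_ q (leqnn q))]/=.
    rewrite sub0r normrN ger0_norm; last by rewrite mulr_ge0 ?ltW// invr_gt0 exprn_gt0.
    by exists q.
  (* The first node strictly after [t]; its distance to [t] is at most the mesh, hence below [e]. *)
  pose k := (Num.truncn ((t - b%:R * L) / h q)).+1.
  have x0 : 0 <= (t - b%:R * L) / h q by rewrite divr_ge0 ?subr_ge0// ltW.
  have /andP[k1 k2] := truncn_itv x0.
  rewrite ler_pdivlMr// in k1; rewrite ltr_pdivrMr// in k2.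
  apply: (nE q k).
    rewrite /k -(ltr_nat R); rewrite -(ltr_pM2r (h0 q)) hL; apply: (le_lt_trans k1).
    by move: tlt; rewrite -natr1; lra.
  rewrite -/k in k2.
  have kS : k%:R * h q = (Num.truncn ((t - b%:R * L) / h q))%:R * h q + h q by rewrite /k -natr1; ring.
  rewrite /E/=; apply: he; last by lra.
  by rewrite /ball_/= ltr_distlC; have := h0 q; rewrite kS in k2 *; lra.
Qed.

(** With L = T0 / m, the bounds C L / N + 3 (C L)^2 of the [m] blocks add up to C T0 / N + 3 (C
    T0)^2 / m. *)
Lemma fluct_osc (T0 : R) : 0 < T0 -> exists2 C : R, 0 <= C & forall (N m : nat) (lam : R), (0 < m)%N -> 0 < lam ->
  exists A, [/\ measurable A, fine (P A) <= (C / N%:R + C / m%:R) / lam ^+ 4 &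
    forall w, ~ A w -> forall (b : nat) t, (b < m)%N ->
      b%:R * (T0 / m%:R) <= t <= b.+1%:R * (T0 / m%:R) ->
      `|fluct N t w - fluct N (b%:R * (T0 / m%:R)) w| <= lam].
Proof.
move=> T00; have [C C0 hC] := incr_const T0.
exists (C * T0 + 3 * (C * T0) ^+ 2).
  by apply: addr_ge0; [rewrite mulr_ge0// ltW|apply: mulr_ge0 => //; exact: sqr_ge0].
move=> N m lam m0 lam0; have mR : 0 < m%:R :> R by rewrite ltr0n.
pose L := T0 / m%:R; have L0 : 0 < L by rewrite divr_gt0.
have [A hA] := choice (fun b => block_osc N b L0 lam0).
have mA b : measurable (A b) by have [] := hA b.
exists (\bigcup_(b in `I_m) A b); split.
- exact: bigcup_measurable.
- apply: le_trans (Pr_union_le _ _ mA) _.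
  have LT : 0 <= L <= T0.
    by rewrite ltW//= ler_pdivrMr// ler_peMr ?ler1n// ltW.
  apply: (@le_trans _ _ (\sum_(b < m) (C * L / N%:R + 3 * (C * L) ^+ 2) / lam ^+ 4)).
    apply: ler_sum => b _; have [_ h _] := hA b; apply: (le_trans h).
    rewrite ler_wpM2r ?invr_ge0 ?exprn_ge0 ?(ltW lam0)//.
    have bL : 0 <= b%:R * L <= T0.
      rewrite mulr_ge0 ?(ltW L0)//= /L mulrCA ler_piMr ?(ltW T00)// ler_pdivrMr// mul1r ler_nat.
      exact: ltnW.
    have [k1 k2] := hC _ _ bL LT.
    apply: lerD; first by rewrite ler_wpM2r ?invr_ge0.
    rewrite ler_wpM2l// lerXn2r// nnegrE; [apply: sig2_ge0; exact: ltW|].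
    by rewrite mulr_ge0// ltW.
  rewrite sumr_const card_ord -[leLHS]mulr_natr [leLHS]mulrAC ler_wpM2r ?invr_ge0 ?exprn_ge0 ?(ltW lam0)//.
  have -> : (C * L / N%:R + 3 * (C * L) ^+ 2) * m%:R = C * T0 / N%:R + 3 * (C * T0) ^+ 2 / m%:R.
    rewrite mulrDl; congr (_ + _); rewrite /L; last by field; rewrite gt_eqF.
    by transitivity (C * T0 / N%:R * (m%:R / m%:R)); [ring|rewrite divff ?gt_eqF// mulr1].
  apply: lerD; rewrite ler_wpM2r ?invr_ge0//; first by rewrite lerDl mulr_ge0// sqr_ge0.
  by rewrite lerDr mulr_ge0// ltW.
- move=> w nA b t bm tb; have [_ _ h] := hA b; apply: h => // Aw.
  by apply: nA; exists b.
Qed.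

End Fluctuations.

(** * Lipschitz envelopes and interpolation *)

Section UniformContinuity.
Context {R : realType}.

Lemma uniformly_small_osc (f : R -> R) (T0 lam : R) : continuous f -> 0 < T0 -> 0 < lam ->
  \forall m \near \oo, forall x y, 0 <= x <= T0 -> `|y - x| <= T0 / m%:R -> `|f y - f x| <= lam.
Proof.
move=> cf T00 lam0.
pose Q (m : nat) (x : R) := forall y : R, `|y - x| <= T0 / m%:R -> `|f y - f x| <= lam.
have /compact_near_coveringP := @segment_compact R 0 T0.
move=> /(_ nat \oo Q _) cov.
have : \forall m \near \oo, [set` `[0, T0]] `<=` Q m.
  apply: cov => x _.
  have /cvgrPdist_lt /(_ (lam / 2)) : f y @[y --> x] --> f x by exact: cf.
  rewrite divr_gt0// => /(_ isT) [del /= del0 hd].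
  have hm : \forall m \near \oo, T0 / m%:R < del / 2.
    have [N _ hN] := nbhs_infty_ger (2 * T0 / del + 1).
    exists N.+1 => // m /= Nm; have mR : 2 * T0 / del + 1 <= m%:R by apply: hN => /=; exact: ltnW.
    have m0 : 0 < m%:R :> R by rewrite ltr0n (leq_trans _ Nm).
    rewrite ltr_pdivrMr//; have : 2 * T0 / del < m%:R by lra.
    by rewrite ltr_pdivrMr//; lra.
  exists (ball x (del / 2), [set m | T0 / m%:R < del / 2]) => /=.
    by split => //; apply: nbhsx_ballx; rewrite divr_gt0.
  move=> [x' m] /= [xx' mm] y yx'.
  have x'x : `|x - x'| < del / 2 by exact: xx'.
  have h1 : `|f x - f x'| < lam / 2 by apply: hd; rewrite /ball_/=; lra.
  have h2 : `|f x - f y| < lam / 2.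
    apply: hd; rewrite /ball_/=; apply: le_lt_trans (ler_distD x' _ _) _.
    by rewrite (distrC x' y); lra.
  apply: le_trans (ler_distD (f x) _ _) _; rewrite (distrC (f y)); lra.
apply: filterS => m h x y x0T; apply: h; by rewrite /= in_itv.
Qed.

End UniformContinuity.

(** * Envelopes and piecewise linear interpolation *)

Section Envelope.
Context {R : realType}.
Variable T0 : R.
Hypothesis T00 : 0 < T0.

Definition within_dist (x y : R -> R) (r : R) := forall t, 0 <= t <= T0 -> `|x t - y t| <= r.

Definition sup_continuous (g : (R -> R) -> R) := forall x, cadlag_on T0 x -> forall e : R, 0 < e ->
  exists2 del : R, 0 < del & forall y, cadlag_on T0 y -> within_dist x y del -> `|g x - g y| < e.

Section fixed.
Variables (g : (R -> R) -> R) (K : R).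
Hypothesis gK : forall x, `|g x| <= K.

Let Eset (n : nat) (x : R -> R) := [set v : R | exists y r,
  [/\ cadlag_on T0 y, 0 <= r, within_dist x y r & v = g y + n%:R * r]].

(* The Pasch-Hausdorff envelope: the largest n-Lipschitz minorant of g for the sup norm. *)
Definition envelope n x := inf (Eset n x).

Let lbE n x : lbound (Eset n x) (- K).
Proof.
move=> _ [y [r [_ r0 _ ->]]]; have := gK y; rewrite ler_norml => /andP[h _].
by apply: (le_trans h); rewrite lerDl mulr_ge0.
Qed.

Let hlbE n x : has_lbound (Eset n x). Proof. by exists (- K). Qed.

Let gE n x : cadlag_on T0 x -> Eset n x (g x).
Proof.
by move=> cx; exists x, 0; split => //; [move=> t _; rewrite subrr normr0|rewrite mulr0 addr0].
Qed.

Lemma envelope_le n x : cadlag_on T0 x -> envelope n x <= g x.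
Proof. by move=> cx; apply: ge_inf; [exact: hlbE|exact: gE]. Qed.

Lemma envelope_bound n x : cadlag_on T0 x -> `|envelope n x| <= K.
Proof.
move=> cx; rewrite ler_norml; apply/andP; split.
  by apply: lb_le_inf; [exists (g x); exact: gE|exact: lbE].
apply: le_trans (envelope_le n cx) _; exact: le_trans (ler_norm _) (gK x).
Qed.

Lemma envelope_lip n x x' r : cadlag_on T0 x' -> 0 <= r ->
  within_dist x x' r -> envelope n x <= envelope n x' + n%:R * r.
Proof.
move=> cx' r0 xx'; rewrite -lerBlDr; apply: lb_le_inf; first by exists (g x'); exact: gE.
move=> _ [y [q [cy q0 x'y ->]]]; rewrite lerBlDr; apply: ge_inf; first exact: hlbE.
exists y, (q + r); split => //; [exact: addr_ge0| |by ring].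
move=> t tT; apply: le_trans (ler_distD (x' t) _ _) _.
by rewrite addrC lerD//; [exact: x'y|exact: xx'].
Qed.

(** A competitor closer than [del] lies less than [e] below [g x] by continuity. One further away
    pays at least n del >= 2K, the whole range of [g]. *)
Lemma envelope_cvg x : cadlag_on T0 x -> sup_continuous g -> envelope n x @[n --> \oo] --> g x.
Proof.
move=> cx cg; apply/cvgrPdist_le => e e0.
have [del del0 hd] := cg x cx e e0.
have [N _ hN] := nbhs_infty_ger (2 * K / del).
exists N => // n /= Nn; have nR : 2 * K / del <= n%:R by exact: hN.
rewrite ler_pdivrMr// in nR.
rewrite ger0_norm ?subr_ge0 ?envelope_le// lerBlDl -lerBlDr.
apply: lb_le_inf; first by exists (g x); exact: gE.
move=> _ [y [r [cy r0 xy ->]]]; case: (ltP r del) => rd.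
  have : `|g x - g y| < e by apply: hd => // t tT; rewrite (le_trans (xy t tT))// ltW.
  rewrite ltr_distl => /andP[_ h]; have : 0 <= n%:R * r by rewrite mulr_ge0.
  by lra.
have : n%:R * del <= n%:R * r by rewrite ler_wpM2l.
have := gK x; have := gK y; rewrite !ler_norml => /andP[h1 h2] /andP[h3 h4]; lra.
Qed.

End fixed.

Section interpolation.
Variable m : nat.
Hypothesis m0 : (0 < m)%N.

Let mR : 0 < m%:R :> R. Proof. by rewrite ltr0n. Qed.

Let h : R := T0 / m%:R.
Let h0 : 0 < h. Proof. by rewrite divr_gt0. Qed.

(** A sum of clipped ramps instead of a case distinction on blocks: continuity in [t] and the
    Lipschitz dependence on [v] are then immediate. *)
Definition interpolate (v : nat -> R) (t : R) : R :=
  v 0%N + \sum_(b < m) (v b.+1 - v b) * clip01 ((t - b%:R * (T0 / m%:R)) / (T0 / m%:R)).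

Lemma continuous_interpolate v : continuous (interpolate v).
Proof.
move=> t; apply: cvgD; first exact: cvg_cst.
apply: cvg_sumr => b; apply: cvgM; first exact: cvg_cst.
have : (s - b%:R * h) / h @[s --> t] --> (t - b%:R * h) / h.
  by apply: cvgM; [apply: cvgB; [exact: cvg_id|exact: cvg_cst]|exact: cvg_cst].
move=> /cvgrPdist_le hc; apply/cvgrPdist_le => e /hc; apply: filterS => s.
by apply: le_trans; exact: clip01_lip.
Qed.

Lemma interpolate_lip v v' t :
  `|interpolate v t - interpolate v' t| <= 3 * \sum_(k < m.+1) `|v k - v' k|.
Proof.
set S := \sum_(k < m.+1) _.
have SE1 : S = `|v 0%N - v' 0%N| + \sum_(b < m) `|v b.+1 - v' b.+1| by rewrite /S big_ord_recl.
have SE2 : S = \sum_(b < m) `|v b - v' b| + `|v m - v' m| by rewrite /S big_ord_recr.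
have -> : interpolate v t - interpolate v' t = (v 0%N - v' 0%N) +
    \sum_(b < m) ((v b.+1 - v' b.+1) - (v b - v' b)) * clip01 ((t - b%:R * h) / h).
  rewrite /interpolate opprD addrACA -sumrB; congr (_ + _); apply: eq_bigr => b _; rewrite /h; ring.
apply: le_trans (ler_normD _ _) _.
have h1 : `|\sum_(b < m) ((v b.+1 - v' b.+1) - (v b - v' b)) * clip01 ((t - b%:R * h) / h)| <=
    \sum_(b < m) (`|v b.+1 - v' b.+1| + `|v b - v' b|).
  apply: le_trans (ler_norm_sum _ _ _) _; apply: ler_sum => b _.
  have /andP[c0 c1] := clip01_bound ((t - b%:R * h) / h).
  rewrite normrM (ger0_norm c0) -[leRHS]mulr1 ler_pM//.
  exact: ler_normB.
rewrite big_split/= in h1.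
have := normr_ge0 (v m - v' m).
have : 0 <= \sum_(b < m) `|v b.+1 - v' b.+1| by apply: sumr_ge0.
have : 0 <= \sum_(b < m) `|v b - v' b| by apply: sumr_ge0.
have := normr_ge0 (v 0%N - v' 0%N).
by lra.
Qed.

(** Ramps before block [b] have reached 1 and telescope; those after it are still 0. *)
Let interpolate_block (v : nat -> R) (b : nat) t : (b < m)%N -> b%:R * h <= t <= b.+1%:R * h ->
  interpolate v t = v b + (v b.+1 - v b) * clip01 ((t - b%:R * h) / h).
Proof.
move=> bm /andP[t1 t2].
have clip1 (k : nat) : (k < b)%N -> clip01 ((t - k%:R * h) / h) = 1.
  move=> kb; rewrite /clip01 min_l ?max_r// ler_pdivlMr// mul1r.
  have : k.+1%:R * h <= b%:R * h by rewrite ler_pM2r// ler_nat.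
  by rewrite -natr1 mulrDl mul1r; lra.
have clip0 (k : nat) : (b < k)%N -> clip01 ((t - k%:R * h) / h) = 0.
  move=> kb; have : (t - k%:R * h) / h <= 0.
    rewrite ler_pdivrMr// mul0r.
    have : b.+1%:R * h <= k%:R * h by rewrite ler_pM2r// ler_nat.
    by lra.
  by move=> hh; rewrite /clip01 max_l// ge_min hh orbT.
have part j : (j <= m)%N -> v 0%N + \sum_(k < j) (v k.+1 - v k) * clip01 ((t - k%:R * h) / h) =
    if (j <= b)%N then v j else v b + (v b.+1 - v b) * clip01 ((t - b%:R * h) / h).
  elim: j => [|j ih] jm; first by rewrite big_ord0 addr0.
  rewrite big_ord_recr/= addrA ih ?(ltnW jm)//.
  case: (ltngtP j b) => jb.
  - by rewrite (clip1 j jb); ring.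
  - by rewrite (clip0 j jb) mulr0 addr0.
  - by rewrite jb.
by rewrite /interpolate -/h part// leqNgt bm.
Qed.

Lemma interpolate_osc (x : R -> R) (lam : R) :
  (forall (b : nat) t, (b < m)%N -> b%:R * h <= t <= b.+1%:R * h -> `|x t - x (b%:R * h)| <= lam) ->
  within_dist x (interpolate (fun k => x (k%:R * h))) (2 * lam).
Proof.
move=> osc t /andP[t0 tT].
have [b bm tb] : exists2 b, (b < m)%N & b%:R * h <= t <= b.+1%:R * h.
  have mh : m%:R * h = T0 by rewrite /h; field; rewrite gt_eqF.
  move: tT; rewrite le_eqVlt => /predU1P[tT|tT].
    exists m.-1; first by rewrite prednK.
    by rewrite prednK// tT mh lexx andbT -[leRHS]mh ler_pM2r// ler_nat leq_pred.
  pose b := Num.truncn (t / h).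
  have /andP[b1 b2] := truncn_itv (divr_ge0 t0 (ltW h0)).
  rewrite ler_pdivlMr// in b1; rewrite ltr_pdivrMr// in b2.
  exists b; last by rewrite b1 ltW.
  by rewrite -(ltr_nat R) -(ltr_pM2r h0) mh (le_lt_trans b1).
rewrite (interpolate_block _ bm tb).
have h1 := osc b t bm tb.
have h2 : `|x (b.+1%:R * h) - x (b%:R * h)| <= lam.
  by apply: osc => //; rewrite lexx andbT ler_pM2r// ler_nat.
have /andP[c0 c1] := clip01_bound ((t - b%:R * h) / h).
rewrite opprD addrA; apply: le_trans (ler_normB _ _) _.
have : `|(x (b.+1%:R * h) - x (b%:R * h)) * clip01 ((t - b%:R * h) / h)| <= lam.
  by rewrite normrM (ger0_norm c0) -[leRHS]mulr1 ler_pM.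
by lra.
Qed.

End interpolation.

Lemma continuous_cadlag_on (x : R -> R) : continuous x -> cadlag_on T0 x.
Proof.
move=> cx; split => t _; first by apply: cvg_at_right_filter; exact: cx.
by apply/cvg_ex; exists (x t); apply: cvg_at_left_filter; exact: cx.
Qed.

End Envelope.

(** * Functional limits *)

Section FunctionalLimit.
Context {R : realType} {d d' : measure_display}.
Context {T : measurableType d} {T' : measurableType d'}.
Variables (P : probability T R) (Q : probability T' R).
Variables (X : nat -> R -> T -> R) (Y : R -> T' -> R) (T0 C : R).
Hypotheses (T00 : 0 < T0) (C0 : 0 <= C).
Hypotheses (mX : forall N t, 0 <= t -> measurable_fun setT (X N t))
  (mY : forall t, 0 <= t -> measurable_fun setT (Y t))
  (cadX : forall N w, cadlag_on T0 (X N ^~ w)) (contY : forall w, continuous (Y ^~ w)).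
Hypothesis fdd : forall (ts : nat -> R) (m : nat) (L M : R) h, (forall k, 0 <= ts k) ->
  lip_on m L h -> (forall x, `|h x| <= M) ->
  cvg_test P Q (fun N k => X N (ts k)) (fun k => Y (ts k)) h.
Hypothesis oscX : forall (N m : nat) (lam : R), (0 < m)%N -> 0 < lam ->
  exists A, [/\ measurable A, fine (P A) <= (C / N%:R + C / m%:R) / lam ^+ 4 &
    forall w, ~ A w -> forall (b : nat) t, (b < m)%N ->
      b%:R * (T0 / m%:R) <= t <= b.+1%:R * (T0 / m%:R) ->
      `|X N t w - X N (b%:R * (T0 / m%:R)) w| <= lam].

Section minorant.
Variables (g : (R -> R) -> R) (K : R).
Hypotheses (gK : forall x, `|g x| <= K) (cg : sup_continuous T0 g).

Let K0 : 0 <= K. Proof. exact: le_trans (gK id). Qed.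

Let H (n m : nat) (v : nat -> R) := envelope T0 g n (interpolate T0 m v).

Let cI m v : cadlag_on T0 (interpolate T0 m v).
Proof. exact/continuous_cadlag_on/continuous_interpolate. Qed.

Let HK n m v : `|H n m v| <= K. Proof. exact: envelope_bound. Qed.

(** The summand 1 keeps the constant positive at n = 0, as [lip_measurable] demands. *)
Let Hlip n m : lip_on m.+1 (3 * n%:R + 1) (H n m).
Proof.
move=> v v'; set S := \sum_(k < m.+1) _.
have S0 : 0 <= S by apply: sumr_ge0.
have S3 : 0 <= 3 * S by rewrite mulr_ge0.
have d1 : within_dist T0 (interpolate T0 m v) (interpolate T0 m v') (3 * S).
  by move=> t _; exact: interpolate_lip.
have d2 : within_dist T0 (interpolate T0 m v') (interpolate T0 m v) (3 * S).
  by move=> t /d1; rewrite distrC.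
have h1 := envelope_lip gK n (cI m v') S3 d1.
have h2 := envelope_lip gK n (cI m v) S3 d2.
by rewrite ler_distl /H mulrDl mul1r -mulrA [n%:R * _]mulrC mulrA; apply/andP; split; nra.
Qed.

Let grid m (k : nat) : R := k%:R * (T0 / m%:R).

Let grid_ge0 m k : 0 <= grid m k. Proof. by rewrite mulr_ge0// divr_ge0// ltW. Qed.

Let HX n m N w := H n m (fun k => X N (grid m k) w).
Let HY n m w := H n m (fun k => Y (grid m k) w).

Let mHX n m N : measurable_fun setT (HX n m N).
Proof.
apply: (@lip_measurable _ _ _ (fun k => X N (grid m k)) m.+1 (3 * n%:R + 1) (H n m)).
- by rewrite ltr_wpDl// mulr_ge0.
- exact: Hlip.
- by move=> k; exact: mX.
Qed.

Let mHY n m : measurable_fun setT (HY n m).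
Proof.
apply: (@lip_measurable _ _ _ (fun k => Y (grid m k)) m.+1 (3 * n%:R + 1) (H n m)).
- by rewrite ltr_wpDl// mulr_ge0.
- exact: Hlip.
- by move=> k; exact: mY.
Qed.

Let cadY w : cadlag_on T0 (Y ^~ w). Proof. exact: continuous_cadlag_on. Qed.

Let HY_cvg n w : HY n m w @[m --> \oo] --> envelope T0 g n (Y ^~ w).
Proof.
apply/cvgrPdist_le => e e0; pose lam := e / (2 * n%:R + 1).
have n0 : 0 < 2 * n%:R + 1 :> R by rewrite ltr_wpDl// mulr_ge0.
have lam0 : 0 < lam by rewrite divr_gt0.
have := uniformly_small_osc (@contY w) T00 lam0.
have : \forall m \near \oo, (0 < m)%N by exists 1%N.
apply: filterS2 => m m0 hm.
have d1 : within_dist T0 (Y ^~ w) (interpolate T0 m (fun k => Y (grid m k) w)) (2 * lam).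
  apply: (interpolate_osc T00 m0) => b t bm /andP[t1 t2]; apply: hm.
    rewrite mulr_ge0//=; last by rewrite divr_ge0// ltW.
    rewrite mulrA ler_pdivrMr ?ltr0n// mulrC ler_pM2l// ler_nat; exact: ltnW.
  rewrite ger0_norm ?subr_ge0// lerBlDr addrC; apply: (le_trans t2).
  by rewrite -natr1 mulrDl mul1r.
have d2 : within_dist T0 (interpolate T0 m (fun k => Y (grid m k) w)) (Y ^~ w) (2 * lam).
  by move=> t /d1; rewrite distrC.
have l2 : 0 <= 2 * lam by rewrite mulr_ge0// ltW.
have h1 := envelope_lip gK n (cI m (fun k => Y (grid m k) w)) l2 d1.
have h2 := envelope_lip gK n (cadY w) l2 d2.
have le : n%:R * (2 * lam) <= e.
  by rewrite /lam !mulrA ler_pdivrMr//; have := ler0n R n; nra.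
by rewrite ler_distl /HY /H; apply/andP; split; lra.
Qed.

Let menv n : measurable_fun setT (fun w => envelope T0 g n (Y ^~ w)).
Proof.
by apply: (@measurable_fun_cvg _ _ _ setT (fun m => HY n m)) => [m|w _]; [exact: mHY|exact: HY_cvg].
Qed.

(** [g] carries no measurability. Along the continuous paths of [Y] it is a limit of envelopes, and
    these are limits of functions of finitely many coordinates. *)
Lemma limit_functional_measurable : measurable_fun setT (fun w => g (Y ^~ w)).
Proof.
apply: (@measurable_fun_cvg _ _ _ setT (fun n w => envelope T0 g n (Y ^~ w))) => [n|w _].
  exact: menv.
exact: (envelope_cvg gK).
Qed.

(** The Lipschitz constant [n] is chosen first, then the grid size [m], then [N]. Six errors of e/6
    arise: envelope, interpolation of the limit, convergence on the grid, oscillation off [A], and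
    the two terms of the probability of [A]. *)
Lemma measurable_minorant (e : R) : 0 < e ->
  \forall N \near \oo, exists g1 : T -> R,
    [/\ bmeas g1, forall w, g1 w <= g (X N ^~ w) &
        Ex Q (fun w => g (Y ^~ w)) - e <= Ex P g1].
Proof.
move=> e0; have e5 : 0 < e / 6 by rewrite divr_gt0.
have c1 : Ex Q (fun w => envelope T0 g n (Y ^~ w)) @[n --> \oo] --> Ex Q (fun w => g (Y ^~ w)).
  apply: (@Ex_cvg _ _ _ Q _ _ K) => // [n w|w]; first exact: envelope_bound.
  exact: (envelope_cvg gK).
move/cvgrPdist_le : c1 => /(_ _ e5) [n _ /(_ n (leqnn n)) hn].
have c2 : Ex Q (HY n m) @[m --> \oo] --> Ex Q (fun w => envelope T0 g n (Y ^~ w)).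
  by apply: (@Ex_cvg _ _ _ Q _ _ K) => [m|m w|w]; [exact: mHY|exact: HK|exact: HY_cvg].
move/cvgrPdist_le : c2 => /(_ _ e5) hm1.
(* Interpolation moves a path by at most 2 lam and the envelope by at most 2 n lam, which this
   choice keeps below e/6, also for n = 0. *)
pose lam := e / 6 / (2 * n%:R + 1).
have n0 : 0 < 2 * n%:R + 1 :> R by rewrite ltr_wpDl// mulr_ge0.
have lam0 : 0 < lam by rewrite divr_gt0.
have nlam : n%:R * (2 * lam) <= e / 6.
  by rewrite /lam !mulrA ler_pdivrMr//; have := ler0n R n; nra.
pose D := 2 * K * C / lam ^+ 4.
have D0 : 0 <= D by rewrite divr_ge0 ?exprn_ge0 ?(ltW lam0)// !mulr_ge0.
have hD : \forall m \near \oo, D / m%:R <= e / 6.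
  have [M _ hM] := nbhs_infty_ger (D / (e / 6)).
  exists M.+1 => // m /= Mm; have : D / (e / 6) <= m%:R by apply: hM => /=; exact: ltnW.
  have m0 : 0 < m%:R :> R by rewrite ltr0n (leq_trans _ Mm).
  by rewrite ler_pdivrMr// => hDm; rewrite ler_pdivrMr// mulrC.
have [m [m0 hm hDm]] : exists m, [/\ (0 < m)%N, `|Ex Q (fun w => envelope T0 g n (Y ^~ w)) - Ex Q (HY n m)| <= e / 6 & D / m%:R <= e / 6].
  have hm0 : \forall m \near \oo, (0 < m)%N by exists 1%N.
  have := filterI hm0 (filterI hm1 hD).
  by move=> [m _ /(_ m (leqnn m)) [h1 [h2 h3]]]; exists m.
have := fdd (grid_ge0 m) (@Hlip n m) (@HK n m).
move=> /cvgrPdist_le /(_ _ e5).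
apply: filterS2 hD => N hDN; rewrite -/(HY n m) -/(HX n m N) => hN.
have [A [mA PA oscA]] := oscX N m0 lam0.
(* The drop by 2K on [A] brings [g1] below [g] there, whatever the path does; the drop by e/6 pays
   for the interpolation elsewhere. *)
pose g1 w := HX n m N w - e / 6 - 2 * K * \1_A w.
have m1 : mom P (HX n m N) by apply: bmeas_mom; split => //; exists K => w; exact: HK.
have mi : mom P (\1_A : T -> R) by exact: mom_indic.
exists g1; split.
- split.
    by have [] := momB (momB m1 (mom_cst P (e / 6))) (momZ (2 * K) mi).
  exists (K + e / 6 + 2 * K) => w; rewrite /g1.
  apply: le_trans (ler_normB _ _) _; apply: lerD.
    by apply: le_trans (ler_normB _ _) _; rewrite (gtr0_norm e5) lerD2r HK.
  rewrite normrM ger0_norm ?mulr_ge0// -[leRHS]mulr1 ler_wpM2l ?mulr_ge0//.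
  by rewrite indicE; case: (_ \in _); rewrite ?normr1 ?normr0.
- move=> w; rewrite /g1 indicE; case: (boolP (w \in A)) => [_|].
    have := gK (X N ^~ w); have := HK n m (fun k => X N (grid m k) w).
    by rewrite /HX mulr1 !ler_norml => /andP[h1 h2] /andP[h3 h4]; lra.
  move=> /negP; rewrite inE => nA; rewrite mulr0 subr0.
  have l2 : 0 <= 2 * lam by rewrite mulr_ge0// ltW.
  have d1 : within_dist T0 (X N ^~ w) (interpolate T0 m (fun k => X N (grid m k) w)) (2 * lam).
    by apply: (interpolate_osc T00 m0) => b t bm tb; apply: oscA.
  have d2 : within_dist T0 (interpolate T0 m (fun k => X N (grid m k) w)) (X N ^~ w) (2 * lam).
    by move=> t /d1; rewrite distrC.
  have h1 := envelope_lip gK n (cadX N w) l2 d2.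
  have h2 := envelope_le gK n (cadX N w).
  by rewrite /HX /H; lra.
- rewrite /g1 ExB; [|by apply/mom_L1/momB => //; exact: mom_cst|exact/mom_L1/momZ].
  rewrite ExB; [|exact/mom_L1|exact: L1_cst].
  rewrite Ex_cst ExZ; last exact/mom_L1.
  rewrite Ex_indic//.
  have PA' : 2 * K * fine (P A) <= D / N%:R + D / m%:R.
    apply: (@le_trans _ _ (2 * K * ((C / N%:R + C / m%:R) / lam ^+ 4))).
      by rewrite ler_wpM2l// mulr_ge0.
    by rewrite le_eqVlt; apply/orP; left; apply/eqP; rewrite /D; ring.
  move: hn hm hN hDN hDm PA'; rewrite !ler_distl => /andP[a1 a2] /andP[a3 a4] /andP[a5 a6] a7 a8 a9.
  lra.
Qed.

End minorant.

End FunctionalLimit.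

(** * Integrals of functions that need not be measurable *)

Section Sandwich.
Context {R : realType} {d : measure_display} {T : measurableType d}.
Variable P : probability T R.

(* No measurability: the integral of a nonnegative function is a supremum over simple minorants. *)
Let ge0_integral_mono (f g : T -> \bar R) : (forall w, (0 <= f w)%E) -> (forall w, (f w <= g w)%E) ->
  (\int[P]_w f w <= \int[P]_w g w)%E.
Proof.
move=> f0 fg; have g0 w : (0 <= g w)%E by exact: le_trans (fg w).
rewrite !ge0_integralTE//; apply: le_ereal_sup => _ [h hf <-]; exists h => //= w.
exact: le_trans (fg w).
Qed.

Let integral_mono (f g : T -> \bar R) : (forall w, (f w <= g w)%E) -> (\int[P]_w f w <= \int[P]_w g w)%E.
Proof.
move=> fg; rewrite integralE [leRHS]integralE; apply: leeB; apply: ge0_integral_mono => // w.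
- by apply: (@funepos_le _ _ setT) => [v _|]; [exact: fg|rewrite inE].
- by apply: (@funeneg_le _ _ setT) => [v _|]; [exact: fg|rewrite inE].
Qed.

Lemma integral_sandwich (F : T -> R) (g1 g2 : T -> R) : bmeas g1 -> bmeas g2 ->
  (forall w, g1 w <= F w) -> (forall w, F w <= g2 w) ->
  exists2 a : R, (\int[P]_w (F w)%:E)%E = a%:E & Ex P g1 <= a <= Ex P g2.
Proof.
move=> h1 h2 g1F Fg2.
have l1 : ((Ex P g1)%:E <= \int[P]_w (F w)%:E)%E.
  by rewrite -ExE; [apply: integral_mono => w; rewrite lee_fin|exact: bmeas_L1].
have l2 : (\int[P]_w (F w)%:E <= (Ex P g2)%:E)%E.
  by rewrite -ExE; [apply: integral_mono => w; rewrite lee_fin|exact: bmeas_L1].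
exists (fine (\int[P]_w (F w)%:E)).
  rewrite fineK// fin_numE; apply/andP; split; apply/eqP => E.
    by move: l1; rewrite E leeNy_eq.
  by move: l2; rewrite E leye_eq.
move: l1 l2; case: (\int[P]_w _)%E => [r| |].
- by rewrite !lee_fin /= => -> ->.
- by rewrite leye_eq.
- by rewrite leeNy_eq.
Qed.

End Sandwich.

(** * The limit process *)

Section SkorokhodSup.
Context {R : realType}.
Variable T0 : R.
Hypothesis T00 : 0 < T0.

Lemma cadlag_on_mul (c x : R -> R) : continuous c -> cadlag_on T0 x -> cadlag_on T0 (fun t => c t * x t).
Proof.
move=> cc [rx lx]; split => t tT.
  by apply: cvgM; [apply: cvg_at_right_filter; exact: cc|exact: rx].
apply: is_cvgM; last exact: lx.
by apply/cvg_ex; exists (c t); apply: cvg_at_left_filter; exact: cc.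
Qed.

Lemma cadlag_on_eq (x y : R -> R) : (forall t, 0 <= t -> x t = y t) -> cadlag_on T0 x -> cadlag_on T0 y.
Proof.
move=> xy [rx lx]; split => t /andP[t0 tT].
  rewrite -xy//; apply: cvg_trans (rx t _); last by rewrite t0.
  apply: near_eq_cvg; near=> s; apply: xy; apply: (le_trans t0).
  by near: s; exact: nbhs_right_ge.
have /cvg_ex[l hl] := lx t (introT andP (conj t0 tT)).
apply/cvg_ex; exists l; apply: cvg_trans hl.
apply: near_eq_cvg; near=> s; apply: xy; apply: ltW.
by near: s; exact: nbhs_left_gt.
Unshelve. all: by end_near. Qed.

Variable f : (R -> R) -> R.
Hypothesis cf : skorokhod_continuous T0 f.

(** The identity is an admissible time change; halving [del] makes the inequality strict. *)
Lemma skorokhod_sup_continuous : sup_continuous T0 f.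
Proof.
move=> x cx e e0; have [del del0 hd] := cf cx e0.
exists (del / 2); first by rewrite divr_gt0.
move=> y cy xy; apply: (hd y id cy); first split => //.
  by apply: continuous_subspaceT => t; exact: cvg_id.
move=> t tT; rewrite subrr normr0; split => //.
by apply: le_lt_trans (xy t tT) _; lra.
Qed.

(** Paths are functions on the whole line, while [normalized_ZN_fluct] identifies them for t >= 0
    only. Continuity of [f] at sup distance zero removes the difference. *)
Lemma skorokhod_ext (x y : R -> R) : cadlag_on T0 x -> (forall t, 0 <= t -> x t = y t) -> f x = f y.
Proof.
move=> cx xy; have cy := cadlag_on_eq xy cx.
apply/eqP; rewrite -subr_eq0 -normr_le0; apply/ler_addgt0Pl => e e0; rewrite addr0.
have [del del0 hd] := skorokhod_sup_continuous cx e0.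
by apply/ltW/hd => // t /andP[t0 _]; rewrite xy// subrr normr0 ltW.
Qed.

Lemma sup_continuous_mul (c : R -> R) (K : R) : continuous c -> 0 < K ->
  (forall t, 0 <= t <= T0 -> `|c t| <= K) -> sup_continuous T0 (fun x => f (fun t => c t * x t)).
Proof.
move=> cc K0 cK x cx e e0.
have [del del0 hd] := skorokhod_sup_continuous (cadlag_on_mul cc cx) e0.
exists (del / K); first by rewrite divr_gt0.
move=> y cy xy; apply: hd => [|t tT]; first exact: cadlag_on_mul.
have -> : c t * x t - c t * y t = c t * (x t - y t) by ring.
rewrite normrM (le_trans (ler_pM _ _ (cK t tT) (xy t tT)))//.
by rewrite mulrC divfK// gt_eqF.
Qed.

End SkorokhodSup.

(** * The Gaussian law of the time-changed bridge *)

Section TimeChangedBridge.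
Context {R : realType} {d : measure_display} {T : measurableType d}.
Variables (Q : probability T R) (B : R -> T -> R).
Hypotheses (mB : forall x, measurable_fun setT (B x)) (contB : forall w, continuous (B ^~ w : R -> R))
  (posB : forall s : seq (R * R), 0 <= quad_form bcov s)
  (cosB : forall s th, Ex Q (fun w => cos (lin_time s B w + th)) = cos th * expR (- (quad_form bcov s / 2))).
Variable gam : R.
Hypothesis gam0 : 0 <= gam.

Definition growing_bridge (t : R) (w : T) : R := expR (t * gam) * B (1 - expR (- (t * gam))) w.

Let K (x y : R) : R := expR (Num.min x y * gam) - 1.

(** For x <= y the left side is e^(gam x) e^(gam y) (1 - e^(-gam x)) e^(-gam y) = e^(gam x) - 1, the
    covariance that [expmart_cov] finds for the martingales. *)
Let bridgeK (x y : R) : 0 <= x -> 0 <= y ->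
  expR (x * gam) * expR (y * gam) * bcov (1 - expR (- (x * gam))) (1 - expR (- (y * gam))) = K x y.
Proof.
wlog xy : x y / x <= y.
  move=> W x0 y0; case: (leP x y) => [xy|/ltW yx]; first by apply: W.
  have bs a b : bcov a b = bcov b a :> R by rewrite /bcov [Num.min a b]minC [Num.max a b]maxC.
  by rewrite bs [_ * expR (y * gam)]mulrC W// /K minC.
move=> x0 y0; have h : expR (- (y * gam)) <= expR (- (x * gam)).
  by rewrite ler_expR lerN2 ler_wpM2r.
have hx : expR (- (x * gam)) <= 1 by rewrite -[leRHS]expR0 ler_expR oppr_le0 mulr_ge0.
have hy := expR_ge0 (- (y * gam)).
rewrite /bcov /K (min_l xy) min_l ?max_r; [|lra..].
rewrite subKr !expRN; field.
by rewrite !gt_eqF ?expR_gt0.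
Qed.

Lemma growing_bridge_measurable t : measurable_fun setT (growing_bridge t).
Proof. exact: measurable_funM. Qed.

Lemma growing_bridge_continuous w : continuous (growing_bridge ^~ w).
Proof.
move=> t; apply: cvgM.
  apply: (@cvg_comp _ _ _ _ expR _ (nbhs (t * gam))); last exact: continuous_expR.
  by apply: cvgM; [exact: cvg_id|exact: cvg_cst].
apply: (@cvg_comp _ _ _ (fun s => 1 - expR (- (s * gam))) (B ^~ w) _ (nbhs (1 - expR (- (t * gam))))); last exact: contB.
apply: cvgB; first exact: cvg_cst.
apply: (@cvg_comp _ _ _ _ expR _ (nbhs (- (t * gam)))); last exact: continuous_expR.
by apply: cvgN; apply: cvgM; [exact: cvg_id|exact: cvg_cst].
Qed.

Section fdd.
Variables (ts : nat -> R) (s : seq (nat * R)).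
Hypothesis ts_ge0 : forall k, 0 <= ts k.

Let s' := [seq (1 - expR (- (ts p.1 * gam)), p.2 * expR (ts p.1 * gam)) | p <- s].

Let quadE : quad_form bcov s' = quad_form K [seq (ts p.1, p.2) | p <- s].
Proof.
rewrite /quad_form !big_map; apply: eq_bigr => p _; rewrite !big_map; apply: eq_bigr => q _ /=.
by rewrite -bridgeK//; ring.
Qed.

Lemma growing_bridge_quad_ge0 : 0 <= quad_form K [seq (ts p.1, p.2) | p <- s].
Proof. by rewrite -quadE. Qed.

Lemma growing_bridge_cos th :
  Ex Q (fun w => cos (lin s (fun k => growing_bridge (ts k) w) + th)) =
  cos th * expR (- (quad_form K [seq (ts p.1, p.2) | p <- s] / 2)).
Proof.
rewrite -quadE -cosB; congr Ex; apply/funext => w; congr cos; congr (_ + _).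
rewrite /lin /lin_time /s' big_map; apply: eq_bigr => p _ /=.
by rewrite /growing_bridge; ring.
Qed.

End fdd.

Variables (psi : R -> R).
Hypothesis gamE : gam = psi 2 - 2 * psi 1.

Let G (t : R) (w : T) : R := expR (psi 1 * t) * growing_bridge t w.

Let covE x y : cov_fn psi x y = expR (psi 1 * x) * expR (psi 1 * y) * K x y.
Proof.
have mm : Num.min x y + Num.max x y = x + y by exact: addr_min_max.
rewrite /cov_fn/= mm /K [RHS]mulrBr mulr1 -!expRD; congr (_ - _); last by congr expR; ring.
congr expR; have -> : Num.max x y = x + y - Num.min x y by rewrite -mm; ring.
by rewrite gamE; ring.
Qed.

(** Scaling the coefficients by [u] gives the whole cosine transform of [Y], and [law_eq_cos]
    compares it with that of the point mass at 0 or of the normal law of variance [v]. *)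
Lemma growing_bridge_gaussian : centered_gaussian_process Q G (cov_fn psi).
Proof.
split=> [t t0|n ts c ts0 Y v]; first by apply: measurable_funM => //; exact: growing_bridge_measurable.
pose s u := [seq (k, u * (c k * expR (psi 1 * ts k))) | k <- index_iota 0 n].
have linE u w : lin (s u) (fun k => growing_bridge (ts k) w) = u * Y w.
  rewrite /lin /s big_map big_mkord /Y mulr_sumr; apply: eq_bigr => k _ /=.
  by rewrite /G; ring.
have quadE u : quad_form K [seq (ts p.1, p.2) | p <- s u] = u ^+ 2 * v.
  rewrite /quad_form /s -map_comp big_map big_mkord /v mulr_sumr; apply: eq_bigr => j _.
  rewrite big_map big_mkord mulr_sumr; apply: eq_bigr => k _ /=.
  by rewrite covE; ring.
have v0 : 0 <= v by rewrite -[v]mul1r -[1](expr1n _ 2) -quadE; exact: growing_bridge_quad_ge0.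
have mY : measurable_fun setT Y.
  apply: measurable_sum => k; apply: measurable_funM => //.
  by apply: measurable_funM => //; exact: growing_bridge_measurable.
have cosY u th : Ex Q (fun w => cos (u * Y w + th)) = cos th * expR (- (u ^+ 2 * v / 2)).
  rewrite -quadE -(growing_bridge_cos (s u) ts0 th).
  by congr Ex; apply/funext => w; rewrite linE.
split => // [v00|v_gt0 A mA].
  have := @law_eq_cos _ _ _ Q _ _ Q Y (fun=> 0) mY (@measurable_cst _ _ _ _ _ _) _ [set 0] (measurable_set1 _).
  have -> : Q ((fun=> 0 : R) @^-1` [set 0]) = 1%E.
    by rewrite -[RHS](@probability_setT _ _ _ Q); congr (Q _); apply/seteqP; split.
  apply=> u th; rewrite cosY v00 mulr0 mul0r oppr0 expR0 mulr1.
  by under [X in Ex _ X]funext do rewrite mulr0 add0r; rewrite Ex_cst.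
have s0 : 0 < Num.sqrt v by rewrite sqrtr_gt0.
have := @law_eq_cos _ _ _ Q _ _ (toR (normal_prob 0 (Num.sqrt v))) Y id mY (@measurable_id _ _ _) _ A mA.
apply=> u th; rewrite cosY Ex_toR.
  by rewrite (normal_cos s0 th u) sqr_sqrtr// [v * _]mulrC.
split; last by exists 1 => x; exact: cos_le1_norm.
by apply: measurable_cos_fun; apply: measurable_funD => //; exact: measurable_funM.
Qed.

End TimeChangedBridge.

(** * Weak convergence *)

Section WeakConvergence.
Context {R : realType} {d : measure_display} {T : measurableType d}.
Variables (P : probability T R) (xi : nat -> R -> T -> R).
Hypotheses (levy_xi : forall i, levy_process P (xi i)) (iid_xi : iid_copies P xi)
  (fin0 : forall u : R, (\int[P]_w (expR (u * xi 0%N 1 w))%:E < +oo)%E).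

Let psi := log_mgf P (xi 0%N 1).
Local Notation gam := (psi 2 - 2 * psi 1).

Let mexp i (t : R) : 0 <= t -> mom P (fun w => expR (xi i t w)) /\ Ex P (fun w => expR (xi i t w)) = expR (psi 1 * t).
Proof.
move=> t0; have fi := levy_fin levy_xi iid_xi fin0 i; have pi := levy_psi levy_xi iid_xi i.
have -> : (fun w => expR (xi i t w)) = (fun w => expR (1 * xi i t w)).
  by apply/funext => w; rewrite mul1r.
split; first exact: (levy_mom (levy_xi i) fi).
by rewrite (levy_mgf (levy_xi i) fi 1 t0) pi mulrC.
Qed.

Lemma normalized_ZN_fluct N w (t : R) : 0 <= t -> expR (psi 1 * t) * fluct P xi N t w = normalized_ZN P xi N w t.
Proof.
move=> t0; rewrite /normalized_ZN /fluct.
have -> : fine (\int[P]_v (ZN xi N t v)%:E) = \sum_(i < N) expR (psi 1 * t).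
  rewrite -[LHS]/(Ex P (fun v => \sum_(i < N) expR (xi i t v))) Ex_sum.
    by apply: eq_bigr => i _; case: (mexp i t0).
  by move=> i; apply: mom_L1; case: (mexp i t0).
rewrite /ZN -sumrB mulrCA [RHS]mulrC; congr (_ * _); rewrite mulr_sumr; apply: eq_bigr => i _.
by rewrite mulrBr mulr1 /expmart -expRD; congr (expR _ - _); rewrite -/psi; ring.
Qed.

Context {d' : measure_display} {T' : measurableType d'}.
Variables (Q : probability T' R) (B : R -> T' -> R).
Hypotheses (mB : forall x, measurable_fun setT (B x)) (contB : forall w, continuous (B ^~ w : R -> R))
  (cosB : forall s th, Ex Q (fun w => cos (lin_time s B w + th)) = cos th * expR (- (quad_form bcov s / 2))).

Let gam0 : 0 <= gam. Proof. exact: expmart_var_ge0 (levy_xi 0%N) fin0. Qed.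

Lemma fluct_fdd (ts : nat -> R) (m : nat) (L M : R) h : (forall k, 0 <= ts k) ->
  lip_on m L h -> (forall x, `|h x| <= M) ->
  cvg_test P Q (fun N k => fluct P xi N (ts k)) (fun k => growing_bridge B gam (ts k)) h.
Proof.
move=> ts0; apply: cvg_lip.
- by move=> N k; have [] := fluct_mom levy_xi iid_xi fin0 N (ts0 k).
- by move=> k; exact: growing_bridge_measurable.
- move=> s th; rewrite /cvg_test (growing_bridge_cos cosB gam0)//.
  exact: fluct_cos.
- move=> k e e0; have [A A0 hA] := fluct_tight levy_xi iid_xi fin0 (ts0 k) e0.
  have [n [_ hn]] : exists n : nat, True /\ fine (Q [set w | n%:R < `|growing_bridge B gam (ts k) w|]) <= e.
    have := tight_single Q (growing_bridge_measurable mB gam (ts k)) e0.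
    by move=> [n _ /(_ n (leqnn n))]; exists n.
  exists (Num.max A n%:R); split; first by rewrite lt_max A0.
    move=> N; apply: le_trans (hA N); rewrite fine_le ?fin_num_measure//.
    + by apply: measurable_gt_norm; have [] := fluct_mom levy_xi iid_xi fin0 N (ts0 k).
    + by apply: measurable_gt_norm; have [] := fluct_mom levy_xi iid_xi fin0 N (ts0 k).
    + apply: le_measure; rewrite ?inE.
      * by apply: measurable_gt_norm; have [] := fluct_mom levy_xi iid_xi fin0 N (ts0 k).
      * by apply: measurable_gt_norm; have [] := fluct_mom levy_xi iid_xi fin0 N (ts0 k).
      * by move=> w /=; rewrite gt_max => /andP[].
  apply: le_trans hn; rewrite fine_le ?fin_num_measure//.
  + by apply: measurable_gt_norm; exact: growing_bridge_measurable.
  + by apply: measurable_gt_norm; exact: growing_bridge_measurable.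
  + apply: le_measure; rewrite ?inE.
    * by apply: measurable_gt_norm; exact: growing_bridge_measurable.
    * by apply: measurable_gt_norm; exact: growing_bridge_measurable.
    * by move=> w /=; rewrite gt_max => /andP[].
Qed.

(** The deterministic factor e^(psi(1) t) is moved from the path into the functional: [g] is [f]
    after multiplication by it, and is still continuous for the sup norm. *)
Lemma normalized_ZN_weak_conv (T0 : R) : 0 < T0 ->
  weak_conv_D P T0 Q (normalized_ZN P xi) (fun w t => expR (psi 1 * t) * growing_bridge B gam t w).
Proof.
move=> T00 f cf [K fK].
pose c t := expR (psi 1 * t).
have cc : continuous c.
  move=> t; apply: (@cvg_comp _ _ _ _ expR _ (nbhs (psi 1 * t))); last exact: continuous_expR.
  by apply: cvgM; [exact: cvg_cst|exact: cvg_id].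
pose g x := f (fun t => c t * x t).
have gK x : `|g x| <= K by exact: fK.
have cg : sup_continuous T0 g.
  apply: (sup_continuous_mul cf cc (expR_gt0 (`|psi 1| * T0))) => t /andP[t0 tT].
  rewrite ger0_norm ?expR_ge0// ler_expR (le_trans (ler_norm _))// normrM (ger0_norm t0).
  by rewrite ler_wpM2l.
have cgN : sup_continuous T0 (fun x => - g x).
  move=> x cx e e0; have [del del0 hd] := cg x cx e e0; exists del => // y cy xy.
  by rewrite -opprD normrN; exact: hd.
have [C C0 osc] := fluct_osc levy_xi iid_xi fin0 T00.
have mX N t : 0 <= t -> measurable_fun setT (fluct P xi N t).
  by move=> t0; have [] := fluct_mom levy_xi iid_xi fin0 N t0.
have mY t : 0 <= t -> measurable_fun setT (growing_bridge B gam t).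
  by move=> _; exact: growing_bridge_measurable.
have cadX N w : cadlag_on T0 (fluct P xi N ^~ w).
  have [rc lc] := fluct_cadlag levy_xi N w.
  by split => t /andP[t0 _]; [exact: rc|exact: lc].
have contY w : continuous (growing_bridge B gam ^~ w) by exact: growing_bridge_continuous.
have fX N w : f (normalized_ZN P xi N w) = g (fluct P xi N ^~ w).
  apply/esym; apply: (skorokhod_ext cf); first exact: cadlag_on_mul.
  by move=> t; exact: normalized_ZN_fluct.
pose Y t w := growing_bridge B gam t w.
have mgY : measurable_fun setT (fun w => g (Y ^~ w)).
  by apply: (limit_functional_measurable T00 mY contY gK cg).
have LgY : L1 Q (fun w => g (Y ^~ w)) by apply: bmeas_L1; split => //; exists K.
rewrite [X in _ --> X](_ : _ = (Ex Q (fun w => g (Y ^~ w)))%:E); last by rewrite -ExE.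
(* Finiteness of the integral is part of the claim: for a function that need not be measurable it
   comes from the sandwich, for large [N] only. *)
have key e : 0 < e -> \forall N \near \oo, exists2 a : R,
    (\int[P]_w (f (normalized_ZN P xi N w))%:E)%E = a%:E & `|Ex Q (fun w => g (Y ^~ w)) - a| <= e.
  move=> e0.
  have h1 := measurable_minorant T00 C0 mX mY cadX contY fluct_fdd osc gK cg e0.
  have gKN x : `|- g x| <= K by rewrite normrN.
  have h2 := measurable_minorant T00 C0 mX mY cadX contY fluct_fdd osc gKN cgN e0.
  apply: filterS2 h1 h2 => N [g1 [b1 l1 i1]] [g2 [b2 l2 i2]].
  have b2' : bmeas (fun w => - g2 w).
    have [mg2 [M hM]] := b2; split; first exact: measurableT_comp.
    by exists M => w; rewrite normrN.
  have [|w|a aE /andP[a1 a2]] := integral_sandwich P b1 b2' (F := fun w => f (normalized_ZN P xi N w)).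
  - by move=> w; rewrite fX.
  - by rewrite fX -lerN2 opprK.
  exists a => //.
  have E2 : Ex P (fun w => - g2 w) = - Ex P g2.
    have -> : (fun w => - g2 w) = (fun w => (-1) * g2 w) by apply/funext => w; rewrite mulN1r.
    by rewrite ExZ ?mulN1r//; exact: bmeas_L1.
  have E3 : Ex Q (fun w => - g (Y ^~ w)) = - Ex Q (fun w => g (Y ^~ w)).
    have -> : (fun w => - g (Y ^~ w)) = (fun w => (-1) * g (Y ^~ w)) by apply/funext => w; rewrite mulN1r.
    by rewrite ExZ ?mulN1r.
  rewrite E2 in a2; rewrite -/(Y) E3 in i2.
  by rewrite ler_distl; apply/andP; split; lra.
apply/fine_cvgP; split.
  by apply: filterS (key 1 ltr01) => N [a -> _].
apply/cvgrPdist_le => e /key; apply: filterS => N [a aE ha].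
by rewrite /= aE.
Qed.

End WeakConvergence.

Theorem theorem1p1 (R : realType) (d : measure_display) (Omega : measurableType d)
  (P : probability Omega R) (xi : nat -> R -> Omega -> R) :
  (forall i, levy_process P (xi i)) ->
  iid_copies P xi ->
  (forall c : R, P [set w | xi 0%N 1 w = c] <> 1%E) ->
  (forall u : R, (\int[P]_w (expR (u * xi 0%N 1 w))%:E < +oo)%E) ->
  let psi := log_mgf P (xi 0%N 1) in
  exists (d' : measure_display) (Om' : measurableType d') (Q : probability Om' R)
         (G : R -> Om' -> R),
    [/\ centered_gaussian_process Q G (cov_fn psi),
        (forall w, cadlag_path (fun t => G t w)) &
        forall T : R, 0 < T ->
          weak_conv_D P T Q (normalized_ZN P xi) (fun w t => G t w)].
Proof.
move=> levy_xi iid_xi _ fin0 psi.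
have gam0 : 0 <= psi 2 - 2 * psi 1 := expmart_var_ge0 (levy_xi 0%N) fin0.
have [B [mB contB posB cosB]] := @brownian_bridge_exists R.
exists _, _, (@unif R), (fun t w => expR (psi 1 * t) * growing_bridge B (psi 2 - 2 * psi 1) t w); split.
- exact: (growing_bridge_gaussian mB posB cosB gam0 erefl).
- move=> w.
  have cG : continuous (fun t => expR (psi 1 * t) * growing_bridge B (psi 2 - 2 * psi 1) t w).
    move=> t; apply: cvgM; last exact: growing_bridge_continuous.
    apply: (@cvg_comp _ _ _ _ expR _ (nbhs (psi 1 * t))); last exact: continuous_expR.
    by apply: cvgM; [exact: cvg_cst|exact: cvg_id].
  split=> t t0; first by apply: cvg_at_right_filter; exact: cG.
  apply/cvg_ex; exists (expR (psi 1 * t) * growing_bridge B (psi 2 - 2 * psi 1) t w).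
  by apply: cvg_at_left_filter; exact: cG.
- by move=> T T0; apply: normalized_ZN_weak_conv.
Qed.
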